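(* The classical versions of $\mathbf{emTT}$ and $\mathbf{mTT}$ (the extensional and intensional levels of the Minimalist Foundation, each extended with $\phi\lor\neg\phi$ for all propositions $\phi$) do not validate the number-theoretic internal rule of unique choice, and hence do not validate the number-theoretic axiom of unique choice $$(\mathbf{AC!}_{\mathsf{N},\mathsf{N}})\qquad \forall_{x\in\mathsf{N}}\ \exists!_{y\in\mathsf{N}}\ R(x,y)\ \rightarrow\ \exists_{f\in\mathsf{N}\to\mathsf{N}}\ \forall_{x\in\mathsf{N}}\ R(x,f(x)).$$
   Context: Both $\mathbf{mTT}$ and $\mathbf{emTT}$ are dependent type theories in the style of Martin-Löf with four kinds of types: small propositions ($\mathit{prop}_s$), propositions ($\mathit{prop}$), sets, and collections. Every small proposition is a proposition and a set; every set and every proposition is a collection. $\mathbf{mTT}$ is intensional, $\mathbf{emTT}$ extensional. Sets of both: the empty set, the singleton, lists $List(A)$ over a set $A$ (hence the natural numbers $\mathsf{N}$), $\Sigma_{x\in A}B(x)$ and $\Pi_{x\in A}B(x)$ for families of sets over a set, disjoint sums, and small propositions, with the rules of first-order (intensional, resp. extensional) Martin-Löf type theory; inductive sets eliminate towards all collections. $\mathbf{emTT}$ also has effective quotients $A/R$ of a set by a small equivalence relation. $\mathsf{N}\to\mathsf{N}$ is the set of $\lambda$-terms (non-dependent $\Pi$). Collections of both: sets, propositions and $\Sigma_{x\in A}B(x)$ for families of collections. In addition $\mathbf{mTT}$ has the collection $\mathsf{prop_s}$ of (codes of) small propositions and $A\to\mathsf{prop_s}$ for a set $A$; $\mathbf{emTT}$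 has $\mathcal{P}(1)$ and $A\to\mathcal{P}(1)$ for a set $A$, where $\mathcal{P}(1)$ is the quotient of the collection of small propositions by equiprovability: each small $\phi$ gives $[\phi]\in\mathcal{P}(1)$, $[\phi]=[\psi]$ iff $\phi\leftrightarrow\psi$ is true, and each $U\in\mathcal{P}(1)$ equals $[\mathsf{Eq}(\mathcal{P}(1),U,[\top])]$, with $\mathsf{Eq}(\mathcal{P}(1),U,V)$ a small proposition. Propositions of both: falsum, conjunction, disjunction, implication, quantifiers over collections, and propositional equality: in $\mathbf{mTT}$ the intensional $\mathsf{Id}$ with elimination restricted to propositions, in $\mathbf{emTT}$ the extensional $\mathsf{Eq}$ with the reflection rule. Small propositions are those closed under connectives and under quantifiers and equalities restricted to sets. The rules are intuitionistic; elimination rules of propositions act only towards propositions. In $\mathbf{emTT}$ propositions are proof-irrelevant with canonical element $\mathsf{true}$; in $\mathbf{mTT}$ they carry proof-terms. $\exists!_{y\in\mathsf{N}}R(x,y)$ is $\exists_{y\in\mathsf{N}}R(x,y)$ together with uniqueness of such $y$ up to propositional equality. The number-theoretic internal rule of unique choice says: for any derivable small proposition $R(x,y)\ \mathit{prop}_s\ [x\in\mathsf{N},y\in\mathsf{N}]$, if $\exists!_{y\in\mathsf{N}}R(x,y)\ [x\in\mathsf{N}]$ is derivably inhabited then $\exists_{f\in\mathsf{N}\to\mathsf{N}}\forall_{x\in\mathsf{N}}R(x,\mathsf{Ap}(f,x))$ is derivably inhabited. A theory does not validate a rule or an axiom scheme if some instance of it fails to be admissible, respectively derivable, in the theory. In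 the axiom, $R$ ranges over small propositions; as usual in type theory, an ambient context common to all judgements is left implicit. *)

(* Defs.v *)
From Stdlib Require Import List.
Import ListNotations.

(** One raw syntax serves both levels of the Minimalist Foundation; the typing
    rules decide which constructors are available at which level. Variables are
    de Bruijn indices. A number after an argument is the number of variables
    bound in it, the last bound one having index 0. *)

Inductive expr : Type :=
| Var (n : nat)
| N0 | N1
| Lst (A : expr)
| Sum (A B : expr)
| Sig (A B (* 1 *) : expr)
| Pi (A B (* 1 *) : expr)
| Quo (A R (* 2 *) : expr)            (* emTT: quotient A/R *)
| PropS                               (* mTT: codes; [COr], say, codes [Or] *)
| Tau (p : expr)                      (* mTT: small proposition with code p *)
| Pow1                                (* emTT: P(1) *)
| Fls
| Or (A B : expr)
| And (A B : expr)
| Imp (A B : expr)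
| Ex (A B (* 1 *) : expr)
| All (A B (* 1 *) : expr)
| Eqp (A a b : expr)                  (* Id in mTT, Eq in emTT *)
| ElN0 (a : expr)
| Star
| ElN1 (t c : expr)
| Eps
| Cns (s c : expr)                    (* the list s with c appended *)
| ElLst (s a l (* 3 *) : expr)
| Inl (a : expr)
| Inr (b : expr)
| ElSum (w a (* 1 *) b (* 1 *) : expr)
| Pair (b c : expr)
| ElSig (d m (* 2 *) : expr)
| Lam (B c (* 1 *) : expr)
| Ap (f b : expr)
| Cls (a : expr)                      (* emTT: [a] in A/R *)
| ElQuo (p l (* 1 *) : expr)
| PCls (phi : expr)                   (* emTT: [phi] in P(1) *)
| CFls
| COr (p q : expr)
| CAnd (p q : expr)
| CImp (p q : expr)
| CEx (B p (* 1 *) : expr)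
| CAll (B p (* 1 *) : expr)
| CEqp (A a b : expr)
| ElFls (a : expr)
| OrL (b : expr)
| OrR (c : expr)
| ElOr (d a (* 1 *) b (* 1 *) : expr)
| AndI (b c : expr)
| And1 (d : expr)
| And2 (d : expr)
| ImpLam (B c (* 1 *) : expr)
| ImpAp (f b : expr)
| ExI (b c : expr)
| ElEx (d m (* 2 *) : expr)
| AllLam (B c (* 1 *) : expr)
| AllAp (f b : expr)
| IdI (a : expr)
| ElId (d c (* 1 *) : expr)
| Lem (phi : expr)                    (* excluded middle for phi *)
| Tru.                                (* emTT: canonical proof *)

Definition scons {X : Type} (x : X) (s : nat -> X) (n : nat) : X :=
  match n with 0 => x | S m => s m end.

Definition upr (r : nat -> nat) : nat -> nat := scons 0 (fun n => S (r n)).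

Fixpoint ren (r : nat -> nat) (e : expr) : expr :=
  let r1 := upr r in let r2 := upr r1 in let r3 := upr r2 in
  match e with
  | Var n => Var (r n)
  | N0 => N0
  | N1 => N1
  | Lst A => Lst (ren r A)
  | Sum A B => Sum (ren r A) (ren r B)
  | Sig A B => Sig (ren r A) (ren r1 B)
  | Pi A B => Pi (ren r A) (ren r1 B)
  | Quo A R => Quo (ren r A) (ren r2 R)
  | PropS => PropS
  | Tau p => Tau (ren r p)
  | Pow1 => Pow1
  | Fls => Fls
  | Or A B => Or (ren r A) (ren r B)
  | And A B => And (ren r A) (ren r B)
  | Imp A B => Imp (ren r A) (ren r B)
  | Ex A B => Ex (ren r A) (ren r1 B)
  | All A B => All (ren r A) (ren r1 B)
  | Eqp A a b => Eqp (ren r A) (ren r a) (ren r b)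
  | ElN0 a => ElN0 (ren r a)
  | Star => Star
  | ElN1 t c => ElN1 (ren r t) (ren r c)
  | Eps => Eps
  | Cns s c => Cns (ren r s) (ren r c)
  | ElLst s a l => ElLst (ren r s) (ren r a) (ren r3 l)
  | Inl a => Inl (ren r a)
  | Inr b => Inr (ren r b)
  | ElSum w a b => ElSum (ren r w) (ren r1 a) (ren r1 b)
  | Pair b c => Pair (ren r b) (ren r c)
  | ElSig d m => ElSig (ren r d) (ren r2 m)
  | Lam B c => Lam (ren r B) (ren r1 c)
  | Ap f b => Ap (ren r f) (ren r b)
  | Cls a => Cls (ren r a)
  | ElQuo p l => ElQuo (ren r p) (ren r1 l)
  | PCls phi => PCls (ren r phi)
  | CFls => CFls
  | COr p q => COr (ren r p) (ren r q)
  | CAnd p q => CAnd (ren r p) (ren r q)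
  | CImp p q => CImp (ren r p) (ren r q)
  | CEx B p => CEx (ren r B) (ren r1 p)
  | CAll B p => CAll (ren r B) (ren r1 p)
  | CEqp A a b => CEqp (ren r A) (ren r a) (ren r b)
  | ElFls a => ElFls (ren r a)
  | OrL b => OrL (ren r b)
  | OrR c => OrR (ren r c)
  | ElOr d a b => ElOr (ren r d) (ren r1 a) (ren r1 b)
  | AndI b c => AndI (ren r b) (ren r c)
  | And1 d => And1 (ren r d)
  | And2 d => And2 (ren r d)
  | ImpLam B c => ImpLam (ren r B) (ren r1 c)
  | ImpAp f b => ImpAp (ren r f) (ren r b)
  | ExI b c => ExI (ren r b) (ren r c)
  | ElEx d m => ElEx (ren r d) (ren r2 m)
  | AllLam B c => AllLam (ren r B) (ren r1 c)
  | AllAp f b => AllAp (ren r f) (ren r b)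
  | IdI a => IdI (ren r a)
  | ElId d c => ElId (ren r d) (ren r1 c)
  | Lem phi => Lem (ren r phi)
  | Tru => Tru
  end.

Definition wk (n : nat) : expr -> expr := ren (fun k => n + k).

Definition up (s : nat -> expr) : nat -> expr :=
  scons (Var 0) (fun n => wk 1 (s n)).

Fixpoint subst (s : nat -> expr) (e : expr) : expr :=
  let s1 := up s in let s2 := up s1 in let s3 := up s2 in
  match e with
  | Var n => s n
  | N0 => N0
  | N1 => N1
  | Lst A => Lst (subst s A)
  | Sum A B => Sum (subst s A) (subst s B)
  | Sig A B => Sig (subst s A) (subst s1 B)
  | Pi A B => Pi (subst s A) (subst s1 B)
  | Quo A R => Quo (subst s A) (subst s2 R)
  | PropS => PropS
  | Tau p => Tau (subst s p)
  | Pow1 => Pow1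
  | Fls => Fls
  | Or A B => Or (subst s A) (subst s B)
  | And A B => And (subst s A) (subst s B)
  | Imp A B => Imp (subst s A) (subst s B)
  | Ex A B => Ex (subst s A) (subst s1 B)
  | All A B => All (subst s A) (subst s1 B)
  | Eqp A a b => Eqp (subst s A) (subst s a) (subst s b)
  | ElN0 a => ElN0 (subst s a)
  | Star => Star
  | ElN1 t c => ElN1 (subst s t) (subst s c)
  | Eps => Eps
  | Cns t c => Cns (subst s t) (subst s c)
  | ElLst t a l => ElLst (subst s t) (subst s a) (subst s3 l)
  | Inl a => Inl (subst s a)
  | Inr b => Inr (subst s b)
  | ElSum w a b => ElSum (subst s w) (subst s1 a) (subst s1 b)
  | Pair b c => Pair (subst s b) (subst s c)
  | ElSig d m => ElSig (subst s d) (subst s2 m)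
  | Lam B c => Lam (subst s B) (subst s1 c)
  | Ap f b => Ap (subst s f) (subst s b)
  | Cls a => Cls (subst s a)
  | ElQuo p l => ElQuo (subst s p) (subst s1 l)
  | PCls phi => PCls (subst s phi)
  | CFls => CFls
  | COr p q => COr (subst s p) (subst s q)
  | CAnd p q => CAnd (subst s p) (subst s q)
  | CImp p q => CImp (subst s p) (subst s q)
  | CEx B p => CEx (subst s B) (subst s1 p)
  | CAll B p => CAll (subst s B) (subst s1 p)
  | CEqp A a b => CEqp (subst s A) (subst s a) (subst s b)
  | ElFls a => ElFls (subst s a)
  | OrL b => OrL (subst s b)
  | OrR c => OrR (subst s c)
  | ElOr d a b => ElOr (subst s d) (subst s1 a) (subst s1 b)
  | AndI b c => AndI (subst s b) (subst s c)
  | And1 d => And1 (subst s d)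
  | And2 d => And2 (subst s d)
  | ImpLam B c => ImpLam (subst s B) (subst s1 c)
  | ImpAp f b => ImpAp (subst s f) (subst s b)
  | ExI b c => ExI (subst s b) (subst s c)
  | ElEx d m => ElEx (subst s d) (subst s2 m)
  | AllLam B c => AllLam (subst s B) (subst s1 c)
  | AllAp f b => AllAp (subst s f) (subst s b)
  | IdI a => IdI (subst s a)
  | ElId d c => ElId (subst s d) (subst s1 c)
  | Lem phi => Lem (subst s phi)
  | Tru => Tru
  end.

(** [at1 n C a] is C(a) for C(x) depending on x on top of a context G, as an
    expression over an extension of G by n variables; similarly [at2 n C a b]
    is C(a,b) and [at3 n C a b c] is C(a,b,c). *)

Definition shift (n : nat) : nat -> expr := fun k => Var (n + k).

Definition at1 (n : nat) (C a : expr) : expr :=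
  subst (scons a (shift n)) C.

Definition at2 (n : nat) (C a b : expr) : expr :=
  subst (scons b (scons a (shift n))) C.

Definition at3 (n : nat) (C a b c : expr) : expr :=
  subst (scons c (scons b (scons a (shift n)))) C.

Definition Arrow (A B : expr) : expr := Pi A (wk 1 B).
Definition Not (A : expr) : expr := Imp A Fls.
Definition Iff (A B : expr) : expr := And (Imp A B) (Imp B A).
Definition Top : expr := Imp Fls Fls.
Definition NN : expr := Lst N1.

Inductive level : Type := mTT | emTT.

Inductive kind : Type := KCol | KSet | KProp | KProps.

Inductive subkind : kind -> kind -> Prop :=
| props_prop : subkind KProps KProp
| props_set : subkind KProps KSet
| set_col : subkind KSet KCol
| prop_col : subkind KProp KCol.

Definition is_prop (k : kind) : Prop := k = KProp \/ k = KProps.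

Definition is_col (k : kind) : Prop := k = KCol \/ k = KSet.

(** Small propositions quantify over sets and equate elements of sets,
    propositions do so with collections. *)
Definition dom (k : kind) : kind :=
  match k with KProps => KSet | _ => KCol end.

(** The collection of which A -> prop_s, resp. A -> P(1), is a power. *)
Definition Omega (T : level) : expr :=
  match T with mTT => PropS | emTT => Pow1 end.

(** Contexts list the last declared variable first. *)
Definition ctx : Type := list expr.

(** [SubEq G s t D]: s and t are equal substitutions from G to D, that is
    s(i) = t(i) in D_i[s] for each variable i declared in D. *)
Inductive judgement : Type :=
| Cont (G : ctx)
| Ty (k : kind) (G : ctx) (A : expr)
| TyEq (k : kind) (G : ctx) (A B : expr)
| Tm (G : ctx) (a A : expr)
| TmEq (G : ctx) (a b A : expr)
| SubEq (G : ctx) (s t : nat -> expr) (D : ctx).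

(** [derivable T cl J]: the judgement J is derivable in the theory T, extended
    with excluded middle for all propositions when [cl] is true. *)

Reserved Notation "⊢ J" (at level 70, J at next level).

Section Calculus.

Context (T : level) (cl : bool).

Inductive derivable : judgement -> Prop :=

| cont_nil : ⊢ Cont []
| cont_cons G A : ⊢ Ty KCol G A -> ⊢ Cont (A :: G)
| tm_var G n A :
    ⊢ Cont G -> nth_error G n = Some A -> ⊢ Tm G (Var n) (wk (S n) A)

| ty_sub k k' G A : subkind k k' -> ⊢ Ty k G A -> ⊢ Ty k' G A
| tyeq_sub k k' G A B : subkind k k' -> ⊢ TyEq k G A B -> ⊢ TyEq k' G A B

| tyeq_refl k G A : ⊢ Ty k G A -> ⊢ TyEq k G A A
| tyeq_sym k G A B : ⊢ TyEq k G A B -> ⊢ TyEq k G B A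
| tyeq_trans k G A B C : ⊢ TyEq k G A B -> ⊢ TyEq k G B C -> ⊢ TyEq k G A C
| tmeq_refl G a A : ⊢ Tm G a A -> ⊢ TmEq G a a A
| tmeq_sym G a b A : ⊢ TmEq G a b A -> ⊢ TmEq G b a A
| tmeq_trans G a b c A :
    ⊢ TmEq G a b A -> ⊢ TmEq G b c A -> ⊢ TmEq G a c A
| tm_conv G a A B : ⊢ Tm G a A -> ⊢ TyEq KCol G A B -> ⊢ Tm G a B
| tmeq_conv G a b A B :
    ⊢ TmEq G a b A -> ⊢ TyEq KCol G A B -> ⊢ TmEq G a b B

(** Substitution; weakening is the case of substitutions by variables. *)
| sub_nil G s t : ⊢ Cont G -> ⊢ SubEq G s t []
| sub_cons G s t D A :
    ⊢ SubEq G (fun n => s (S n)) (fun n => t (S n)) D ->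
    ⊢ Ty KCol D A ->
    ⊢ TmEq G (s 0) (t 0) (subst (fun n => s (S n)) A) ->
    ⊢ SubEq G s t (A :: D)
| ty_subst k G D s t A :
    ⊢ SubEq G s t D -> ⊢ Ty k D A -> ⊢ Ty k G (subst s A)
| tyeq_subst k G D s t A B :
    ⊢ SubEq G s t D -> ⊢ TyEq k D A B -> ⊢ TyEq k G (subst s A) (subst t B)
| tm_subst G D s t a A :
    ⊢ SubEq G s t D -> ⊢ Tm D a A -> ⊢ Tm G (subst s a) (subst s A)
| tmeq_subst G D s t a b A :
    ⊢ SubEq G s t D -> ⊢ TmEq D a b A ->
    ⊢ TmEq G (subst s a) (subst t b) (subst s A)

| ty_N0 G : ⊢ Cont G -> ⊢ Ty KSet G N0
| ty_N1 G : ⊢ Cont G -> ⊢ Ty KSet G N1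
| ty_Lst G A : ⊢ Ty KSet G A -> ⊢ Ty KSet G (Lst A)
| tyeq_Lst G A A' : ⊢ TyEq KSet G A A' -> ⊢ TyEq KSet G (Lst A) (Lst A')
| ty_Sum G A B : ⊢ Ty KSet G A -> ⊢ Ty KSet G B -> ⊢ Ty KSet G (Sum A B)
| tyeq_Sum G A A' B B' :
    ⊢ TyEq KSet G A A' -> ⊢ TyEq KSet G B B' ->
    ⊢ TyEq KSet G (Sum A B) (Sum A' B')
| ty_Sig k G A B :
    is_col k -> ⊢ Ty k G A -> ⊢ Ty k (A :: G) B -> ⊢ Ty k G (Sig A B)
| tyeq_Sig k G A A' B B' :
    is_col k -> ⊢ TyEq k G A A' -> ⊢ TyEq k (A :: G) B B' ->
    ⊢ TyEq k G (Sig A B) (Sig A' B')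
| ty_Pi G A B :
    ⊢ Ty KSet G A -> ⊢ Ty KSet (A :: G) B -> ⊢ Ty KSet G (Pi A B)
| tyeq_Pi G A A' B B' :
    ⊢ TyEq KSet G A A' -> ⊢ TyEq KSet (A :: G) B B' ->
    ⊢ TyEq KSet G (Pi A B) (Pi A' B')
| ty_Omega G : ⊢ Cont G -> ⊢ Ty KCol G (Omega T)
| ty_Pow G A : ⊢ Ty KSet G A -> ⊢ Ty KCol G (Arrow A (Omega T))
| tyeq_Pow G A A' :
    ⊢ TyEq KSet G A A' ->
    ⊢ TyEq KCol G (Arrow A (Omega T)) (Arrow A' (Omega T))

| ty_Fls G : ⊢ Cont G -> ⊢ Ty KProps G Fls
| ty_Or k G A B :
    is_prop k -> ⊢ Ty k G A -> ⊢ Ty k G B -> ⊢ Ty k G (Or A B)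
| tyeq_Or k G A A' B B' :
    is_prop k -> ⊢ TyEq k G A A' -> ⊢ TyEq k G B B' ->
    ⊢ TyEq k G (Or A B) (Or A' B')
| ty_And k G A B :
    is_prop k -> ⊢ Ty k G A -> ⊢ Ty k G B -> ⊢ Ty k G (And A B)
| tyeq_And k G A A' B B' :
    is_prop k -> ⊢ TyEq k G A A' -> ⊢ TyEq k G B B' ->
    ⊢ TyEq k G (And A B) (And A' B')
| ty_Imp k G A B :
    is_prop k -> ⊢ Ty k G A -> ⊢ Ty k G B -> ⊢ Ty k G (Imp A B)
| tyeq_Imp k G A A' B B' :
    is_prop k -> ⊢ TyEq k G A A' -> ⊢ TyEq k G B B' ->
    ⊢ TyEq k G (Imp A B) (Imp A' B')
| ty_Ex k G A B :
    is_prop k -> ⊢ Ty (dom k) G A -> ⊢ Ty k (A :: G) B -> ⊢ Ty k G (Ex A B)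
| tyeq_Ex k G A A' B B' :
    is_prop k -> ⊢ TyEq (dom k) G A A' -> ⊢ TyEq k (A :: G) B B' ->
    ⊢ TyEq k G (Ex A B) (Ex A' B')
| ty_All k G A B :
    is_prop k -> ⊢ Ty (dom k) G A -> ⊢ Ty k (A :: G) B -> ⊢ Ty k G (All A B)
| tyeq_All k G A A' B B' :
    is_prop k -> ⊢ TyEq (dom k) G A A' -> ⊢ TyEq k (A :: G) B B' ->
    ⊢ TyEq k G (All A B) (All A' B')
| ty_Eqp k G A a b :
    is_prop k -> ⊢ Ty (dom k) G A -> ⊢ Tm G a A -> ⊢ Tm G b A ->
    ⊢ Ty k G (Eqp A a b)
| tyeq_Eqp k G A A' a a' b b' :
    is_prop k -> ⊢ TyEq (dom k) G A A' ->
    ⊢ TmEq G a a' A -> ⊢ TmEq G b b' A ->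
    ⊢ TyEq k G (Eqp A a b) (Eqp A' a' b')

| tm_ElN0 G a M :
    ⊢ Ty KCol (N0 :: G) M -> ⊢ Tm G a N0 -> ⊢ Tm G (ElN0 a) (at1 0 M a)

| tm_Star G : ⊢ Cont G -> ⊢ Tm G Star N1
| tm_ElN1 G t c M :
    ⊢ Ty KCol (N1 :: G) M -> ⊢ Tm G t N1 -> ⊢ Tm G c (at1 0 M Star) ->
    ⊢ Tm G (ElN1 t c) (at1 0 M t)
| tmeq_ElN1 G c M :
    ⊢ Ty KCol (N1 :: G) M -> ⊢ Tm G c (at1 0 M Star) ->
    ⊢ TmEq G (ElN1 Star c) c (at1 0 M Star)

| tm_Eps G A : ⊢ Ty KSet G A -> ⊢ Tm G Eps (Lst A)
| tm_Cns G A s c :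
    ⊢ Ty KSet G A -> ⊢ Tm G s (Lst A) -> ⊢ Tm G c A ->
    ⊢ Tm G (Cns s c) (Lst A)
| tm_ElLst G A s a l M :
    ⊢ Ty KSet G A -> ⊢ Ty KCol (Lst A :: G) M ->
    ⊢ Tm G s (Lst A) -> ⊢ Tm G a (at1 0 M Eps) ->
    ⊢ Tm (wk 1 M :: wk 1 A :: Lst A :: G) l
          (at1 3 M (Cns (Var 2) (Var 1))) ->
    ⊢ Tm G (ElLst s a l) (at1 0 M s)
| tmeq_ElLst_Eps G A a l M :
    ⊢ Ty KSet G A -> ⊢ Ty KCol (Lst A :: G) M ->
    ⊢ Tm G a (at1 0 M Eps) ->
    ⊢ Tm (wk 1 M :: wk 1 A :: Lst A :: G) l
          (at1 3 M (Cns (Var 2) (Var 1))) ->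
    ⊢ TmEq G (ElLst Eps a l) a (at1 0 M Eps)
| tmeq_ElLst_Cns G A s c a l M :
    ⊢ Ty KSet G A -> ⊢ Ty KCol (Lst A :: G) M ->
    ⊢ Tm G s (Lst A) -> ⊢ Tm G c A -> ⊢ Tm G a (at1 0 M Eps) ->
    ⊢ Tm (wk 1 M :: wk 1 A :: Lst A :: G) l
          (at1 3 M (Cns (Var 2) (Var 1))) ->
    ⊢ TmEq G (ElLst (Cns s c) a l) (at3 0 l s c (ElLst s a l))
            (at1 0 M (Cns s c))

| tm_Inl G A B a :
    ⊢ Ty KSet G A -> ⊢ Ty KSet G B -> ⊢ Tm G a A -> ⊢ Tm G (Inl a) (Sum A B)
| tm_Inr G A B b :
    ⊢ Ty KSet G A -> ⊢ Ty KSet G B -> ⊢ Tm G b B -> ⊢ Tm G (Inr b) (Sum A B)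
| tm_ElSum G A B w a b M :
    ⊢ Ty KSet G A -> ⊢ Ty KSet G B -> ⊢ Ty KCol (Sum A B :: G) M ->
    ⊢ Tm G w (Sum A B) ->
    ⊢ Tm (A :: G) a (at1 1 M (Inl (Var 0))) ->
    ⊢ Tm (B :: G) b (at1 1 M (Inr (Var 0))) ->
    ⊢ Tm G (ElSum w a b) (at1 0 M w)
| tmeq_ElSum_Inl G A B c a b M :
    ⊢ Ty KSet G A -> ⊢ Ty KSet G B -> ⊢ Ty KCol (Sum A B :: G) M ->
    ⊢ Tm G c A ->
    ⊢ Tm (A :: G) a (at1 1 M (Inl (Var 0))) ->
    ⊢ Tm (B :: G) b (at1 1 M (Inr (Var 0))) ->
    ⊢ TmEq G (ElSum (Inl c) a b) (at1 0 a c) (at1 0 M (Inl c))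
| tmeq_ElSum_Inr G A B d a b M :
    ⊢ Ty KSet G A -> ⊢ Ty KSet G B -> ⊢ Ty KCol (Sum A B :: G) M ->
    ⊢ Tm G d B ->
    ⊢ Tm (A :: G) a (at1 1 M (Inl (Var 0))) ->
    ⊢ Tm (B :: G) b (at1 1 M (Inr (Var 0))) ->
    ⊢ TmEq G (ElSum (Inr d) a b) (at1 0 b d) (at1 0 M (Inr d))

| tm_Pair G B C b c :
    ⊢ Ty KCol G B -> ⊢ Ty KCol (B :: G) C ->
    ⊢ Tm G b B -> ⊢ Tm G c (at1 0 C b) -> ⊢ Tm G (Pair b c) (Sig B C)
| tm_ElSig G B C d m M :
    ⊢ Ty KCol G B -> ⊢ Ty KCol (B :: G) C -> ⊢ Ty KCol (Sig B C :: G) M ->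
    ⊢ Tm G d (Sig B C) ->
    ⊢ Tm (C :: B :: G) m (at1 2 M (Pair (Var 1) (Var 0))) ->
    ⊢ Tm G (ElSig d m) (at1 0 M d)
| tmeq_ElSig G B C b c m M :
    ⊢ Ty KCol G B -> ⊢ Ty KCol (B :: G) C -> ⊢ Ty KCol (Sig B C :: G) M ->
    ⊢ Tm G b B -> ⊢ Tm G c (at1 0 C b) ->
    ⊢ Tm (C :: B :: G) m (at1 2 M (Pair (Var 1) (Var 0))) ->
    ⊢ TmEq G (ElSig (Pair b c) m) (at2 0 m b c) (at1 0 M (Pair b c))

(** The premise that [Pi B C] is a collection makes the next rules serve both
    for dependent products of sets and for the collections B -> prop_s and
    B -> P(1). *)
| tm_Lam G B C c :
    ⊢ Ty KCol G (Pi B C) -> ⊢ Tm (B :: G) c C -> ⊢ Tm G (Lam B c) (Pi B C)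
| tm_Ap G B C f b :
    ⊢ Ty KCol G (Pi B C) -> ⊢ Tm G f (Pi B C) -> ⊢ Tm G b B ->
    ⊢ Tm G (Ap f b) (at1 0 C b)
| tmeq_beta G B C c b :
    ⊢ Ty KCol G (Pi B C) -> ⊢ Tm (B :: G) c C -> ⊢ Tm G b B ->
    ⊢ TmEq G (Ap (Lam B c) b) (at1 0 c b) (at1 0 C b)

| ty_Tau G p : T = mTT -> ⊢ Tm G p PropS -> ⊢ Ty KProps G (Tau p)
| tm_CFls G : T = mTT -> ⊢ Cont G -> ⊢ Tm G CFls PropS
| tyeq_CFls G : T = mTT -> ⊢ Cont G -> ⊢ TyEq KProps G (Tau CFls) Fls
| tm_COr G p q :
    T = mTT -> ⊢ Tm G p PropS -> ⊢ Tm G q PropS -> ⊢ Tm G (COr p q) PropS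
| tyeq_COr G p q :
    T = mTT -> ⊢ Tm G p PropS -> ⊢ Tm G q PropS ->
    ⊢ TyEq KProps G (Tau (COr p q)) (Or (Tau p) (Tau q))
| tm_CAnd G p q :
    T = mTT -> ⊢ Tm G p PropS -> ⊢ Tm G q PropS -> ⊢ Tm G (CAnd p q) PropS
| tyeq_CAnd G p q :
    T = mTT -> ⊢ Tm G p PropS -> ⊢ Tm G q PropS ->
    ⊢ TyEq KProps G (Tau (CAnd p q)) (And (Tau p) (Tau q))
| tm_CImp G p q :
    T = mTT -> ⊢ Tm G p PropS -> ⊢ Tm G q PropS -> ⊢ Tm G (CImp p q) PropS
| tyeq_CImp G p q :
    T = mTT -> ⊢ Tm G p PropS -> ⊢ Tm G q PropS ->
    ⊢ TyEq KProps G (Tau (CImp p q)) (Imp (Tau p) (Tau q))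
| tm_CEx G B p :
    T = mTT -> ⊢ Ty KSet G B -> ⊢ Tm (B :: G) p PropS ->
    ⊢ Tm G (CEx B p) PropS
| tyeq_CEx G B p :
    T = mTT -> ⊢ Ty KSet G B -> ⊢ Tm (B :: G) p PropS ->
    ⊢ TyEq KProps G (Tau (CEx B p)) (Ex B (Tau p))
| tm_CAll G B p :
    T = mTT -> ⊢ Ty KSet G B -> ⊢ Tm (B :: G) p PropS ->
    ⊢ Tm G (CAll B p) PropS
| tyeq_CAll G B p :
    T = mTT -> ⊢ Ty KSet G B -> ⊢ Tm (B :: G) p PropS ->
    ⊢ TyEq KProps G (Tau (CAll B p)) (All B (Tau p))
| tm_CEqp G A a b :
    T = mTT -> ⊢ Ty KSet G A -> ⊢ Tm G a A -> ⊢ Tm G b A ->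
    ⊢ Tm G (CEqp A a b) PropS
| tyeq_CEqp G A a b :
    T = mTT -> ⊢ Ty KSet G A -> ⊢ Tm G a A -> ⊢ Tm G b A ->
    ⊢ TyEq KProps G (Tau (CEqp A a b)) (Eqp A a b)

(** There is no xi-rule in mTT: equality of open terms is preserved by
    substitution, but not by the binders of term constructors. *)
| tm_ElFls G a A :
    T = mTT -> ⊢ Ty KProp G A -> ⊢ Tm G a Fls -> ⊢ Tm G (ElFls a) A

| tm_OrL G B C b :
    T = mTT -> ⊢ Ty KProp G B -> ⊢ Ty KProp G C ->
    ⊢ Tm G b B -> ⊢ Tm G (OrL b) (Or B C)
| tm_OrR G B C c :
    T = mTT -> ⊢ Ty KProp G B -> ⊢ Ty KProp G C ->
    ⊢ Tm G c C -> ⊢ Tm G (OrR c) (Or B C)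
| tm_ElOr G B C A d a b :
    T = mTT -> ⊢ Ty KProp G B -> ⊢ Ty KProp G C -> ⊢ Ty KProp G A ->
    ⊢ Tm G d (Or B C) ->
    ⊢ Tm (B :: G) a (wk 1 A) -> ⊢ Tm (C :: G) b (wk 1 A) ->
    ⊢ Tm G (ElOr d a b) A
| tmeq_ElOr_OrL G B C A d a b :
    T = mTT -> ⊢ Ty KProp G B -> ⊢ Ty KProp G C -> ⊢ Ty KProp G A ->
    ⊢ Tm G d B ->
    ⊢ Tm (B :: G) a (wk 1 A) -> ⊢ Tm (C :: G) b (wk 1 A) ->
    ⊢ TmEq G (ElOr (OrL d) a b) (at1 0 a d) A
| tmeq_ElOr_OrR G B C A d a b :
    T = mTT -> ⊢ Ty KProp G B -> ⊢ Ty KProp G C -> ⊢ Ty KProp G A ->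
    ⊢ Tm G d C ->
    ⊢ Tm (B :: G) a (wk 1 A) -> ⊢ Tm (C :: G) b (wk 1 A) ->
    ⊢ TmEq G (ElOr (OrR d) a b) (at1 0 b d) A

| tm_AndI G B C b c :
    T = mTT -> ⊢ Ty KProp G B -> ⊢ Ty KProp G C ->
    ⊢ Tm G b B -> ⊢ Tm G c C -> ⊢ Tm G (AndI b c) (And B C)
| tm_And1 G B C d :
    T = mTT -> ⊢ Ty KProp G B -> ⊢ Ty KProp G C ->
    ⊢ Tm G d (And B C) -> ⊢ Tm G (And1 d) B
| tm_And2 G B C d :
    T = mTT -> ⊢ Ty KProp G B -> ⊢ Ty KProp G C ->
    ⊢ Tm G d (And B C) -> ⊢ Tm G (And2 d) C
| tmeq_And1 G B C b c :
    T = mTT -> ⊢ Ty KProp G B -> ⊢ Ty KProp G C ->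
    ⊢ Tm G b B -> ⊢ Tm G c C -> ⊢ TmEq G (And1 (AndI b c)) b B
| tmeq_And2 G B C b c :
    T = mTT -> ⊢ Ty KProp G B -> ⊢ Ty KProp G C ->
    ⊢ Tm G b B -> ⊢ Tm G c C -> ⊢ TmEq G (And2 (AndI b c)) c C

| tm_ImpLam G B C c :
    T = mTT -> ⊢ Ty KProp G B -> ⊢ Ty KProp G C ->
    ⊢ Tm (B :: G) c (wk 1 C) -> ⊢ Tm G (ImpLam B c) (Imp B C)
| tm_ImpAp G B C f b :
    T = mTT -> ⊢ Ty KProp G B -> ⊢ Ty KProp G C ->
    ⊢ Tm G f (Imp B C) -> ⊢ Tm G b B -> ⊢ Tm G (ImpAp f b) C
| tmeq_ImpAp G B C c b :
    T = mTT -> ⊢ Ty KProp G B -> ⊢ Ty KProp G C ->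
    ⊢ Tm (B :: G) c (wk 1 C) -> ⊢ Tm G b B ->
    ⊢ TmEq G (ImpAp (ImpLam B c) b) (at1 0 c b) C

| tm_ExI G B C b c :
    T = mTT -> ⊢ Ty KCol G B -> ⊢ Ty KProp (B :: G) C ->
    ⊢ Tm G b B -> ⊢ Tm G c (at1 0 C b) -> ⊢ Tm G (ExI b c) (Ex B C)
| tm_ElEx G B C M d m :
    T = mTT -> ⊢ Ty KCol G B -> ⊢ Ty KProp (B :: G) C -> ⊢ Ty KProp G M ->
    ⊢ Tm G d (Ex B C) -> ⊢ Tm (C :: B :: G) m (wk 2 M) ->
    ⊢ Tm G (ElEx d m) M
| tmeq_ElEx G B C M b c m :
    T = mTT -> ⊢ Ty KCol G B -> ⊢ Ty KProp (B :: G) C -> ⊢ Ty KProp G M ->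
    ⊢ Tm G b B -> ⊢ Tm G c (at1 0 C b) -> ⊢ Tm (C :: B :: G) m (wk 2 M) ->
    ⊢ TmEq G (ElEx (ExI b c) m) (at2 0 m b c) M

| tm_AllLam G B C c :
    T = mTT -> ⊢ Ty KCol G B -> ⊢ Ty KProp (B :: G) C ->
    ⊢ Tm (B :: G) c C -> ⊢ Tm G (AllLam B c) (All B C)
| tm_AllAp G B C f b :
    T = mTT -> ⊢ Ty KCol G B -> ⊢ Ty KProp (B :: G) C ->
    ⊢ Tm G f (All B C) -> ⊢ Tm G b B -> ⊢ Tm G (AllAp f b) (at1 0 C b)
| tmeq_AllAp G B C c b :
    T = mTT -> ⊢ Ty KCol G B -> ⊢ Ty KProp (B :: G) C ->
    ⊢ Tm (B :: G) c C -> ⊢ Tm G b B ->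
    ⊢ TmEq G (AllAp (AllLam B c) b) (at1 0 c b) (at1 0 C b)

| tm_IdI G A a :
    T = mTT -> ⊢ Ty KCol G A -> ⊢ Tm G a A -> ⊢ Tm G (IdI a) (Eqp A a a)
| tm_ElId G A C a b d c :
    T = mTT -> ⊢ Ty KCol G A -> ⊢ Ty KProp (wk 1 A :: A :: G) C ->
    ⊢ Tm G a A -> ⊢ Tm G b A -> ⊢ Tm G d (Eqp A a b) ->
    ⊢ Tm (A :: G) c (at2 1 C (Var 0) (Var 0)) ->
    ⊢ Tm G (ElId d c) (at2 0 C a b)
| tmeq_ElId G A C a c :
    T = mTT -> ⊢ Ty KCol G A -> ⊢ Ty KProp (wk 1 A :: A :: G) C ->
    ⊢ Tm G a A -> ⊢ Tm (A :: G) c (at2 1 C (Var 0) (Var 0)) ->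
    ⊢ TmEq G (ElId (IdI a) c) (at1 0 c a) (at2 0 C a a)

(** In emTT congruence for the eliminators need not be postulated: it follows from
    elimination towards [Eqp] and reflection. *)
| tmeq_xi G B B' C c c' :
    T = emTT -> ⊢ Ty KCol G (Pi B C) ->
    ⊢ TyEq KSet G B B' -> ⊢ TmEq (B :: G) c c' C ->
    ⊢ TmEq G (Lam B c) (Lam B' c') (Pi B C)
| tmeq_eta G B C f :
    T = emTT -> ⊢ Ty KCol G (Pi B C) -> ⊢ Tm G f (Pi B C) ->
    ⊢ TmEq G (Lam B (Ap (wk 1 f) (Var 0))) f (Pi B C)

| ty_Quo G A R :
    T = emTT -> ⊢ Ty KSet G A -> ⊢ Ty KProps (wk 1 A :: A :: G) R ->
    ⊢ Tm (A :: G) Tru (at2 1 R (Var 0) (Var 0)) ->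
    ⊢ Tm (R :: wk 1 A :: A :: G) Tru (at2 3 R (Var 1) (Var 2)) ->
    ⊢ Tm (at2 4 R (Var 2) (Var 1) :: wk 1 R :: wk 2 A :: wk 1 A :: A :: G) Tru
          (at2 5 R (Var 4) (Var 2)) ->
    ⊢ Ty KSet G (Quo A R)
| tyeq_Quo G A A' R R' :
    T = emTT -> ⊢ Ty KSet G (Quo A R) -> ⊢ Ty KSet G (Quo A' R') ->
    ⊢ TyEq KSet G A A' -> ⊢ TyEq KProps (wk 1 A :: A :: G) R R' ->
    ⊢ TyEq KSet G (Quo A R) (Quo A' R')
| tm_Cls G A R a :
    T = emTT -> ⊢ Ty KSet G (Quo A R) -> ⊢ Tm G a A ->
    ⊢ Tm G (Cls a) (Quo A R)
| tmeq_Cls G A R a b :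
    T = emTT -> ⊢ Ty KSet G (Quo A R) -> ⊢ Tm G a A -> ⊢ Tm G b A ->
    ⊢ Tm G Tru (at2 0 R a b) -> ⊢ TmEq G (Cls a) (Cls b) (Quo A R)
| tm_Quo_eff G A R a b :
    T = emTT -> ⊢ Ty KSet G (Quo A R) -> ⊢ Tm G a A -> ⊢ Tm G b A ->
    ⊢ TmEq G (Cls a) (Cls b) (Quo A R) -> ⊢ Tm G Tru (at2 0 R a b)
| tm_ElQuo G A R M p l :
    T = emTT -> ⊢ Ty KSet G (Quo A R) -> ⊢ Ty KCol (Quo A R :: G) M ->
    ⊢ Tm G p (Quo A R) ->
    ⊢ Tm (A :: G) l (at1 1 M (Cls (Var 0))) ->
    ⊢ TmEq (R :: wk 1 A :: A :: G) (at1 3 l (Var 2)) (at1 3 l (Var 1))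
            (at1 3 M (Cls (Var 2))) ->
    ⊢ Tm G (ElQuo p l) (at1 0 M p)
| tmeq_ElQuo G A R M a l :
    T = emTT -> ⊢ Ty KSet G (Quo A R) -> ⊢ Ty KCol (Quo A R :: G) M ->
    ⊢ Tm G a A ->
    ⊢ Tm (A :: G) l (at1 1 M (Cls (Var 0))) ->
    ⊢ TmEq (R :: wk 1 A :: A :: G) (at1 3 l (Var 2)) (at1 3 l (Var 1))
            (at1 3 M (Cls (Var 2))) ->
    ⊢ TmEq G (ElQuo (Cls a) l) (at1 0 l a) (at1 0 M (Cls a))

| tm_PCls G A : T = emTT -> ⊢ Ty KProps G A -> ⊢ Tm G (PCls A) Pow1
| tmeq_PCls G A B :
    T = emTT -> ⊢ Ty KProps G A -> ⊢ Ty KProps G B ->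
    ⊢ Tm G Tru (Iff A B) -> ⊢ TmEq G (PCls A) (PCls B) Pow1
| tm_Pow1_eff G A B :
    T = emTT -> ⊢ Ty KProps G A -> ⊢ Ty KProps G B ->
    ⊢ TmEq G (PCls A) (PCls B) Pow1 -> ⊢ Tm G Tru (Iff A B)
| ty_Eqp_Pow1 G U V :
    T = emTT -> ⊢ Tm G U Pow1 -> ⊢ Tm G V Pow1 ->
    ⊢ Ty KProps G (Eqp Pow1 U V)
| tmeq_Pow1_eta G U :
    T = emTT -> ⊢ Tm G U Pow1 ->
    ⊢ TmEq G U (PCls (Eqp Pow1 U (PCls Top))) Pow1

| tm_Tru G A p : T = emTT -> ⊢ Ty KProp G A -> ⊢ Tm G p A -> ⊢ Tm G Tru A
| tmeq_prop G A p q :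
    T = emTT -> ⊢ Ty KProp G A -> ⊢ Tm G p A -> ⊢ Tm G q A ->
    ⊢ TmEq G p q A

| true_Fls_E G A :
    T = emTT -> ⊢ Ty KProp G A -> ⊢ Tm G Tru Fls -> ⊢ Tm G Tru A
| true_Or_I1 G B C :
    T = emTT -> ⊢ Ty KProp G B -> ⊢ Ty KProp G C ->
    ⊢ Tm G Tru B -> ⊢ Tm G Tru (Or B C)
| true_Or_I2 G B C :
    T = emTT -> ⊢ Ty KProp G B -> ⊢ Ty KProp G C ->
    ⊢ Tm G Tru C -> ⊢ Tm G Tru (Or B C)
| true_Or_E G B C A :
    T = emTT -> ⊢ Ty KProp G B -> ⊢ Ty KProp G C -> ⊢ Ty KProp G A ->
    ⊢ Tm G Tru (Or B C) ->
    ⊢ Tm (B :: G) Tru (wk 1 A) -> ⊢ Tm (C :: G) Tru (wk 1 A) ->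
    ⊢ Tm G Tru A
| true_And_I G B C :
    T = emTT -> ⊢ Ty KProp G B -> ⊢ Ty KProp G C ->
    ⊢ Tm G Tru B -> ⊢ Tm G Tru C -> ⊢ Tm G Tru (And B C)
| true_And_E1 G B C :
    T = emTT -> ⊢ Ty KProp G B -> ⊢ Ty KProp G C ->
    ⊢ Tm G Tru (And B C) -> ⊢ Tm G Tru B
| true_And_E2 G B C :
    T = emTT -> ⊢ Ty KProp G B -> ⊢ Ty KProp G C ->
    ⊢ Tm G Tru (And B C) -> ⊢ Tm G Tru C
| true_Imp_I G B C :
    T = emTT -> ⊢ Ty KProp G B -> ⊢ Ty KProp G C ->
    ⊢ Tm (B :: G) Tru (wk 1 C) -> ⊢ Tm G Tru (Imp B C)
| true_Imp_E G B C :
    T = emTT -> ⊢ Ty KProp G B -> ⊢ Ty KProp G C ->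
    ⊢ Tm G Tru (Imp B C) -> ⊢ Tm G Tru B -> ⊢ Tm G Tru C
| true_Ex_I G B C b :
    T = emTT -> ⊢ Ty KCol G B -> ⊢ Ty KProp (B :: G) C ->
    ⊢ Tm G b B -> ⊢ Tm G Tru (at1 0 C b) -> ⊢ Tm G Tru (Ex B C)
| true_Ex_E G B C M :
    T = emTT -> ⊢ Ty KCol G B -> ⊢ Ty KProp (B :: G) C -> ⊢ Ty KProp G M ->
    ⊢ Tm G Tru (Ex B C) -> ⊢ Tm (C :: B :: G) Tru (wk 2 M) ->
    ⊢ Tm G Tru M
| true_All_I G B C :
    T = emTT -> ⊢ Ty KCol G B -> ⊢ Ty KProp (B :: G) C ->
    ⊢ Tm (B :: G) Tru C -> ⊢ Tm G Tru (All B C)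
| true_All_E G B C b :
    T = emTT -> ⊢ Ty KCol G B -> ⊢ Ty KProp (B :: G) C ->
    ⊢ Tm G Tru (All B C) -> ⊢ Tm G b B -> ⊢ Tm G Tru (at1 0 C b)
| true_Eqp_I G A a :
    T = emTT -> ⊢ Ty KCol G A -> ⊢ Tm G a A -> ⊢ Tm G Tru (Eqp A a a)
| tmeq_reflection G A a b :
    T = emTT -> ⊢ Ty KCol G A -> ⊢ Tm G a A -> ⊢ Tm G b A ->
    ⊢ Tm G Tru (Eqp A a b) -> ⊢ TmEq G a b A

| tm_Lem G A :
    cl = true -> T = mTT -> ⊢ Ty KProp G A -> ⊢ Tm G (Lem A) (Or A (Not A))
| true_Lem G A :
    cl = true -> T = emTT -> ⊢ Ty KProp G A -> ⊢ Tm G Tru (Or A (Not A))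

where "⊢ J" := (derivable J).

End Calculus.

Definition inhabited_in (T : level) (cl : bool) (G : ctx) (A : expr) : Prop :=
  exists p, derivable T cl (Tm G p A).

(** R is over a context G extended by x and then y; [ExUniq R] is over G
    extended by x, while [Choice R] and [ACuniq R] are over G. *)
Definition ExUniq (R : expr) : expr :=
  And (Ex NN R)
      (All NN (All NN
        (Imp (And (at2 3 R (Var 2) (Var 1)) (at2 3 R (Var 2) (Var 0)))
             (Eqp NN (Var 1) (Var 0))))).

Definition Choice (R : expr) : expr :=
  Ex (Arrow NN NN) (All NN (at2 2 R (Var 0) (Ap (Var 1) (Var 0)))).

Definition ACuniq (R : expr) : expr :=
  Imp (All NN (ExUniq R)) (Choice R).

(** G is the ambient context of the instance of the rule, resp. axiom. *)
Definition not_validates_rule (T : level) (cl : bool) : Prop :=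
  exists (G : ctx) (R : expr),
    derivable T cl (Ty KProps (NN :: NN :: G) R) /\
    inhabited_in T cl (NN :: G) (ExUniq R) /\
    ~ inhabited_in T cl G (Choice R).

Definition not_validates_axiom (T : level) (cl : bool) : Prop :=
  exists (G : ctx) (R : expr),
    derivable T cl (Ty KProps (NN :: NN :: G) R) /\
    ~ inhabited_in T cl G (ACuniq R).

(* Main.v *)
From Stdlib Require Import List Cantor Lia FunctionalExtensionality
  PropExtensionality Classical.
Import ListNotations.
Require Import Defs.

(** Both levels have a common model in which excluded middle holds, every
    element of N -> N is computed by a program, and yet subsets of N x N are
    arbitrary. Programs are countably many, so some functional relation on N
    is the graph of no element of N -> N, and unique choice fails.

    The programs are the raw expressions themselves under weak-head reduction
    ([step]); an element of a type is a pair of a program, its realizer, and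
    of a non-computational part ([info]) made of truth values. A type denotes
    a partial equivalence relation between such pairs ([den]). The relation of
    a set looks at the realizers only. A proposition denotes a constant
    relation, true or false by the usual clauses of classical logic, so that
    proof terms carry no content. An element of the collection of small
    propositions, or of P(1), is a truth value that realizers need not decide,
    so N x N -> P(1) contains every binary relation between numbers. This is
    the structure of the quasi-topos of assemblies, with strong subobjects as
    propositions.

    Denotations are total functions of raw expressions. Since substitution
    acts on realizers as on any expression, they commute with substitution up
    to equality ([sem_subst]), hence [soundness] is a direct induction on
    derivations. Equality of terms is interpreted extensionally, which
    validates both the intensional and the extensional equality rules.

    The instance of the rule that fails has an ambient context that declares
    P : N x N -> prop_s (or P(1)) and a proof that for each x there is exactly
    one y such that P(x,y); the relation R(x,y) is P(x,y). Uniqueness and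
    existence of y are then derivable ([derivable_unique]). The model makes P
    the diagonal relation [diag]: it is total and single-valued by classical
    reasoning ([diag_total], [diag_fun]), but each program errs on its own
    index ([diag_untracked]). The context is thus satisfied and the conclusion
    of choice false ([no_choice]). The implication between them is false as
    well, which refutes the axiom. *)

(** * Substitution *)

Ltac fext := apply functional_extensionality.

Lemma upr_comp r r' : upr (fun n => r' (r n)) = (fun n => upr r' (upr r n)).
Proof. fext; intros [|n]; reflexivity. Qed.

Lemma ren_ren e : forall r r', ren r' (ren r e) = ren (fun n => r' (r n)) e.
Proof.
induction e; intros r r'; cbn [ren]; f_equal;
  repeat match goal with H : _ |- _ => rewrite H end;
  rewrite <- ?upr_comp; reflexivity.
Qed.

Lemma up_ren s r : up (fun n => s (r n)) = (fun n => up s (upr r n)).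
Proof. fext; intros [|n]; reflexivity. Qed.

Lemma subst_ren e :
  forall r s, subst s (ren r e) = subst (fun n => s (r n)) e.
Proof.
induction e; intros r s; cbn [ren subst]; f_equal;
  repeat match goal with H : _ |- _ => rewrite H end;
  rewrite <- ?up_ren; reflexivity.
Qed.

Lemma ren_up s r : up (fun n => ren r (s n)) = (fun n => ren (upr r) (up s n)).
Proof.
fext; intros [|n]; [reflexivity|].
cbn [up scons]; unfold wk; rewrite !ren_ren; reflexivity.
Qed.

Lemma ren_subst e :
  forall r s, ren r (subst s e) = subst (fun n => ren r (s n)) e.
Proof.
induction e; intros r s; cbn [ren subst]; f_equal;
  repeat match goal with H : _ |- _ => rewrite H end;
  rewrite <- ?ren_up; reflexivity.
Qed.

Lemma subst_up s t :
  up (fun n => subst t (s n)) = (fun n => subst (up t) (up s n)).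
Proof.
fext; intros [|n]; [reflexivity|].
cbn [up scons]; unfold wk; rewrite subst_ren, ren_subst; reflexivity.
Qed.

Lemma subst_subst e :
  forall s t, subst t (subst s e) = subst (fun n => subst t (s n)) e.
Proof.
induction e; intros s t; cbn [subst]; f_equal;
  repeat match goal with H : _ |- _ => rewrite H end;
  rewrite <- ?subst_up; reflexivity.
Qed.

Lemma up_Var : up Var = Var.
Proof. fext; intros [|n]; reflexivity. Qed.

Lemma subst_Var e : subst Var e = e.
Proof. induction e; cbn [subst]; f_equal; rewrite ?up_Var; auto. Qed.

Lemma subst_wk1 a s e : subst (scons a s) (wk 1 e) = subst s e.
Proof. unfold wk; rewrite subst_ren; reflexivity. Qed.

Lemma at1_up s c a : at1 0 (subst (up s) c) a = subst (scons a s) c.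
Proof.
unfold at1; rewrite subst_subst; f_equal; fext; intros [|n]; [reflexivity|].
cbn [up scons]; rewrite subst_wk1; apply subst_Var.
Qed.

Lemma at2_up s c a b :
  at2 0 (subst (up (up s)) c) a b = subst (scons b (scons a s)) c.
Proof.
unfold at2; rewrite subst_subst; f_equal; fext; intros [|[|n]]; try reflexivity.
cbn [up scons]; rewrite !subst_wk1; apply subst_Var.
Qed.

Lemma at3_up s c a b d :
  at3 0 (subst (up (up (up s))) c) a b d =
  subst (scons d (scons b (scons a s))) c.
Proof.
unfold at3; rewrite subst_subst; f_equal; fext;
  intros [|[|[|n]]]; try reflexivity.
cbn [up scons]; rewrite !subst_wk1; apply subst_Var.
Qed.

(** * Realizers *)

(** Weak-head reduction. A class in a quotient is realized by the realizers of
    its representatives, so [Cls] is erased and [ElQuo] applies its step to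
    any of them. The eliminator of [N1] does not evaluate its argument, as
    every expression will realize the element of [N1]. *)
Inductive step : expr -> expr -> Prop :=
| step_ElN1 t c : step (ElN1 t c) c
| step_Eps a l : step (ElLst Eps a l) a
| step_Cns s c a l :
    step (ElLst (Cns s c) a l) (at3 0 l s c (ElLst s a l))
| step_ElLst s s' a l : step s s' -> step (ElLst s a l) (ElLst s' a l)
| step_Inl c a b : step (ElSum (Inl c) a b) (at1 0 a c)
| step_Inr c a b : step (ElSum (Inr c) a b) (at1 0 b c)
| step_ElSum w w' a b : step w w' -> step (ElSum w a b) (ElSum w' a b)
| step_Pair b c m : step (ElSig (Pair b c) m) (at2 0 m b c)
| step_ElSig d d' m : step d d' -> step (ElSig d m) (ElSig d' m)
| step_Lam B c b : step (Ap (Lam B c) b) (at1 0 c b)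
| step_Ap f f' b : step f f' -> step (Ap f b) (Ap f' b)
| step_Cls a : step (Cls a) a
| step_ElQuo p l : step (ElQuo p l) (at1 0 l p).

Lemma step_det a b c : step a b -> step a c -> b = c.
Proof.
intros Hb; revert c; induction Hb; intros x Hx; inversion Hx; subst;
  try reflexivity;
  try (f_equal; auto);
  match goal with
  | H : step Eps _ |- _ => inversion H
  | H : step (Cns _ _) _ |- _ => inversion H
  | H : step (Inl _) _ |- _ => inversion H
  | H : step (Inr _) _ |- _ => inversion H
  | H : step (Pair _ _) _ |- _ => inversion H
  | H : step (Lam _ _) _ |- _ => inversion H
  end.
Qed.

Inductive red : expr -> expr -> Prop :=
| red_refl e : red e e
| red_next a b c : step a b -> red b c -> red a c.

Definition canon (e : expr) : Prop := forall e', ~ step e e'.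

Lemma red_step e e' : step e e' -> red e e'.
Proof. intros H; eapply red_next; [exact H | constructor]. Qed.

Lemma red_trans a b c : red a b -> red b c -> red a c.
Proof.
intros H Hc; induction H; [exact Hc|]; eapply red_next; [exact H|]; auto.
Qed.

Lemma red_canon v v' u : canon u -> red v v' -> (red v u <-> red v' u).
Proof.
intros Hu H; induction H as [|x y z Hxy Hyz IH]; [tauto|].
rewrite <- IH; split; intros H.
- destruct H as [|x y' u Hy' H]; [now destruct (Hu y)|].
  now rewrite (step_det _ _ _ Hxy Hy').
- eapply red_next; eassumption.
Qed.

Lemma red_canon_eq v a b : canon a -> canon b -> red v a -> red v b -> a = b.
Proof.
intros Ha Hb H1 H2.
apply (red_canon _ _ b Hb H1) in H2.
destruct H2 as [|x y z H _]; [reflexivity | now destruct (Ha y)].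
Qed.

Lemma canon_Eps : canon Eps. Proof. intros e H; inversion H. Qed.
Lemma canon_Cns s c : canon (Cns s c). Proof. intros e H; inversion H. Qed.
Lemma canon_Inl c : canon (Inl c). Proof. intros e H; inversion H. Qed.
Lemma canon_Inr c : canon (Inr c). Proof. intros e H; inversion H. Qed.
Lemma canon_Pair b c : canon (Pair b c). Proof. intros e H; inversion H. Qed.
#[local] Hint Resolve red_refl canon_Eps canon_Cns canon_Inl canon_Inr canon_Pair : core.

Lemma red_ctx (F : expr -> expr) :
  (forall e e', step e e' -> step (F e) (F e')) ->
  forall e e', red e e' -> red (F e) (F e').
Proof.
intros HF e e' H; induction H; [constructor|].
eapply red_next; eauto.
Qed.

Lemma red_ElLst s s' a l : red s s' -> red (ElLst s a l) (ElLst s' a l).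
Proof. apply (red_ctx (fun s => ElLst s a l)); intros; now constructor. Qed.
Lemma red_ElSum w w' a b : red w w' -> red (ElSum w a b) (ElSum w' a b).
Proof. apply (red_ctx (fun s => ElSum s a b)); intros; now constructor. Qed.
Lemma red_ElSig d d' m : red d d' -> red (ElSig d m) (ElSig d' m).
Proof. apply (red_ctx (fun s => ElSig s m)); intros; now constructor. Qed.
Lemma red_Ap f f' b : red f f' -> red (Ap f b) (Ap f' b).
Proof. apply (red_ctx (fun s => Ap s b)); intros; now constructor. Qed.

(** * Semantic domain *)

Inductive dir : Type := DFst | DSnd | DArg (w : expr).
(** What realizers do not determine in an element: a truth value at each path
    of projections and applications. Functions are applied to realizers, which
    suffices because the domain of a product is always a set. All operations
    are total on this type, whatever the shape of the element. *)
Definition info : Type := list dir -> Prop.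

Definition dfst (d : info) : info := fun p => d (DFst :: p).
Definition dsnd (d : info) : info := fun p => d (DSnd :: p).
Definition dapp (d : info) (w : expr) : info := fun p => d (DArg w :: p).
Definition dpair (d e : info) : info := fun p =>
  match p with DFst :: q => d q | DSnd :: q => e q | _ => False end.
Definition dlam (f : expr -> info) : info := fun p =>
  match p with DArg w :: q => f w q | _ => False end.
Definition d0 : info := fun _ => False.
Definition dprop (P : Prop) : info := fun _ => P.
Definition holds (d : info) : Prop := d [].

Definition el : Type := info * expr.
Definition rel : Type := el -> el -> Prop.

(** An element of a set is determined by its realizer. *)
Definition pt (v : expr) : el := (d0, v).

(** The denotation of a proposition, and the truth value that it encodes. *)
Definition crel (P : Prop) : rel := fun _ _ => P.
Definition tr (R : rel) : Prop := R (pt Star) (pt Star).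

Inductive lrel (R : rel) : expr -> expr -> Prop :=
| lrel_Eps v v' : red v Eps -> red v' Eps -> lrel R v v'
| lrel_Cns v v' s s' c c' :
    red v (Cns s c) -> red v' (Cns s' c') -> lrel R s s' -> R (pt c) (pt c') ->
    lrel R v v'.

Definition rLst (R : rel) : rel := fun x y => lrel R (snd x) (snd y).

Definition rSum (R S : rel) : rel := fun x y =>
  (exists c c', red (snd x) (Inl c) /\ red (snd y) (Inl c') /\
    R (pt c) (pt c')) \/
  (exists c c', red (snd x) (Inr c) /\ red (snd y) (Inr c') /\
    S (pt c) (pt c')).

Definition rSig (R : rel) (S : el -> rel) : rel := fun x y =>
  exists b c b' c',
    red (snd x) (Pair b c) /\ red (snd y) (Pair b' c') /\
    R (dfst (fst x), b) (dfst (fst y), b') /\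
    S (dfst (fst x), b) (dsnd (fst x), c) (dsnd (fst y), c').

Definition papp (x : el) (w : expr) : el := (dapp (fst x) w, Ap (snd x) w).

Definition rPi (R : rel) (S : el -> rel) : rel := fun x y =>
  forall w w', R (pt w) (pt w') -> S (pt w) (papp x w) (papp y w').

Definition rQuo (R : rel) (S : el -> el -> rel) : rel := fun x y =>
  R (pt (snd x)) (pt (snd x)) /\ R (pt (snd y)) (pt (snd y)) /\
  tr (S (pt (snd x)) (pt (snd y))).

(** Realizers are ignored: this is what puts every predicate on a set A, even
    an undecidable one, into A -> prop_s and A -> P(1). *)
Definition rOmega : rel := fun x y => holds (fst x) <-> holds (fst y).

Definition ex_in (R : rel) (P : el -> Prop) : Prop := exists x, R x x /\ P x.
Definition all_in (R : rel) (P : el -> Prop) : Prop := forall x, R x x -> P x.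

(** The information produced by list recursion is given through its graph,
    since the realizer of a list may fail to evaluate to one. *)
Inductive lrec (X : info) (Y : expr -> expr -> info -> info) : expr -> info -> Prop :=
| lrec_Eps v : red v Eps -> lrec X Y v X
| lrec_Cns v s c d :
    red v (Cns s c) -> lrec X Y s d -> lrec X Y v (Y s c d).

Definition dLst (X : info) (Y : expr -> expr -> info -> info) (v : expr) : info :=
  fun p => exists d, lrec X Y v d /\ d p.
Definition dSum (X Y : expr -> info) (v : expr) : info := fun p =>
  (exists c, red v (Inl c) /\ X c p) \/ (exists c, red v (Inr c) /\ Y c p).
Definition dSig (X : el -> el -> info) (x : el) : info := fun p =>
  exists b c, red (snd x) (Pair b c) /\
    X (dfst (fst x), b) (dsnd (fst x), c) p.

Definition none : rel := crel False.

(** The second component of an item is the denotation of a variable used as a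
    type. It is [none] for declared variables; in raw expressions a variable
    may stand for a type, and this slot is what makes [sem_subst] hold for all
    of them. *)
Definition item : Type := el * rel.
Definition env : Type := nat -> item.

Definition bind (x : el) (g : env) : env := scons (x, none) g.

Definition rzs (g : env) : nat -> expr := fun n => snd (fst (g n)).

Definition rz (e : expr) (g : env) : expr := subst (rzs g) e.

(** The step of a list recursion occurs inside the realizer of the recursor,
    where its three bound variables remain bound. *)
Definition rz3 (e : expr) (g : env) : expr := subst (up (up (up (rzs g)))) e.

(** [den] interprets an expression as a type, [content] gives the information
    of an expression as a term; they are mutual since propositional equality
    and [Tau] mention terms while [PCls] and the codes mention types. Realizers
    are obtained by substitution, so no evaluation takes place here except in
    the eliminators whose information depends on a canonical form. *)
Fixpoint den (e : expr) (g : env) {struct e} : rel :=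
  match e with
  | Var n => snd (g n)
  | N1 => crel True
  | Lst A => rLst (den A g)
  | Sum A B => rSum (den A g) (den B g)
  | Sig A B => rSig (den A g) (fun x => den B (bind x g))
  | Pi A B => rPi (den A g) (fun x => den B (bind x g))
  | Quo A R => rQuo (den A g) (fun x y => den R (bind y (bind x g)))
  | PropS | Pow1 => rOmega
  | Tau p => crel (holds (content p g))
  | Or A B => crel (tr (den A g) \/ tr (den B g))
  | And A B => crel (tr (den A g) /\ tr (den B g))
  | Imp A B => crel (tr (den A g) -> tr (den B g))
  | Ex A B => crel (ex_in (den A g) (fun x => tr (den B (bind x g))))
  | All A B => crel (all_in (den A g) (fun x => tr (den B (bind x g))))
  | Eqp A a b => crel (den A g (content a g, rz a g) (content b g, rz b g))
  | _ => none
  end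
with content (e : expr) (g : env) {struct e} : info :=
  match e with
  | Var n => fst (fst (g n))
  | ElN1 t c => content c g
  | ElLst s a l =>
      dLst (content a g)
        (fun s' c d =>
           content l (bind (d, ElLst s' (rz a g) (rz3 l g))
                   (bind (pt c) (bind (pt s') g))))
        (rz s g)
  | ElSum w a b =>
      dSum (fun c => content a (bind (pt c) g)) (fun c => content b (bind (pt c) g))
        (rz w g)
  | Pair b c => dpair (content b g) (content c g)
  | ElSig d m => dSig (fun x y => content m (bind y (bind x g))) (content d g, rz d g)
  | Lam B c => dlam (fun w => content c (bind (pt w) g))
  | Ap f b => dapp (content f g) (rz b g)
  | Cls a => content a g
  | ElQuo p l => content l (bind (pt (rz p g)) g)
  | PCls phi => dprop (tr (den phi g))
  | COr p q => dprop (holds (content p g) \/ holds (content q g))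
  | CAnd p q => dprop (holds (content p g) /\ holds (content q g))
  | CImp p q => dprop (holds (content p g) -> holds (content q g))
  | CEx B p => dprop (ex_in (den B g) (fun x => holds (content p (bind x g))))
  | CAll B p => dprop (all_in (den B g) (fun x => holds (content p (bind x g))))
  | CEqp A a b => dprop (den A g (content a g, rz a g) (content b g, rz b g))
  | _ => d0
  end.

Definition ev (e : expr) (g : env) : el := (content e g, rz e g).
Definition val (e : expr) (g : env) : item := (ev e g, den e g).

Definition senv (s : nat -> expr) (g : env) : env := fun n => val (s n) g.

Lemma rz_ren r e g : rz (ren r e) g = rz e (fun n => g (r n)).
Proof. apply subst_ren. Qed.

Lemma rz_subst s e g : rz (subst s e) g = rz e (senv s g).
Proof. apply subst_subst. Qed.

Lemma rz3_ren r e g : rz3 (ren (upr (upr (upr r))) e) g = rz3 e (fun n => g (r n)).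
Proof. unfold rz3; rewrite subst_ren, <- !up_ren; reflexivity. Qed.

Lemma rz3_subst s e g : rz3 (subst (up (up (up s))) e) g = rz3 e (senv s g).
Proof. unfold rz3; rewrite subst_subst, <- !subst_up; reflexivity. Qed.

Lemma bind_upr x g r :
  (fun n => bind x g (upr r n)) = bind x (fun n => g (r n)).
Proof. fext; intros [|n]; reflexivity. Qed.

Ltac split_ih :=
  repeat match goal with
  | H : forall r g, _ /\ _ |- _ =>
      let H1 := fresh "Ht" in let H2 := fresh "Hd" in
      pose proof (fun r g => proj1 (H r g)) as H1;
      pose proof (fun r g => proj2 (H r g)) as H2; clear H
  end.

Ltac congr_with tac :=
  repeat (match goal with
          | |- (fun _ => _) = (fun _ => _) => fext; intro
          | |- ?x = ?x => reflexivity
          | |- den _ _ = den _ _ => tac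
          | |- content _ _ = content _ _ => tac
          | |- _ => f_equal
          end).

Lemma sem_ren e : forall r g,
  den (ren r e) g = den e (fun n => g (r n)) /\
  content (ren r e) g = content e (fun n => g (r n)).
Proof.
induction e; intros r g; split_ih; (split; cbn [ren den content]; [|]);
  rewrite ?rz_ren, ?rz3_ren;
  repeat match goal with
  | H : forall r g, den (ren r ?e) g = _ |- context [den (ren _ ?e) g] => rewrite H
  | H : forall r g, content (ren r ?e) g = _ |- context [content (ren _ ?e) g] => rewrite H
  end; try reflexivity;
  congr_with ltac:(
    match goal with
    | H : forall r g, den (ren r ?e) g = _ |- den (ren _ ?e) _ = _ => rewrite H
    | H : forall r g, content (ren r ?e) g = _ |- content (ren _ ?e) _ = _ => rewrite H
    end; rewrite ?bind_upr; reflexivity).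
Qed.

Lemma val_ren r e g : val (ren r e) g = val e (fun n => g (r n)).
Proof.
unfold val, ev; destruct (sem_ren e r g) as [-> ->]; now rewrite rz_ren.
Qed.

Lemma val_Var n g : val (Var n) g = g n.
Proof.
change (((fst (fst (g n)), snd (fst (g n))), snd (g n)) = g n).
now destruct (g n) as [[d v] R].
Qed.

Lemma senv_up s x g : senv (up s) (scons x g) = scons x (senv s g).
Proof.
fext; intros [|n]; unfold senv; cbn [up scons]; [apply val_Var|].
unfold wk; rewrite val_ren; reflexivity.
Qed.

Lemma senv_up_bind s x g : senv (up s) (bind x g) = bind x (senv s g).
Proof. apply senv_up. Qed.

(** Because a realizer is an instance of the syntax and not a closure with its
    own environment, both sides have literally the same realizers, and this is
    an equality and not only a relatedness at some type. *)
Lemma sem_subst e : forall s g,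
  den (subst s e) g = den e (senv s g) /\ content (subst s e) g = content e (senv s g).
Proof.
induction e; intros s g; split_ih; (split; cbn [subst den content]; [|]);
  rewrite ?rz_subst, ?rz3_subst;
  repeat match goal with
  | H : forall r g, den (subst r ?e) g = _ |- context [den (subst _ ?e) g] => rewrite H
  | H : forall r g, content (subst r ?e) g = _ |- context [content (subst _ ?e) g] => rewrite H
  end; try reflexivity;
  congr_with ltac:(
    match goal with
    | H : forall r g, den (subst r ?e) g = _ |- den (subst _ ?e) _ = _ => rewrite H
    | H : forall r g, content (subst r ?e) g = _ |- content (subst _ ?e) _ = _ => rewrite H
    end; rewrite ?senv_up_bind; reflexivity).
Qed.

Lemma val_subst s e g : val (subst s e) g = val e (senv s g).
Proof.
unfold val, ev; destruct (sem_subst e s g) as [-> ->]; now rewrite rz_subst.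
Qed.

Lemma val_at1 n C a g : val (at1 n C a) g = val C (scons (val a g) (fun k => g (n + k))).
Proof.
unfold at1; rewrite val_subst; f_equal; fext; intros [|k];
  [reflexivity | exact (val_Var (n + k) g)].
Qed.

Lemma val_at2 n C a b g :
  val (at2 n C a b) g = val C (scons (val b g) (scons (val a g) (fun k => g (n + k)))).
Proof.
unfold at2; rewrite val_subst; f_equal; fext; intros [|[|k]];
  [reflexivity | reflexivity | exact (val_Var (n + k) g)].
Qed.

Lemma val_at3 n C a b c g :
  val (at3 n C a b c) g =
  val C (scons (val c g) (scons (val b g) (scons (val a g) (fun k => g (n + k))))).
Proof.
unfold at3; rewrite val_subst; f_equal; fext; intros [|[|[|k]]];
  [reflexivity | reflexivity | reflexivity | exact (val_Var (n + k) g)].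
Qed.

Lemma val_wk n C g : val (wk n C) g = val C (fun k => g (n + k)).
Proof. apply val_ren. Qed.

Lemma den_val e e' g g' : val e g = val e' g' -> den e g = den e' g'.
Proof. intros H; exact (f_equal snd H). Qed.

Definition den_subst s e g := den_val _ _ _ _ (val_subst s e g).
Definition den_at1 n C a g := den_val _ _ _ _ (val_at1 n C a g).
Definition den_at2 n C a b g := den_val _ _ _ _ (val_at2 n C a b g).
Definition den_wk n C g := den_val _ _ _ _ (val_wk n C g).

(** * Partial equivalence relations *)

Lemma rel_ext (R S : rel) : (forall x y, R x y <-> S x y) -> R = S.
Proof. intros H; fext; intros x; fext; intros y; apply propositional_extensionality, H. Qed.

Lemma crel_ext P Q : (P <-> Q) -> crel P = crel Q.
Proof. intros H; apply rel_ext; intros x y; exact H. Qed.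

(** Closure under reduction in both directions, [per_red], replaces a
    separate notion of conversion between realizers. *)
Record per (R : rel) : Prop := {
  per_sym x y : R x y -> R y x;
  per_trans x y z : R x y -> R y z -> R x z;
  per_red d v v' y : red v v' -> (R (d, v) y <-> R (d, v') y) }.

Lemma per_l R x y : per R -> R x y -> R x x.
Proof. intros HR H; apply (per_trans _ HR x y x); [|apply (per_sym _ HR)]; exact H. Qed.

Lemma per_r R x y : per R -> R x y -> R y y.
Proof. intros HR H; apply (per_trans _ HR y x y); [apply (per_sym _ HR)|]; exact H. Qed.

Lemma per_exp R d v v' d2 w w' :
  per R -> red v v' -> red w w' -> R (d, v') (d2, w') -> R (d, v) (d2, w).
Proof.
intros HR Hv Hw H; apply (per_red _ HR d v v' _ Hv).
apply (per_sym _ HR), (per_red _ HR d2 w w' _ Hw), (per_sym _ HR), H.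
Qed.

Lemma per_exp_l R d v v' y : per R -> red v v' -> R (d, v') y -> R (d, v) y.
Proof. intros HR Hv H; apply (per_red _ HR d v v' _ Hv), H. Qed.

Lemma per_crel P : per (crel P).
Proof. split; unfold crel; tauto. Qed.

Lemma per_rOmega : per rOmega.
Proof. split; unfold rOmega; cbn; tauto. Qed.

(** Respect for R and equality of the two families are stated together:
    [fam R S S] says that S is a family over R. *)
Definition fam (R : rel) (S S' : el -> rel) : Prop :=
  forall x y, R x y -> per (S x) /\ S x = S' y.

Lemma lrel_red R v v' y : red v v' -> (lrel R v y <-> lrel R v' y).
Proof.
intros Hv; split; intros H; inversion H; subst.
1,3: apply lrel_Eps; [|assumption]; apply (red_canon v v'); auto.
1,2: eapply lrel_Cns; try eassumption; apply (red_canon v v'); auto.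
Qed.

Lemma lrel_sym R v v' : per R -> lrel R v v' -> lrel R v' v.
Proof.
intros HR H; induction H; [now apply lrel_Eps|].
eapply lrel_Cns; try eassumption; now apply (per_sym _ HR).
Qed.

(* By determinism, two canonical forms of one realizer coincide. *)
Ltac canon_inj :=
  repeat match goal with
  | H : red ?v ?a, H' : red ?v ?b |- _ =>
      assert_fails (constr_eq a b);
      let E := fresh in
      assert (E : a = b) by (apply (red_canon_eq v); auto);
      first [discriminate E | injection E as; subst; clear H' | clear H]
  end.

Lemma lrel_trans R u v w : per R -> lrel R u v -> lrel R v w -> lrel R u w.
Proof.
intros HR H; revert w; induction H; intros w Hw; inversion Hw; subst; canon_inj.
- now apply lrel_Eps.
- eapply lrel_Cns; try eassumption; [auto|eapply per_trans; eassumption].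
Qed.

Lemma per_rLst R : per R -> per (rLst R).
Proof.
intros HR; split; unfold rLst; cbn.
- intros x y; now apply lrel_sym.
- intros x y z; now apply lrel_trans.
- intros _ v v' y; apply lrel_red.
Qed.

Lemma per_rSum R S : per R -> per S -> per (rSum R S).
Proof.
intros HR HS; split; unfold rSum; cbn.
- intros x y [(c & c' & H1 & H2 & H)|(c & c' & H1 & H2 & H)]; [left|right];
    exists c', c; repeat split; auto; apply per_sym; auto.
- intros x y z [(c & c' & H1 & H2 & H)|(c & c' & H1 & H2 & H)]
    [(b & b' & H3 & H4 & H')|(b & b' & H3 & H4 & H')]; canon_inj; [left|right];
    exists c, b'; repeat split; auto; eapply per_trans; eassumption.
- intros _ v v' y Hv; split;
    (intros [(c & c' & H1 & H2 & H)|(c & c' & H1 & H2 & H)]; [left|right];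
     exists c, c'; repeat split; auto; apply (red_canon v v'); auto).
Qed.

Lemma per_rSig R S : per R -> fam R S S -> per (rSig R S).
Proof.
intros HR HS; split; unfold rSig; cbn.
- intros x y (b & c & b' & c' & H1 & H2 & Hb & Hc).
  exists b', c', b, c; repeat split; auto; [now apply per_sym|].
  destruct (HS _ _ Hb) as [HP <-]; now apply per_sym.
- intros x y z (b & c & b' & c' & H1 & H2 & Hb & Hc)
    (b2 & c2 & b'' & c'' & H3 & H4 & Hb' & Hc'); canon_inj.
  exists b, c, b'', c''; repeat split; auto; [eapply per_trans; eassumption|].
  destruct (HS _ _ Hb) as [HP E]; rewrite <- E in Hc'.
  eapply per_trans; eassumption.
- intros d v v' y Hv; split;
    (intros (b & c & b' & c' & H1 & H2 & Hb & Hc);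
     exists b, c, b', c'; repeat split; auto; apply (red_canon v v'); auto).
Qed.

Lemma per_rPi R S : per R -> fam R S S -> per (rPi R S).
Proof.
intros HR HS; split; unfold rPi, papp; cbn.
- intros x y H w w' Hw.
  destruct (HS _ _ Hw) as [HP ->].
  destruct (HS _ _ (per_sym _ HR _ _ Hw)) as [HP' _].
  apply (per_sym _ HP'), H, (per_sym _ HR), Hw.
- intros x y z H H' w w' Hw.
  destruct (HS _ _ Hw) as [HP _].
  apply (per_trans _ HP _ (dapp (fst y) w, Ap (snd y) w)); auto.
  apply H, (per_l _ _ _ HR Hw).
- intros d v v' y Hv; split; intros H w w' Hw;
    destruct (HS _ _ Hw) as [HP _];
    apply (per_red _ HP _ _ _ _ (red_Ap v v' w Hv)); auto.
Qed.

Lemma rSig_ext R S S' : per R -> fam R S S' -> rSig R S = rSig R S'.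
Proof.
intros HR HS; apply rel_ext; intros x y; split;
  intros (b & c & b' & c' & H1 & H2 & Hb & Hc);
  exists b, c, b', c'; repeat split; auto;
  destruct (HS _ _ (per_l _ _ _ HR Hb)) as [_ E];
  [rewrite <- E | rewrite E]; exact Hc.
Qed.

Lemma rPi_ext R S S' : per R -> fam R S S' -> rPi R S = rPi R S'.
Proof.
intros HR HS; apply rel_ext; intros x y; split; intros H w w' Hw;
  destruct (HS _ _ (per_l _ _ _ HR Hw)) as [_ E];
  [rewrite <- E | rewrite E]; auto.
Qed.

Lemma ex_in_iff R P Q :
  (forall x, R x x -> (P x <-> Q x)) -> ex_in R P <-> ex_in R Q.
Proof. intros H; split; intros (x & Hx & HP); exists x; firstorder. Qed.

Lemma all_in_iff R P Q :
  (forall x, R x x -> (P x <-> Q x)) -> all_in R P <-> all_in R Q.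
Proof. intros H; split; intros HP x Hx; apply H; auto. Qed.

Record equiv_on (R : rel) (S : el -> el -> rel) : Prop := {
  equiv_cong x x' y y' : R x x' -> R y y' -> tr (S x y) -> tr (S x' y');
  equiv_refl x : R x x -> tr (S x x);
  equiv_sym x y : R x x -> R y y -> tr (S x y) -> tr (S y x);
  equiv_trans x y z : R x x -> R y y -> R z z ->
    tr (S x y) -> tr (S y z) -> tr (S x z) }.

Lemma per_rQuo R S : per R -> equiv_on R S -> per (rQuo R S).
Proof.
intros HR HS; split; unfold rQuo; cbn.
- intros x y (Hx & Hy & H); repeat split; auto; now apply (equiv_sym _ _ HS).
- intros x y z (Hx & Hy & H) (_ & Hz & H'); repeat split; auto.
  now apply (equiv_trans _ _ HS _ (pt (snd y))).
- intros _ v v' y Hv.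
  assert (Hp : R (pt v) (pt v) <-> R (pt v') (pt v')).
  { split; intros H; eapply per_l; try exact HR;
      apply (per_red _ HR d0 v v' _ Hv), H. }
  assert (Hc : R (pt v) (pt v) -> R (pt v) (pt v')).
  { intros H; apply (per_sym _ HR), (per_red _ HR d0 v v' _ Hv), H. }
  split; intros (Hx & Hy & H); repeat split; auto; try (apply Hp; assumption).
  + apply (equiv_cong _ _ HS (pt v) _ (pt (snd y)) _); auto.
  + apply Hp in Hx. apply (equiv_cong _ _ HS (pt v') _ (pt (snd y)) _); auto.
    apply (per_sym _ HR); auto.
Qed.

Lemma rQuo_ext R S S' :
  (forall x y, R x x -> R y y -> (tr (S x y) <-> tr (S' x y))) ->
  rQuo R S = rQuo R S'.
Proof.
intros H; apply rel_ext; intros x y; unfold rQuo; split;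
  intros (Hx & Hy & HS); repeat split; auto; apply H; auto.
Qed.

Lemma lrec_fun X Y v d d' : lrec X Y v d -> lrec X Y v d' -> d = d'.
Proof.
intros H; revert d'; induction H; intros d' H'; inversion H'; subst; canon_inj;
  [reflexivity | f_equal; auto].
Qed.

Lemma dLst_lrec X Y v d : lrec X Y v d -> dLst X Y v = d.
Proof.
intros H; fext; intros p; apply propositional_extensionality; split.
- intros (d' & H' & Hp); now rewrite (lrec_fun _ _ _ _ _ H H').
- intros Hp; now exists d.
Qed.

Lemma dSum_Inl X Y v c : red v (Inl c) -> dSum X Y v = X c.
Proof.
intros H; fext; intros p; apply propositional_extensionality; split.
- intros [(c' & H' & Hp)|(c' & H' & Hp)]; canon_inj; assumption.
- intros Hp; left; eauto.
Qed.

Lemma dSum_Inr X Y v c : red v (Inr c) -> dSum X Y v = Y c.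
Proof.
intros H; fext; intros p; apply propositional_extensionality; split.
- intros [(c' & H' & Hp)|(c' & H' & Hp)]; canon_inj; assumption.
- intros Hp; right; eauto.
Qed.

Lemma dSig_Pair X x b c :
  red (snd x) (Pair b c) -> dSig X x = X (dfst (fst x), b) (dsnd (fst x), c).
Proof.
intros H; fext; intros p; apply propositional_extensionality; split.
- intros (b' & c' & H' & Hp); canon_inj; assumption.
- intros Hp; exists b, c; auto.
Qed.

(** Two list recursions with related bases and steps are related at each pair
    of equal lists: induction on the proof that the lists are equal. [L] and
    [L'] are the steps as functions of the recursive result, the head and the
    tail; the first two hypotheses say that the realizer of the recursor
    unfolds to the realizer of the step. *)
Lemma rec_list R M a a' l l' X X' (L L' : el -> expr -> expr -> el) v v' :
  (forall s c r, red (ElLst (Cns s c) a l) (snd (L (r, ElLst s a l) c s))) ->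
  (forall s c r, red (ElLst (Cns s c) a' l') (snd (L' (r, ElLst s a' l') c s))) ->
  per R ->
  fam (rLst R) M M ->
  M (pt Eps) (X, a) (X', a') ->
  (forall s s' c c' r r', lrel R s s' -> R (pt c) (pt c') -> M (pt s) r r' ->
     M (pt (Cns s c)) (L r c s) (L' r' c' s')) ->
  lrel R v v' ->
  exists d d',
    lrec X (fun s c d => fst (L (d, ElLst s a l) c s)) v d /\
    lrec X' (fun s c d => fst (L' (d, ElLst s a' l') c s)) v' d' /\
    M (pt v) (d, ElLst v a l) (d', ElLst v' a' l').
Proof.
intros E E' HR HM Ha Hl H.
assert (Hpl := per_rLst R HR).
induction H as [v v' Hv Hv'|v v' s s' c c' Hv Hv' Hs (d & d' & Hd & Hd' & IH) Hc].
- exists X, X'; split; [|split]; [now apply lrec_Eps|now apply lrec_Eps|].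
  destruct (HM (pt v) (pt Eps)) as [HP ->]; [apply lrel_Eps; auto|].
  destruct (HM (pt Eps) (pt Eps)) as [HP' _]; [apply lrel_Eps; auto|].
  apply (per_exp _ _ _ a _ _ a' HP'); [| |exact Ha];
    (eapply red_trans; [apply red_ElLst; eassumption|]; apply red_step; constructor).
- eexists _, _; split; [|split]; [eapply lrec_Cns; eassumption..|].
  destruct (HM (pt v) (pt (Cns s c))) as [HP ->].
  { apply (lrel_Cns _ _ _ s s c c); auto.
    - apply (per_l _ (pt s) (pt s') Hpl Hs).
    - eapply per_l; eassumption. }
  destruct (HM (pt (Cns s c)) (pt (Cns s c))) as [HP' _].
  { apply (lrel_Cns _ _ _ s s c c); auto.
    - apply (per_l _ (pt s) (pt s') Hpl Hs).
    - eapply per_l; eassumption. }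
  specialize (Hl _ _ _ _ _ _ Hs Hc IH).
  destruct (L _ _ _) as [x y] eqn:E1, (L' _ _ _) as [x' y'] eqn:E2; cbn.
  apply (per_exp _ _ _ y _ _ y' HP'); [| |exact Hl].
  + eapply red_trans; [apply red_ElLst; eassumption|].
    specialize (E s c d); now rewrite E1 in E.
  + eapply red_trans; [apply red_ElLst; eassumption|].
    specialize (E' s' c' d'); now rewrite E2 in E'.
Qed.

(** * Validity of judgements *)

Definition irel (R : rel) (x y : item) : Prop :=
  R (fst x) (fst y) /\ snd x = none /\ snd y = none.

Definition tl (g : env) : env := fun n => g (S n).

Fixpoint cenv (G : ctx) (g g' : env) : Prop :=
  match G with
  | [] => True
  | A :: G => cenv G (tl g) (tl g') /\ irel (den A (tl g)) (g 0) (g' 0)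
  end.

(** Taking the environments of both sides related, not equal, makes respect
    for equality of environments a part of this notion. *)
Definition veq (G : ctx) (A B : expr) : Prop :=
  forall g g', cenv G g g' -> per (den A g) /\ den A g = den B g'.

Definition vty (G : ctx) (A : expr) : Prop := veq G A A.

Fixpoint vctx (G : ctx) : Prop :=
  match G with [] => True | A :: G => vctx G /\ vty G A end.

(** The semantic property of sets: only realizers matter. *)
Definition irr (G : ctx) (A : expr) : Prop :=
  forall g d d' e e' v v', cenv G g g ->
    den A g (d, v) (d', v') -> den A g (e, v) (e', v').

(** The semantic property of propositions: their relation is constant. *)
Definition pirr (G : ctx) (A : expr) : Prop :=
  forall g x y x' y', cenv G g g -> den A g x y -> den A g x' y'.

Definition kc (k : kind) (G : ctx) (A : expr) : Prop :=
  match k with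
  | KCol => True | KSet => irr G A | KProp | KProps => pirr G A
  end.

(** The rules for products and quotients have the formed type as a premise and
    use its components, which the denotation alone does not give back; they are
    recorded here. Excluding variables keeps the record stable under
    substitution: only a variable can change its head when instantiated. *)
Definition shape (G : ctx) (A : expr) : Prop :=
  match A with
  | Var _ => False
  | Pi B C => vty G B /\ irr G B /\ vty (B :: G) C
  | Quo B R => vty G B /\ irr G B /\ vty (wk 1 B :: B :: G) R /\
      pirr (wk 1 B :: B :: G) R /\
      forall g, cenv G g g ->
        equiv_on (den B g) (fun x y => den R (bind y (bind x g)))
  | _ => True
  end.

Definition vtm (G : ctx) (a b A : expr) : Prop :=
  vctx G /\ vty G A /\
  forall g g', cenv G g g' -> irel (den A g) (val a g) (val b g').

Definition valid (J : judgement) : Prop :=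
  match J with
  | Cont G => vctx G
  | Ty k G A => vctx G /\ vty G A /\ kc k G A /\ shape G A
  | TyEq k G A B => vctx G /\ veq G A B
  | Tm G a A => vtm G a a A
  | TmEq G a b A => vtm G a b A
  | SubEq G s t D => vctx G /\ vctx D /\
      forall g g', cenv G g g' -> cenv D (senv s g) (senv t g')
  end.

Lemma irel_sym R x y : per R -> irel R x y -> irel R y x.
Proof. intros HR (H & H1 & H2); split; auto; now apply (per_sym _ HR). Qed.

Lemma irel_trans R x y z : per R -> irel R x y -> irel R y z -> irel R x z.
Proof.
intros HR (H & H1 & H2) (H' & H1' & H2'); split; auto.
eapply (per_trans _ HR); eassumption.
Qed.

Lemma cenv_sym G g g' : vctx G -> cenv G g g' -> cenv G g' g.
Proof.
revert g g'; induction G as [|A G IH]; cbn; auto.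
intros g g' [HG HA] [Hg H]; split; [auto|].
destruct (HA _ _ Hg) as [HP E]; rewrite <- E; now apply irel_sym.
Qed.

Lemma cenv_trans G g g' g'' :
  vctx G -> cenv G g g' -> cenv G g' g'' -> cenv G g g''.
Proof.
revert g g' g''; induction G as [|A G IH]; cbn; auto.
intros g g' g'' [HG HA] [Hg H] [Hg' H']; split; [eauto|].
destruct (HA _ _ Hg) as [HP E]; rewrite <- E in H'; eapply irel_trans; eauto.
Qed.

Lemma cenv_l G g g' : vctx G -> cenv G g g' -> cenv G g g.
Proof. intros HG H; eapply cenv_trans; eauto; now apply cenv_sym. Qed.

Lemma cenv_r G g g' : vctx G -> cenv G g g' -> cenv G g' g'.
Proof. intros HG H; eapply cenv_trans; eauto; now apply cenv_sym. Qed.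

Lemma cenv_cons G A g g' x y :
  cenv G g g' -> irel (den A g) x y -> cenv (A :: G) (scons x g) (scons y g').
Proof. intros Hg H; exact (conj Hg H). Qed.

Lemma irel_pure (R : rel) x y : R x y -> irel R (x, none) (y, none).
Proof. repeat split; auto. Qed.

Lemma cenv_bind G A g g' x y :
  cenv G g g' -> den A g x y -> cenv (A :: G) (bind x g) (bind y g').
Proof. intros Hg H; apply cenv_cons; auto; now apply irel_pure. Qed.

Lemma veq_sym G A B : vctx G -> veq G A B -> veq G B A.
Proof.
intros HG H g g' Hg.
destruct (H _ _ (cenv_sym _ _ _ HG Hg)) as [_ E1].
destruct (H _ _ (cenv_r _ _ _ HG Hg)) as [HP E2].
destruct (H _ _ (cenv_l _ _ _ HG Hg)) as [HP' E3].
split; [rewrite <- E3; auto | congruence].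
Qed.

Lemma veq_trans G A B C : vctx G -> veq G A B -> veq G B C -> veq G A C.
Proof.
intros HG H H' g g' Hg.
destruct (H _ _ (cenv_l _ _ _ HG Hg)) as [HP E1].
destruct (H' _ _ Hg) as [_ E2]; split; congruence.
Qed.

Lemma veq_l G A B : vctx G -> veq G A B -> vty G A.
Proof. intros HG H; eapply veq_trans; eauto; now apply veq_sym. Qed.

Lemma veq_r G A B : vctx G -> veq G A B -> vty G B.
Proof. intros HG H; eapply veq_trans; eauto; now apply veq_sym. Qed.

Lemma veq_fam G A B B' g g' :
  veq (A :: G) B B' -> cenv G g g' ->
  fam (den A g) (fun x => den B (bind x g)) (fun x => den B' (bind x g')).
Proof. intros H Hg x y Hx; apply H, cenv_bind; auto. Qed.

Lemma pirr_irr G A : pirr G A -> irr G A.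
Proof. intros H g d d' e e' v v' Hg; apply H; auto. Qed.

Lemma kc_crel k G A :
  is_prop k -> (forall g, exists P, den A g = crel P) -> kc k G A.
Proof.
intros Hk H; enough (pirr G A) by (destruct Hk as [-> | ->]; auto).
intros g x y x' y' _; destruct (H g) as [P ->]; auto.
Qed.

Lemma tr_iff G A g x y : pirr G A -> cenv G g g -> (den A g x y <-> tr (den A g)).
Proof. intros H Hg; split; apply H; auto. Qed.

Lemma prop_irel G A g x y :
  pirr G A -> cenv G g g -> tr (den A g) -> snd x = none -> snd y = none ->
  irel (den A g) x y.
Proof. intros H Hg Ht; split; auto; now apply (tr_iff _ _ _ _ _ H Hg). Qed.

Lemma irel_tr G A g x y : pirr G A -> cenv G g g -> irel (den A g) x y -> tr (den A g).
Proof. intros H Hg [Ht _]; now apply (tr_iff _ _ _ _ _ H Hg) in Ht. Qed.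

Section Sub.
Variables (G D : ctx) (s t : nat -> expr).
Hypothesis (Hs : valid (SubEq G s t D)).

Lemma sub_l : valid (SubEq G s s D).
Proof.
destruct Hs as (HG & HD & H); split; [|split]; auto.
intros g g' Hg; apply (cenv_trans _ _ (senv t g') _ HD); auto.
apply cenv_sym; auto; apply H; eapply cenv_r; eauto.
Qed.

Lemma sub_veq A B : veq D A B -> veq G (subst s A) (subst t B).
Proof.
intros H g g' Hg; rewrite !den_subst; apply H, Hs, Hg.
Qed.

Lemma sub_vtm a b A :
  vtm D a b A -> vtm G (subst s a) (subst t b) (subst s A).
Proof.
intros (_ & HA & H); split; [|split]; [apply Hs| |].
- intros g g' Hg; rewrite !den_subst; apply HA, sub_l, Hg.
- intros g g' Hg; rewrite !val_subst, !den_subst; apply H, Hs, Hg.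
Qed.

Lemma sub_irr A : irr D A -> irr G (subst s A).
Proof.
intros H g d d' e e' v v' Hg; rewrite !den_subst; apply H, sub_l, Hg.
Qed.

Lemma sub_pirr A : pirr D A -> pirr G (subst s A).
Proof.
intros H g x y x' y' Hg; rewrite !den_subst; apply H, sub_l, Hg.
Qed.

Lemma sub_kc k A : kc k D A -> kc k G (subst s A).
Proof. destruct k; cbn; auto using sub_irr, sub_pirr. Qed.
End Sub.

Lemma scons_eta {X} (g : nat -> X) : scons (g 0) (fun n => g (S n)) = g.
Proof. fext; intros [|n]; reflexivity. Qed.

Lemma sub_lift G s t D A :
  vty D A -> valid (SubEq G s t D) ->
  valid (SubEq (subst s A :: G) (up s) (up t) (A :: D)).
Proof.
intros HA Hs; assert (Hs' := sub_l _ _ _ _ Hs); split; [|split].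
- split; [apply Hs | now apply (sub_veq _ _ _ _ Hs')].
- split; [apply Hs | exact HA].
- intros g g' [Hg Hx]; rewrite <- (scons_eta g), <- (scons_eta g'), !senv_up.
  apply cenv_cons; [apply Hs, Hg|]; rewrite den_subst in Hx; exact Hx.
Qed.

Lemma wk_sub G D : vctx G -> vctx (D ++ G) ->
  valid (SubEq (D ++ G) (shift (length D)) (shift (length D)) G).
Proof.
intros HG HD; split; [|split]; auto.
intros g g' Hg.
assert (E : forall h, senv (shift (length D)) h = (fun n => h (length D + n))).
{ intros h; fext; intros n; apply val_Var. }
rewrite !E; clear E.
revert g g' HD Hg; induction D as [|A D IH]; intros g g' HD Hg; [exact Hg|].
exact (IH _ _ (proj1 HD) (proj1 Hg)).
Qed.

Lemma wk_subst n A : wk n A = subst (shift n) A.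
Proof.
unfold wk, shift; rewrite <- (subst_Var (ren _ A)), subst_ren; reflexivity.
Qed.

Lemma wk1_vty G A B : vctx G -> vty G B -> vty G A -> vty (B :: G) (wk 1 A).
Proof.
intros HG HB HA; rewrite wk_subst.
apply (sub_veq _ _ _ _ (wk_sub G [B] HG (conj HG HB))), HA.
Qed.

Lemma up_wk1 s A : subst (up s) (wk 1 A) = wk 1 (subst s A).
Proof. unfold wk; rewrite subst_ren, ren_subst; reflexivity. Qed.

Lemma sub_shape G s t D A :
  valid (SubEq G s t D) -> shape D A -> shape G (subst s A).
Proof.
intros Hs H; apply sub_l in Hs.
destruct A; cbn [subst shape] in *; auto; [now elim H| |].
- destruct H as (H1 & H2 & H3); split; [|split].
  + now apply (sub_veq _ _ _ _ Hs).
  + now apply (sub_irr _ _ _ _ Hs).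
  + apply (sub_veq _ _ _ _ (sub_lift _ _ _ _ _ H1 Hs)), H3.
- destruct H as (H1 & H2 & H3 & H5 & H4).
  assert (Hl := sub_lift _ _ _ _ _ H1 Hs).
  assert (H1' := wk1_vty _ _ _ (proj1 (proj2 Hs)) H1 H1).
  apply (sub_lift _ _ _ _ _ H1') in Hl; rewrite up_wk1 in Hl.
  split; [|split; [|split; [|split]]].
  + now apply (sub_veq _ _ _ _ Hs).
  + now apply (sub_irr _ _ _ _ Hs).
  + apply (sub_veq _ _ _ _ Hl), H3.
  + apply (sub_pirr _ _ _ _ Hl), H5.
  + intros g Hg; apply Hs, H4 in Hg; rewrite den_subst.
    assert (E : (fun x y => den (subst (up (up s)) A2) (bind y (bind x g))) =
                (fun x y => den A2 (bind y (bind x (senv s g))))).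
    { fext; intros x; fext; intros y; now rewrite den_subst, !senv_up_bind. }
    rewrite E; exact Hg.
Qed.

Lemma val_at1_0 C a g : val (at1 0 C a) g = val C (scons (val a g) g).
Proof. apply val_at1. Qed.
Lemma val_at2_0 C a b g :
  val (at2 0 C a b) g = val C (scons (val b g) (scons (val a g) g)).
Proof. apply val_at2. Qed.
Lemma val_at3_0 C a b c g :
  val (at3 0 C a b c) g =
  val C (scons (val c g) (scons (val b g) (scons (val a g) g))).
Proof. apply val_at3. Qed.
Lemma den_at1_0 C a g : den (at1 0 C a) g = den C (scons (val a g) g).
Proof. apply den_at1. Qed.
Lemma den_at2_0 C a b g :
  den (at2 0 C a b) g = den C (scons (val b g) (scons (val a g) g)).
Proof. apply den_at2. Qed.

(** * Structural rules *)

Lemma valid_cons G A : valid (Ty KCol G A) -> valid (Cont (A :: G)).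
Proof. intros (H1 & H2 & _); split; auto. Qed.

Lemma valid_var G n A :
  valid (Cont G) -> nth_error G n = Some A -> valid (Tm G (Var n) (wk (S n) A)).
Proof.
intros HG; cbn in HG; intros Hn.
assert (H : vty G (wk (S n) A) /\ forall g g', cenv G g g' ->
          irel (den (wk (S n) A) g) (g n) (g' n)).
{ revert n Hn; induction G as [|B G IH]; intros [|n]; try discriminate.
  - intros [= ->]; split.
    + destruct HG; now apply wk1_vty.
    + intros g g' [Hg Hx]; rewrite den_wk; exact Hx.
  - intros Hn; destruct HG as [HG HB]; destruct (IH HG n Hn) as [HA H].
    assert (E : wk (S (S n)) A = wk 1 (wk (S n) A)).
    { unfold wk at 2; unfold wk; now rewrite ren_ren. }
    rewrite E; split; [now apply wk1_vty|].
    intros g g' [Hg Hx]; rewrite den_wk; exact (H _ _ Hg). }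
split; [|split]; [assumption|apply H|].
intros g g' Hg; rewrite !val_Var; apply H; auto.
Qed.

Lemma valid_ty_sub k k' G A : subkind k k' -> valid (Ty k G A) -> valid (Ty k' G A).
Proof.
intros Hk (H1 & H2 & H3 & H4); split; [|split; [|split]]; auto.
destruct Hk; cbn [kc] in *; auto using pirr_irr.
Qed.

Lemma valid_tyeq_sub k k' G A B : subkind k k' -> valid (TyEq k G A B) -> valid (TyEq k' G A B).
Proof. auto. Qed.

Lemma valid_tyeq_refl k G A : valid (Ty k G A) -> valid (TyEq k G A A).
Proof. intros (H1 & H2 & _); split; auto. Qed.
Lemma valid_tyeq_sym k G A B : valid (TyEq k G A B) -> valid (TyEq k G B A).
Proof. intros (H1 & H2); split; auto using veq_sym. Qed.
Lemma valid_tyeq_trans k G A B C :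
  valid (TyEq k G A B) -> valid (TyEq k G B C) -> valid (TyEq k G A C).
Proof. intros (H1 & H2) (_ & H3); split; eauto using veq_trans. Qed.

Lemma vtm_sym G a b A : vtm G a b A -> vtm G b a A.
Proof.
intros (HG & HA & H); split; [|split]; auto.
intros g g' Hg; destruct (HA _ _ Hg) as [HP E]; apply irel_sym; auto.
rewrite E; apply H, cenv_sym; auto.
Qed.

Lemma vtm_trans G a b c A : vtm G a b A -> vtm G b c A -> vtm G a c A.
Proof.
intros (HG & HA & H) (_ & _ & H'); split; [|split]; auto.
intros g g' Hg; destruct (HA _ _ Hg) as [HP E].
eapply irel_trans; [auto|apply H; eapply cenv_l; eauto|auto].
Qed.

Lemma vtm_l G a b A : vtm G a b A -> vtm G a a A.
Proof. intros H; eapply vtm_trans; eauto using vtm_sym. Qed.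

Lemma vtm_conv G a b A B : vtm G a b A -> veq G A B -> vtm G a b B.
Proof.
intros (HG & HA & H) HE; split; [|split]; auto; [eapply veq_r; eauto|].
intros g g' Hg; destruct (HE _ _ (cenv_l _ _ _ HG Hg)) as [_ <-]; auto.
Qed.

Lemma valid_sub_nil G s t : valid (Cont G) -> valid (SubEq G s t []).
Proof. repeat split; auto. Qed.

Lemma valid_sub_cons G s t D A :
  valid (SubEq G (fun n => s (S n)) (fun n => t (S n)) D) ->
  valid (Ty KCol D A) ->
  valid (TmEq G (s 0) (t 0) (subst (fun n => s (S n)) A)) ->
  valid (SubEq G s t (A :: D)).
Proof.
intros (HG & HD & H) (_ & HA & _) (_ & _ & H0); split; [|split]; [auto|split; auto|].
intros g g' Hg; split; [apply H, Hg|].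
specialize (H0 _ _ Hg); rewrite den_subst in H0; exact H0.
Qed.

Lemma valid_ty_subst k G D s t A :
  valid (SubEq G s t D) -> valid (Ty k D A) -> valid (Ty k G (subst s A)).
Proof.
intros Hs (H1 & H2 & H3 & H4); split; [apply Hs|split; [|split]].
- apply (sub_veq _ _ _ _ (sub_l _ _ _ _ Hs)), H2.
- eapply sub_kc; eauto.
- eapply sub_shape; eauto.
Qed.

Lemma valid_tyeq_subst k G D s t A B :
  valid (SubEq G s t D) -> valid (TyEq k D A B) ->
  valid (TyEq k G (subst s A) (subst t B)).
Proof. intros Hs [_ H]; split; [apply Hs | eapply sub_veq; eauto]. Qed.

Lemma valid_tm_subst G D s t a A :
  valid (SubEq G s t D) -> valid (Tm D a A) ->
  valid (Tm G (subst s a) (subst s A)).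
Proof. intros Hs H; apply (sub_vtm _ D _ _ (sub_l _ _ _ _ Hs)), H. Qed.

Lemma valid_tmeq_subst G D s t a b A :
  valid (SubEq G s t D) -> valid (TmEq D a b A) ->
  valid (TmEq G (subst s a) (subst t b) (subst s A)).
Proof. intros Hs H; eapply sub_vtm; eauto. Qed.

(** * Type formation *)

Lemma veq_crel G A B (P Q : env -> Prop) :
  (forall g, den A g = crel (P g)) -> (forall g, den B g = crel (Q g)) ->
  (forall g g', cenv G g g' -> (P g <-> Q g')) -> veq G A B.
Proof.
intros HA HB H g g' Hg; rewrite HA, HB; split; [apply per_crel|].
now apply crel_ext, H.
Qed.

Lemma veq_N0 G : vty G N0.
Proof. intros g g' Hg; split; [apply per_crel | reflexivity]. Qed.
Lemma veq_N1 G : vty G N1.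
Proof. intros g g' Hg; split; [apply per_crel | reflexivity]. Qed.
Lemma veq_Omega T G : vty G (Omega T).
Proof. intros g g' Hg; destruct T; (split; [apply per_rOmega | reflexivity]). Qed.

Lemma veq_Lst G A A' : veq G A A' -> veq G (Lst A) (Lst A').
Proof.
intros H g g' Hg; cbn; destruct (H _ _ Hg) as [HP <-]; split; auto using per_rLst.
Qed.

Lemma veq_Sum G A A' B B' : veq G A A' -> veq G B B' -> veq G (Sum A B) (Sum A' B').
Proof.
intros H H' g g' Hg; cbn; destruct (H _ _ Hg) as [HP <-], (H' _ _ Hg) as [HP' <-].
split; auto using per_rSum.
Qed.

Lemma veq_Sig G A A' B B' : vctx G ->
  veq G A A' -> veq (A :: G) B B' -> veq G (Sig A B) (Sig A' B').
Proof.
intros HG H H' g g' Hg; cbn.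
assert (HA := veq_l _ _ _ HG H).
assert (HB : vty (A :: G) B) by (eapply veq_l; [split|]; eassumption).
destruct (H _ _ Hg) as [HP <-]; split.
- apply per_rSig; auto; apply (veq_fam G); auto; eapply cenv_l; eauto.
- apply rSig_ext; auto; apply (veq_fam G); auto.
Qed.

Lemma veq_Pi G A A' B B' : vctx G ->
  veq G A A' -> veq (A :: G) B B' -> veq G (Pi A B) (Pi A' B').
Proof.
intros HG H H' g g' Hg; cbn.
assert (HA := veq_l _ _ _ HG H).
assert (HB : vty (A :: G) B) by (eapply veq_l; [split|]; eassumption).
destruct (H _ _ Hg) as [HP <-]; split.
- apply per_rPi; auto; apply (veq_fam G); auto; eapply cenv_l; eauto.
- apply rPi_ext; auto; apply (veq_fam G); auto.
Qed.

Lemma valid_N0 G : valid (Cont G) -> valid (Ty KSet G N0).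
Proof.
intros H; split; [auto|split; [apply veq_N0|split; [|exact I]]].
intros g d d' e e' v v' _ Hx; exact Hx.
Qed.
Lemma valid_N1 G : valid (Cont G) -> valid (Ty KSet G N1).
Proof.
intros H; split; [auto|split; [apply veq_N1|split; [|exact I]]].
intros g d d' e e' v v' _ Hx; exact Hx.
Qed.
Lemma valid_Omega T G : valid (Cont G) -> valid (Ty KCol G (Omega T)).
Proof. split; [|split; [|split]]; auto; [apply veq_Omega | exact I | destruct T; exact I]. Qed.

Lemma valid_Lst G A : valid (Ty KSet G A) -> valid (Ty KSet G (Lst A)).
Proof.
intros (H1 & H2 & _); split; [auto|split; [now apply veq_Lst|split; [|exact I]]].
intros g d d' e e' v v' Hg H; exact H.
Qed.

Lemma valid_tyeq_Lst G A A' : valid (TyEq KSet G A A') -> valid (TyEq KSet G (Lst A) (Lst A')).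
Proof. intros (H1 & H2); split; auto using veq_Lst. Qed.

Lemma valid_Sum G A B :
  valid (Ty KSet G A) -> valid (Ty KSet G B) -> valid (Ty KSet G (Sum A B)).
Proof.
intros (H1 & H2 & _) (_ & H2' & _); split; [auto|split; [now apply veq_Sum|split; [|exact I]]].
intros g d d' e e' v v' Hg H; exact H.
Qed.

Lemma valid_tyeq_Sum G A A' B B' :
  valid (TyEq KSet G A A') -> valid (TyEq KSet G B B') ->
  valid (TyEq KSet G (Sum A B) (Sum A' B')).
Proof. intros (H1 & H2) (_ & H3); split; auto using veq_Sum. Qed.

Lemma irr_pt G A g d v d' v' : irr G A -> cenv G g g ->
  den A g (d, v) (d', v') -> den A g (pt v) (pt v').
Proof. intros H Hg; now apply H. Qed.

(** A dependent sum of sets is again determined by realizers: changing the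
    information of a pair changes that of its first component, which the
    family of second components does not see. *)
Lemma valid_Sig k G A B : is_col k ->
  valid (Ty k G A) -> valid (Ty k (A :: G) B) -> valid (Ty k G (Sig A B)).
Proof.
intros Hk (H1 & H2 & H3 & _) (_ & H2' & H3' & _);
  split; [auto|split; [now apply veq_Sig|split; [|exact I]]].
destruct Hk as [-> | ->]; [exact I|].
intros g d d' e e' v v' Hg (b & c & b' & c' & E & E' & Hb & Hc).
exists b, c, b', c'; repeat split; auto; [now apply (H3 g (dfst d) (dfst d'))|].
assert (Hb' : den A g (dfst d, b) (dfst e, b)).
{ apply (H3 g (dfst d) (dfst d)); auto; eapply per_l; [apply (H2 g g Hg)|]; eassumption. }
cbn [fst snd] in *.
assert (Hb2 := cenv_bind G A g g _ _ Hg Hb').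
destruct (H2' _ _ Hb2) as [_ <-].
apply (H3' _ (dsnd d) (dsnd d')); auto.
eapply cenv_l; [|eassumption]; split; assumption.
Qed.

Lemma valid_tyeq_Sig k G A A' B B' : is_col k ->
  valid (TyEq k G A A') -> valid (TyEq k (A :: G) B B') ->
  valid (TyEq k G (Sig A B) (Sig A' B')).
Proof. intros _ (H1 & H2) (_ & H3); split; auto using veq_Sig. Qed.

Lemma valid_Pi G A B :
  valid (Ty KSet G A) -> valid (Ty KSet (A :: G) B) -> valid (Ty KSet G (Pi A B)).
Proof.
intros (H1 & H2 & H3 & _) (_ & H2' & H3' & _); split; [auto|split; [|split]].
- now apply veq_Pi.
- intros g d d' e e' v v' Hg H w w' Hw.
  eapply H3'; [|apply (H w w' Hw)].
  apply (cenv_l _ _ (bind (pt w') g)); [split; auto|]; apply cenv_bind; auto.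
- split; auto.
Qed.

Lemma valid_tyeq_Pi G A A' B B' :
  valid (TyEq KSet G A A') -> valid (TyEq KSet (A :: G) B B') ->
  valid (TyEq KSet G (Pi A B) (Pi A' B')).
Proof. intros (H1 & H2) (_ & H3); split; auto using veq_Pi. Qed.

Lemma valid_Pow T G A : valid (Ty KSet G A) -> valid (Ty KCol G (Arrow A (Omega T))).
Proof.
intros (H1 & H2 & H3 & _).
assert (H : vty (A :: G) (wk 1 (Omega T)))
  by (destruct T; [apply (veq_Omega mTT) | apply (veq_Omega emTT)]).
split; [auto|split; [|split]]; [now apply veq_Pi|exact I|split; auto].
Qed.

Lemma valid_tyeq_Pow T G A A' :
  valid (TyEq KSet G A A') ->
  valid (TyEq KCol G (Arrow A (Omega T)) (Arrow A' (Omega T))).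
Proof.
intros (H1 & H2).
assert (H : vty (A :: G) (wk 1 (Omega T)))
  by (destruct T; [apply (veq_Omega mTT) | apply (veq_Omega emTT)]).
split; auto; now apply veq_Pi.
Qed.

Lemma valid_Fls G : valid (Cont G) -> valid (Ty KProps G Fls).
Proof.
intros HG; split; [auto|split; [|split; [|exact I]]].
{ intros g g' Hg; split; [apply per_crel|reflexivity]. }
apply kc_crel; [now right|]; intros g; now exists False.
Qed.

Lemma veq_Or G A A' B B' : veq G A A' -> veq G B B' -> veq G (Or A B) (Or A' B').
Proof.
intros H H'; eapply veq_crel; [intros h; cbn [den]; reflexivity..|]; intros g g' Hg; cbn beta.
destruct (H _ _ Hg) as [_ ->], (H' _ _ Hg) as [_ ->]; tauto.
Qed.
Lemma veq_And G A A' B B' : veq G A A' -> veq G B B' -> veq G (And A B) (And A' B').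
Proof.
intros H H'; eapply veq_crel; [intros h; cbn [den]; reflexivity..|]; intros g g' Hg; cbn beta.
destruct (H _ _ Hg) as [_ ->], (H' _ _ Hg) as [_ ->]; tauto.
Qed.
Lemma veq_Imp G A A' B B' : veq G A A' -> veq G B B' -> veq G (Imp A B) (Imp A' B').
Proof.
intros H H'; eapply veq_crel; [intros h; cbn [den]; reflexivity..|]; intros g g' Hg; cbn beta.
destruct (H _ _ Hg) as [_ ->], (H' _ _ Hg) as [_ ->]; tauto.
Qed.
Lemma veq_Ex G A A' B B' : veq G A A' -> veq (A :: G) B B' -> veq G (Ex A B) (Ex A' B').
Proof.
intros H H'; eapply veq_crel; [intros h; cbn [den]; reflexivity..|]; intros g g' Hg; cbn beta.
destruct (H _ _ Hg) as [_ <-]; apply ex_in_iff; intros x Hx.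
destruct (veq_fam _ _ _ _ _ _ H' Hg _ _ Hx) as [_ ->]; tauto.
Qed.
Lemma veq_All G A A' B B' : veq G A A' -> veq (A :: G) B B' -> veq G (All A B) (All A' B').
Proof.
intros H H'; eapply veq_crel; [intros h; cbn [den]; reflexivity..|]; intros g g' Hg; cbn beta.
destruct (H _ _ Hg) as [_ <-]; apply all_in_iff; intros x Hx.
destruct (veq_fam _ _ _ _ _ _ H' Hg _ _ Hx) as [_ ->]; tauto.
Qed.

Lemma eqp_iff G A A' a a' b b' g g' : vctx G ->
  veq G A A' -> vtm G a a' A -> vtm G b b' A -> cenv G g g' ->
  (den A g (ev a g) (ev b g) <-> den A' g' (ev a' g') (ev b' g')).
Proof.
intros HG H Ha Hb Hg.
destruct (H _ _ Hg) as [HP <-].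
destruct Ha as (_ & _ & Ha), Hb as (_ & _ & Hb).
destruct (Ha _ _ Hg) as [Ha' _], (Hb _ _ Hg) as [Hb' _]; cbn in Ha', Hb'.
split; intros E.
- apply (per_trans _ HP _ (ev a g)); [now apply per_sym|].
  apply (per_trans _ HP _ (ev b g)); auto.
- apply (per_trans _ HP _ (ev a' g')); auto.
  apply (per_trans _ HP _ (ev b' g')); auto; now apply per_sym.
Qed.

Lemma veq_Eqp G A A' a a' b b' : vctx G ->
  veq G A A' -> vtm G a a' A -> vtm G b b' A -> veq G (Eqp A a b) (Eqp A' a' b').
Proof.
intros HG H Ha Hb; eapply veq_crel; [intros h; cbn [den]; reflexivity..|]; intros g g' Hg; cbn beta.
eapply eqp_iff; eauto.
Qed.

Ltac kc_tac := apply kc_crel; [assumption|]; intros g; eexists; cbn [den]; reflexivity.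

Lemma valid_Or k G A B : is_prop k ->
  valid (Ty k G A) -> valid (Ty k G B) -> valid (Ty k G (Or A B)).
Proof.
intros Hk (H1 & H2 & _) (_ & H3 & _); split; [auto|split; [|split]];
  [now apply veq_Or | kc_tac | exact I].
Qed.
Lemma valid_And k G A B : is_prop k ->
  valid (Ty k G A) -> valid (Ty k G B) -> valid (Ty k G (And A B)).
Proof.
intros Hk (H1 & H2 & _) (_ & H3 & _); split; [auto|split; [|split]];
  [now apply veq_And | kc_tac | exact I].
Qed.
Lemma valid_Imp k G A B : is_prop k ->
  valid (Ty k G A) -> valid (Ty k G B) -> valid (Ty k G (Imp A B)).
Proof.
intros Hk (H1 & H2 & _) (_ & H3 & _); split; [auto|split; [|split]];
  [now apply veq_Imp | kc_tac | exact I].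
Qed.
Lemma valid_Ex k G A B : is_prop k ->
  valid (Ty (dom k) G A) -> valid (Ty k (A :: G) B) -> valid (Ty k G (Ex A B)).
Proof.
intros Hk (H1 & H2 & _) (_ & H3 & _); split; [auto|split; [|split]];
  [now apply veq_Ex | kc_tac | exact I].
Qed.
Lemma valid_All k G A B : is_prop k ->
  valid (Ty (dom k) G A) -> valid (Ty k (A :: G) B) -> valid (Ty k G (All A B)).
Proof.
intros Hk (H1 & H2 & _) (_ & H3 & _); split; [auto|split; [|split]];
  [now apply veq_All | kc_tac | exact I].
Qed.
Lemma valid_Eqp k G A a b : is_prop k ->
  valid (Ty (dom k) G A) -> valid (Tm G a A) -> valid (Tm G b A) ->
  valid (Ty k G (Eqp A a b)).
Proof.
intros Hk (H1 & H2 & _) Ha Hb; split; [auto|split; [|split]];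
  [now apply veq_Eqp | kc_tac | exact I].
Qed.
Lemma valid_Eqp_Pow1 G U V :
  valid (Tm G U Pow1) -> valid (Tm G V Pow1) -> valid (Ty KProps G (Eqp Pow1 U V)).
Proof.
intros HU HV; split; [apply HU|split; [|split]];
  [apply veq_Eqp; auto; apply HU | | exact I].
apply kc_crel; [now right|]; intros g; eexists; cbn [den]; reflexivity.
Qed.

Lemma valid_tyeq_Or k G A A' B B' : is_prop k ->
  valid (TyEq k G A A') -> valid (TyEq k G B B') ->
  valid (TyEq k G (Or A B) (Or A' B')).
Proof. intros _ (H1 & H2) (_ & H3); split; auto using veq_Or. Qed.
Lemma valid_tyeq_And k G A A' B B' : is_prop k ->
  valid (TyEq k G A A') -> valid (TyEq k G B B') ->
  valid (TyEq k G (And A B) (And A' B')).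
Proof. intros _ (H1 & H2) (_ & H3); split; auto using veq_And. Qed.
Lemma valid_tyeq_Imp k G A A' B B' : is_prop k ->
  valid (TyEq k G A A') -> valid (TyEq k G B B') ->
  valid (TyEq k G (Imp A B) (Imp A' B')).
Proof. intros _ (H1 & H2) (_ & H3); split; auto using veq_Imp. Qed.
Lemma valid_tyeq_Ex k G A A' B B' : is_prop k ->
  valid (TyEq (dom k) G A A') -> valid (TyEq k (A :: G) B B') ->
  valid (TyEq k G (Ex A B) (Ex A' B')).
Proof. intros _ (H1 & H2) (_ & H3); split; auto using veq_Ex. Qed.
Lemma valid_tyeq_All k G A A' B B' : is_prop k ->
  valid (TyEq (dom k) G A A') -> valid (TyEq k (A :: G) B B') ->
  valid (TyEq k G (All A B) (All A' B')).
Proof. intros _ (H1 & H2) (_ & H3); split; auto using veq_All. Qed.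
Lemma valid_tyeq_Eqp k G A A' a a' b b' : is_prop k ->
  valid (TyEq (dom k) G A A') -> valid (TmEq G a a' A) -> valid (TmEq G b b' A) ->
  valid (TyEq k G (Eqp A a b) (Eqp A' a' b')).
Proof. intros _ (H1 & H2) Ha Hb; split; auto using veq_Eqp. Qed.

(** * Inductive sets *)

Lemma use_tm G a b A g g' : vtm G a b A -> cenv G g g' ->
  irel (den A g) (val a g) (val b g').
Proof. intros (_ & _ & H); apply H. Qed.

Lemma use_vty G A g g' : vty G A -> cenv G g g' -> den A g = den A g'.
Proof. intros H Hg; apply H, Hg. Qed.

Lemma use_per G A g : vty G A -> cenv G g g -> per (den A g).
Proof. intros H Hg; apply (H g g Hg). Qed.

Lemma den_at1_1 C a x g : den (at1 1 C a) (bind x g) = den C (scons (val a (bind x g)) g).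
Proof. apply den_at1. Qed.

Lemma rzs_scons x g : rzs (scons x g) = scons (snd (fst x)) (rzs g).
Proof. fext; intros [|n]; reflexivity. Qed.

Lemma rzs_bind x g : rzs (bind x g) = scons (snd x) (rzs g).
Proof. apply rzs_scons. Qed.

Lemma sub1_veq G A M a b : vty (A :: G) M -> vtm G a b A -> veq G (at1 0 M a) (at1 0 M b).
Proof.
intros HM Ha g g' Hg; rewrite !den_at1_0; apply HM, cenv_cons; auto.
eapply use_tm; eauto.
Qed.

Lemma sub1_vtm G A M a b c d : vtm (A :: G) c d M -> vtm G a b A ->
  vtm G (at1 0 c a) (at1 0 d b) (at1 0 M a).
Proof.
intros (_ & HM & Hc) Ha; split; [apply Ha|split].
- eapply sub1_veq; [eassumption | eapply vtm_l; eassumption].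
- intros g g' Hg; rewrite den_at1_0, !val_at1_0; apply Hc, cenv_cons; auto.
  eapply use_tm; eauto.
Qed.

(** The steps of eliminators, and bodies of functions, are interpreted at bare
    realizers; a given element of a set may be traded for its realizer. *)
Lemma env_pt G A g g' x y : vctx G -> vty G A -> irr G A ->
  cenv G g g' -> irel (den A g) x y ->
  cenv (A :: G) (bind (pt (snd (fst x))) g) (scons y g').
Proof.
intros HG HA HI Hg (H & H1 & H2); apply cenv_cons; auto; split; [|split; auto].
destruct x as [[d v] R], y as [[e w] S]; cbn in *.
apply (HI g d e d0 e v w); auto; eapply cenv_l; eauto.
Qed.

Lemma env_pt_l G A g x y : vctx G -> vty G A -> irr G A ->
  cenv G g g -> irel (den A g) x y ->
  cenv (A :: G) (bind (pt (snd (fst x))) g) (scons x g).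
Proof.
intros HG HA HI Hg H; apply env_pt; auto.
assert (HP := use_per _ _ _ HA Hg).
eapply irel_trans; [exact HP | exact H|]; now apply irel_sym.
Qed.

Lemma valid_ElN0 G a M :
  valid (Ty KCol (N0 :: G) M) -> valid (Tm G a N0) ->
  valid (Tm G (ElN0 a) (at1 0 M a)).
Proof.
intros (_ & HM & _) Ha; split; [apply Ha|split].
- eapply sub1_veq; eassumption.
- intros g g' Hg; destruct (use_tm _ _ _ _ _ _ Ha Hg) as [[] _].
Qed.

Lemma valid_Star G : valid (Cont G) -> valid (Tm G Star N1).
Proof.
intros HG; split; [auto|split; [apply veq_N1|]].
intros g g' Hg; repeat split.
Qed.

Lemma valid_ElN1 G t c M :
  valid (Ty KCol (N1 :: G) M) -> valid (Tm G t N1) ->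
  valid (Tm G c (at1 0 M Star)) -> valid (Tm G (ElN1 t c) (at1 0 M t)).
Proof.
intros (_ & HM & _) Ht Hc; split; [apply Ht|split].
- eapply sub1_veq; eassumption.
- intros g g' Hg; destruct (use_tm _ _ _ _ _ _ Hc Hg) as [H _].
  assert (HG : vctx G) by apply Ht.
  rewrite den_at1_0 in *.
  assert (E : cenv (N1 :: G) (scons (val t g) g) (scons (val Star g) g)).
  { apply cenv_cons; [eapply cenv_l; eauto|].
    destruct (use_tm _ _ _ _ _ _ Ht Hg) as (_ & H1 & _); split; [exact I|split; auto]. }
  destruct (HM _ _ E) as [HP ->]; split; [|split; reflexivity].
  destruct (HM _ _ (cenv_r (N1 :: G) _ _ (conj HG (veq_N1 G)) E)) as [HP' _].
  apply (per_exp _ _ _ (rz c g) _ _ (rz c g') HP'); [| |exact H];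
    apply red_step; constructor.
Qed.

Lemma valid_ElN1_Star G c M :
  valid (Ty KCol (N1 :: G) M) -> valid (Tm G c (at1 0 M Star)) ->
  valid (TmEq G (ElN1 Star c) c (at1 0 M Star)).
Proof.
intros HM Hc; assert (HG : vctx G) by apply Hc.
assert (HS := valid_Star G HG).
assert (HE := valid_ElN1 _ _ _ _ HM HS Hc); split; [auto|split; [apply Hc|]].
intros g g' Hg; destruct (use_tm _ _ _ _ _ _ Hc Hg) as (H & H1 & H2).
split; [|split; auto].
apply (per_exp_l _ _ _ (rz c g));
  [eapply use_per; [apply Hc|eapply cenv_l; eauto]|apply red_step; constructor|exact H].
Qed.

(** The step of [lrec] in the clause of [content] for [ElLst]. *)
Definition Yl (a l : expr) (g : env) (s c : expr) (d : info) : info :=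
  content l (bind (d, ElLst s (rz a g) (rz3 l g)) (bind (pt c) (bind (pt s) g))).

Lemma red_rz3 r s c a l g :
  red (ElLst (Cns s c) (rz a g) (rz3 l g))
      (rz l (bind (r, ElLst s (rz a g) (rz3 l g)) (bind (pt c) (bind (pt s) g)))).
Proof.
unfold rz at 2; rewrite !rzs_bind; cbn [snd pt]; rewrite <- at3_up.
apply red_step, step_Cns.
Qed.

Section Lists.
Variables (G : ctx) (A a l M : expr).
Hypothesis (HA : valid (Ty KSet G A)) (HM : valid (Ty KCol (Lst A :: G) M))
  (Ha : valid (Tm G a (at1 0 M Eps)))
  (Hl : valid (Tm (wk 1 M :: wk 1 A :: Lst A :: G) l
                (at1 3 M (Cns (Var 2) (Var 1))))).

Lemma step_list g g' xs xs' xc xc' xr xr' :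
  cenv G g g' -> irel (den (Lst A) g) xs xs' -> irel (den A g) xc xc' ->
  irel (den M (scons xs g)) xr xr' ->
  irel (den M (bind (pt (Cns (snd (fst xs)) (snd (fst xc)))) g))
    (val l (scons xr (scons xc (scons xs g))))
    (val l (scons xr' (scons xc' (scons xs' g')))).
Proof.
intros Hg Hs Hc Hr.
assert (E : cenv (wk 1 M :: wk 1 A :: Lst A :: G)
              (scons xr (scons xc (scons xs g)))
              (scons xr' (scons xc' (scons xs' g')))).
{ apply cenv_cons; [apply cenv_cons; [apply cenv_cons; auto|]|];
    rewrite den_wk; assumption. }
apply (use_tm _ _ _ _ _ _ Hl) in E; rewrite den_at1 in E; exact E.
Qed.

Lemma list_core g g' v v' : cenv G g g' -> lrel (den A g) v v' ->
  exists d d',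
    lrec (content a g) (Yl a l g) v d /\ lrec (content a g') (Yl a l g') v' d' /\
    den M (bind (pt v) g) (d, ElLst v (rz a g) (rz3 l g))
      (d', ElLst v' (rz a g') (rz3 l g')).
Proof.
intros Hg Hv.
destruct HA as (HG & HA1 & _); destruct HM as (_ & HM1 & _).
assert (Hgg := cenv_l _ _ _ HG Hg).
apply (rec_list (den A g) (fun x => den M (bind x g)) _ _ _ _ _ _
  (fun r c s => ev l (bind r (bind (pt c) (bind (pt s) g))))
  (fun r c s => ev l (bind r (bind (pt c) (bind (pt s) g'))))); auto.
- intros s c r; apply red_rz3.
- intros s c r; apply red_rz3.
- now apply (use_per G).
- intros x y Hx; apply HM1, cenv_bind; auto.
- destruct (use_tm _ _ _ _ _ _ Ha Hg) as [H _]; rewrite den_at1_0 in H; exact H.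
- intros s s' c c' r r' Hs Hc Hr; apply (step_list g g' (pt s, none) (pt s', none)
    (pt c, none) (pt c', none) (r, none) (r', none)); auto using irel_pure.
Qed.

Lemma valid_ElLst s : valid (Tm G s (Lst A)) -> valid (Tm G (ElLst s a l) (at1 0 M s)).
Proof.
intros Hs; assert (HG : vctx G) by apply Hs; split; [auto|split].
- eapply sub1_veq; [apply HM | exact Hs].
- intros g g' Hg; destruct (use_tm _ _ _ _ _ _ Hs Hg) as (H & H1 & H2).
  destruct (list_core g g' _ _ Hg H) as (d & d' & Hd & Hd' & HE).
  apply dLst_lrec in Hd, Hd'; split; [|split; reflexivity].
  change (den (at1 0 M s) g
    (dLst (content a g) (Yl a l g) (rz s g), ElLst (rz s g) (rz a g) (rz3 l g))
    (dLst (content a g') (Yl a l g') (rz s g'), ElLst (rz s g') (rz a g') (rz3 l g'))).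
  cbn [fst snd val ev] in Hd, Hd', HE; rewrite Hd, Hd', den_at1_0.
  rewrite <- (use_vty (Lst A :: G) M (bind (pt (rz s g)) g)); [exact HE|apply HM|].
  apply (env_pt_l G (Lst A) g (val s g) (val s g)); auto.
  + apply Hs.
  + intros h ? ? ? ? ? ? _ Hx; exact Hx.
  + eapply cenv_l; eauto.
  + eapply use_tm; eauto; eapply cenv_l; eauto.
Qed.

Lemma valid_ElLst_Eps : valid (TmEq G (ElLst Eps a l) a (at1 0 M Eps)).
Proof.
split; [apply Ha|split; [apply Ha|]].
intros g g' Hg; destruct (use_tm _ _ _ _ _ _ Ha Hg) as (H & H1 & H2).
split; [|split; auto].
change (den (at1 0 M Eps) g
    (dLst (content a g) (Yl a l g) Eps, ElLst Eps (rz a g) (rz3 l g)) (ev a g')).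
rewrite (dLst_lrec _ _ _ (content a g)) by now apply lrec_Eps.
apply (per_exp_l _ _ _ (rz a g));
  [eapply use_per; [apply Ha|eapply cenv_l; [apply Ha|eauto]]|
   apply red_step; constructor|exact H].
Qed.

Lemma valid_ElLst_Cns s c :
  valid (Tm G s (Lst A)) -> valid (Tm G c A) ->
  valid (TmEq G (ElLst (Cns s c) a l) (at3 0 l s c (ElLst s a l))
           (at1 0 M (Cns s c))).
Proof.
intros Hs Hc; assert (HG : vctx G) by apply Hs.
assert (Hi : irr G A) by apply HA.
assert (HA1 : vty G A) by apply HA.
assert (HL := valid_Lst _ _ HA).
split; [auto|split].
- apply (sub1_veq G (Lst A)); [apply HM|].
  split; [auto|split; [apply HL|]].
  intros g g' Hg; split; [|split; reflexivity].
  apply (lrel_Cns _ _ _ (rz s g) (rz s g') (rz c g) (rz c g')); auto.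
  + apply (use_tm _ _ _ _ _ _ Hs Hg).
  + apply (irr_pt _ _ _ (content c g) _ (content c g') _ Hi); [eapply cenv_l; eauto|].
    apply (use_tm _ _ _ _ _ _ Hc Hg).
- intros g g' Hg.
  assert (Hgg := cenv_l _ _ _ HG Hg).
  destruct (use_tm _ _ _ _ _ _ Hs Hg) as (H & H1 & H2).
  destruct (list_core g g' _ _ Hg H) as (d & d' & Hd & Hd' & HE).
  cbn [fst snd val ev] in Hd, Hd', HE.
  rewrite val_at3_0, den_at1_0.
  destruct (use_tm _ _ _ _ _ _ Hc Hg) as (K & K1 & K2).
  destruct (step_list g g' (pt (rz s g), none) (val s g') (pt (rz c g), none) (val c g')
    (d, ElLst (rz s g) (rz a g) (rz3 l g), none) (val (ElLst s a l) g'))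
    as (X & X1 & X2); auto.
  + split; [exact H | auto].
  + split; [|auto]. cbn [fst]. eapply Hi; [exact Hgg|exact K].
  + split; [|split; reflexivity].
    apply dLst_lrec in Hd'; rewrite <- Hd' in HE; exact HE.
  + split; [|split; [reflexivity|exact X2]].
    change (den M (bind (pt (Cns (rz s g) (rz c g))) g)
      (dLst (content a g) (Yl a l g) (Cns (rz s g) (rz c g)),
       ElLst (Cns (rz s g) (rz c g)) (rz a g) (rz3 l g))
      (ev l (scons (val (ElLst s a l) g') (scons (val c g') (scons (val s g') g'))))).
    rewrite (dLst_lrec _ _ _ (Yl a l g (rz s g) (rz c g) d))
      by (eapply lrec_Cns; eauto).
    eapply per_exp_l; [|apply (red_rz3 d)|exact X].
    apply (use_per (Lst A :: G)); [apply HM|]; apply cenv_bind; auto.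
    apply (lrel_Cns _ _ _ (rz s g) (rz s g) (rz c g) (rz c g)); auto.
    * apply (use_tm _ _ _ _ _ _ Hs Hgg).
    * apply (irr_pt _ _ _ (content c g) _ (content c g) _ Hi); auto.
      apply (use_tm _ _ _ _ _ _ Hc Hgg).
Qed.

End Lists.

Lemma valid_Eps G A : valid (Ty KSet G A) -> valid (Tm G Eps (Lst A)).
Proof.
intros HA; split; [apply HA|split; [apply veq_Lst, HA|]].
intros g g' Hg; split; [|split; reflexivity]; now apply lrel_Eps; apply red_refl.
Qed.

Lemma valid_Cns G A s c :
  valid (Ty KSet G A) -> valid (Tm G s (Lst A)) -> valid (Tm G c A) ->
  valid (Tm G (Cns s c) (Lst A)).
Proof.
intros HA Hs Hc; assert (HG : vctx G) by apply Hs.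
split; [auto|split; [apply Hs|]].
intros g g' Hg; split; [|split; reflexivity].
apply (lrel_Cns _ _ _ (rz s g) (rz s g') (rz c g) (rz c g')); try apply red_refl.
- apply (use_tm _ _ _ _ _ _ Hs Hg).
- apply (irr_pt G _ _ (content c g) _ (content c g')); [apply HA|eapply cenv_l; eauto|].
  apply (use_tm _ _ _ _ _ _ Hc Hg).
Qed.

Lemma valid_Inl G A B a : valid (Ty KSet G A) -> valid (Ty KSet G B) ->
  valid (Tm G a A) -> valid (Tm G (Inl a) (Sum A B)).
Proof.
intros HA HB Ha; assert (HG : vctx G) by apply HA.
split; [auto|split; [apply veq_Sum; [apply HA | apply HB]|]].
intros g g' Hg; split; [|split; reflexivity].
left; exists (rz a g), (rz a g'); split; [apply red_refl|split; [apply red_refl|]].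
apply (irr_pt G _ _ (content a g) _ (content a g')); [apply HA|eapply cenv_l; eauto|].
apply (use_tm _ _ _ _ _ _ Ha Hg).
Qed.

Lemma valid_Inr G A B b : valid (Ty KSet G A) -> valid (Ty KSet G B) ->
  valid (Tm G b B) -> valid (Tm G (Inr b) (Sum A B)).
Proof.
intros HA HB Hb; assert (HG : vctx G) by apply HA.
split; [auto|split; [apply veq_Sum; [apply HA | apply HB]|]].
intros g g' Hg; split; [|split; reflexivity].
right; exists (rz b g), (rz b g'); split; [apply red_refl|split; [apply red_refl|]].
apply (irr_pt G _ _ (content b g) _ (content b g')); [apply HB|eapply cenv_l; eauto|].
apply (use_tm _ _ _ _ _ _ Hb Hg).
Qed.

Lemma rz_bind e x g : rz e (bind x g) = at1 0 (subst (up (rzs g)) e) (snd x).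
Proof. unfold rz; now rewrite rzs_bind, at1_up. Qed.

Section Sums.
Variables (G : ctx) (A B a b M : expr).
Hypothesis (HA : valid (Ty KSet G A)) (HB : valid (Ty KSet G B))
  (HM : valid (Ty KCol (Sum A B :: G) M))
  (Ha : valid (Tm (A :: G) a (at1 1 M (Inl (Var 0)))))
  (Hb : valid (Tm (B :: G) b (at1 1 M (Inr (Var 0))))).

Lemma sum_M g w w' : cenv G g g -> den (Sum A B) g (pt w) (pt w') ->
  per (den M (bind (pt w) g)) /\ den M (bind (pt w) g) = den M (bind (pt w') g).
Proof.
intros Hg H; destruct HM as (_ & HM1 & _); apply HM1; apply cenv_bind; auto.
Qed.

Lemma sum_per g : cenv G g g -> per (den (Sum A B) g).
Proof. intros Hg; apply (use_per G); [apply (valid_Sum _ _ _ HA HB) | exact Hg]. Qed.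

(** An elimination at a left injection is related to the left branch at any
    element equal to the injected one. It serves twice: for the computation
    rule, and to compare two eliminations through a common branch. *)
Lemma sum_inl g g' x x' w : cenv G g g' -> irel (den A g) x x' ->
  red w (Inl (snd (fst x))) ->
  irel (den M (bind (pt w) g))
   ((dSum (fun c => content a (bind (pt c) g)) (fun c => content b (bind (pt c) g)) w,
     ElSum w (subst (up (rzs g)) a) (subst (up (rzs g)) b)), none)
   (val a (scons x' g')).
Proof.
intros Hg Hx Hw; destruct HA as (HG & HA1 & HA2 & _).
assert (Hgg := cenv_l _ _ _ HG Hg).
assert (E := env_pt G A g g' x x' HG HA1 HA2 Hg Hx).
destruct (use_tm _ _ _ _ _ _ Ha E) as (H & H1 & H2).
set (v := snd (fst x)) in *.
rewrite den_at1_1 in H.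
change (den M (bind (pt (Inl v)) g)
  (ev a (bind (pt v) g)) (fst (val a (scons x' g')))) in H.
split; [|split; [reflexivity|exact H2]]; cbn [fst].
assert (Hv : den A g (pt v) (pt v)).
{ exact (proj1 (proj2 (cenv_l (A :: G) _ _ (conj HG HA1) E))). }
assert (HS : den (Sum A B) g (pt w) (pt (Inl v))).
{ left; exists v, v; split; [exact Hw|split; [apply red_refl|exact Hv]]. }
destruct (sum_M g _ _ Hgg HS) as [HP ->].
destruct (sum_M g (Inl v) (Inl v) Hgg) as [HP' _].
{ eapply per_r; [now apply sum_per|exact HS]. }
rewrite (dSum_Inl _ _ _ v Hw); eapply per_exp_l; [exact HP'| |exact H].
rewrite rz_bind; eapply red_trans; [apply red_ElSum, Hw|apply red_step; constructor].
Qed.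

Lemma sum_inr g g' x x' w : cenv G g g' -> irel (den B g) x x' ->
  red w (Inr (snd (fst x))) ->
  irel (den M (bind (pt w) g))
   ((dSum (fun c => content a (bind (pt c) g)) (fun c => content b (bind (pt c) g)) w,
     ElSum w (subst (up (rzs g)) a) (subst (up (rzs g)) b)), none)
   (val b (scons x' g')).
Proof.
intros Hg Hx Hw; destruct HB as (HG & HB1 & HB2 & _).
assert (Hgg := cenv_l _ _ _ HG Hg).
assert (E := env_pt G B g g' x x' HG HB1 HB2 Hg Hx).
destruct (use_tm _ _ _ _ _ _ Hb E) as (H & H1 & H2).
set (v := snd (fst x)) in *.
rewrite den_at1_1 in H.
change (den M (bind (pt (Inr v)) g)
  (ev b (bind (pt v) g)) (fst (val b (scons x' g')))) in H.
split; [|split; [reflexivity|exact H2]]; cbn [fst].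
assert (Hv : den B g (pt v) (pt v)).
{ exact (proj1 (proj2 (cenv_l (B :: G) _ _ (conj HG HB1) E))). }
assert (HS : den (Sum A B) g (pt w) (pt (Inr v))).
{ right; exists v, v; split; [exact Hw|split; [apply red_refl|exact Hv]]. }
destruct (sum_M g _ _ Hgg HS) as [HP ->].
destruct (sum_M g (Inr v) (Inr v) Hgg) as [HP' _].
{ eapply per_r; [now apply sum_per|exact HS]. }
rewrite (dSum_Inr _ _ _ v Hw); eapply per_exp_l; [exact HP'| |exact H].
rewrite rz_bind; eapply red_trans; [apply red_ElSum, Hw|apply red_step; constructor].
Qed.

Lemma valid_ElSum w : valid (Tm G w (Sum A B)) -> valid (Tm G (ElSum w a b) (at1 0 M w)).
Proof.
intros Hw; assert (HG : vctx G) by apply Hw; split; [auto|split].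
- eapply sub1_veq; [apply HM | exact Hw].
- intros g g' Hg; destruct (use_tm _ _ _ _ _ _ Hw Hg) as (H & H1 & H2).
  assert (Hgg := cenv_l _ _ _ HG Hg).
  assert (Hgg' := cenv_r _ _ _ HG Hg).
  rewrite den_at1_0.
  rewrite <- (use_vty (Sum A B :: G) M (bind (pt (rz w g)) g)); [|apply HM|].
  2:{ apply (env_pt_l G (Sum A B) g (val w g) (val w g)); auto.
      - apply Hw.
      - intros h ? ? ? ? ? ? _ Hx; exact Hx.
      - eapply use_tm; eauto. }
  destruct (sum_M g (rz w g) (rz w g') Hgg H) as [HP EM].
  (* Both eliminations are compared with the branch in the second
     environment. *)
  assert (EA : den A g = den A g') by (apply (use_vty G); [apply HA|auto]).
  assert (EB : den B g = den B g') by (apply (use_vty G); [apply HB|auto]).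
  assert (EM' : den M (bind (pt (rz w g)) g) = den M (bind (pt (rz w g')) g')).
  { apply (use_vty (Sum A B :: G)); [apply HM|]; apply cenv_bind; auto. }
  destruct H as [(c & c' & Hc & Hc' & H)|(c & c' & Hc & Hc' & H)].
  + assert (X := sum_inl g g' (pt c, none) (pt c', none) (rz w g) Hg (irel_pure _ _ _ H) Hc).
    rewrite EA in H; assert (H' := per_r _ _ _ (use_per _ _ _ (proj1 (proj2 HA)) Hgg') H).
    assert (Y := sum_inl g' g' (pt c', none) (pt c', none) (rz w g') Hgg' (irel_pure _ _ _ H') Hc').
    rewrite <- EM' in Y.
    exact (irel_trans _ _ _ _ HP X (irel_sym _ _ _ HP Y)).
  + assert (X := sum_inr g g' (pt c, none) (pt c', none) (rz w g) Hg (irel_pure _ _ _ H) Hc).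
    rewrite EB in H; assert (H' := per_r _ _ _ (use_per _ _ _ (proj1 (proj2 HB)) Hgg') H).
    assert (Y := sum_inr g' g' (pt c', none) (pt c', none) (rz w g') Hgg' (irel_pure _ _ _ H') Hc').
    rewrite <- EM' in Y.
    exact (irel_trans _ _ _ _ HP X (irel_sym _ _ _ HP Y)).
Qed.

Lemma valid_ElSum_Inl c : valid (Tm G c A) ->
  valid (TmEq G (ElSum (Inl c) a b) (at1 0 a c) (at1 0 M (Inl c))).
Proof.
intros Hc; split; [apply Hc|split].
- eapply sub1_veq; [apply HM | apply valid_Inl; auto].
- intros g g' Hg; rewrite den_at1_0, val_at1_0.
  apply (sum_inl g g' (val c g) (val c g') (Inl (rz c g))); auto.
  eapply use_tm; eauto.
Qed.

Lemma valid_ElSum_Inr c : valid (Tm G c B) ->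
  valid (TmEq G (ElSum (Inr c) a b) (at1 0 b c) (at1 0 M (Inr c))).
Proof.
intros Hc; split; [apply Hc|split].
- eapply sub1_veq; [apply HM | apply valid_Inr; auto].
- intros g g' Hg; rewrite den_at1_0, val_at1_0.
  apply (sum_inr g g' (val c g) (val c g') (Inr (rz c g))); auto.
  eapply use_tm; eauto.
Qed.

End Sums.

(** * Dependent sums and products *)

Lemma valid_Pair G B C b c :
  valid (Ty KCol G B) -> valid (Ty KCol (B :: G) C) ->
  valid (Tm G b B) -> valid (Tm G c (at1 0 C b)) ->
  valid (Tm G (Pair b c) (Sig B C)).
Proof.
intros (HG & HB & _) (_ & HC & _) Hb Hc; split; [auto|split; [now apply veq_Sig|]].
intros g g' Hg; split; [|split; reflexivity].
destruct (use_tm _ _ _ _ _ _ Hb Hg) as (H & H1 & H2).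
destruct (use_tm _ _ _ _ _ _ Hc Hg) as (K & _); rewrite den_at1_0 in K.
exists (rz b g), (rz c g), (rz b g'), (rz c g').
split; [apply red_refl|split; [apply red_refl|split; [exact H|]]].
change (den C (bind (ev b g) g) (ev c g) (ev c g')).
assert (E : (ev b g, none) = val b g) by (cbn in H1; now rewrite <- H1).
unfold bind; rewrite E; exact K.
Qed.

Section Sigs.
Variables (G : ctx) (B C m M : expr).
Hypothesis (HB : valid (Ty KCol G B)) (HC : valid (Ty KCol (B :: G) C))
  (HM : valid (Ty KCol (Sig B C :: G) M))
  (Hm : valid (Tm (C :: B :: G) m (at1 2 M (Pair (Var 1) (Var 0))))).

(** As for disjoint sums, this comparison of an elimination with its step
    yields both the computation rule and the congruence of [ElSig]. The
    information of a pair need not be a [dpair]; it is only read by its two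
    projections, so it can be replaced by one. *)
Lemma sig_core g g' d v b c xb xc : cenv G g g' ->
  red v (Pair b c) ->
  irel (den B g) ((dfst d, b), none) xb ->
  irel (den C (bind (dfst d, b) g)) ((dsnd d, c), none) xc ->
  irel (den M (bind (d, v) g))
    ((dSig (fun x y => content m (bind y (bind x g))) (d, v),
      ElSig v (subst (up (up (rzs g))) m)), none)
    (val m (scons xc (scons xb g'))).
Proof.
intros Hg Hv Hb Hc; destruct HB as (HG & HB1 & _), HC as (_ & HC1 & _).
assert (Hgg := cenv_l _ _ _ HG Hg).
assert (E1 : cenv (B :: G) (bind (dfst d, b) g) (scons xb g')) by now apply cenv_cons.
assert (E : cenv (C :: B :: G) (bind (dsnd d, c) (bind (dfst d, b) g))
           (scons xc (scons xb g'))) by now apply cenv_cons.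
destruct (use_tm _ _ _ _ _ _ Hm E) as (H & H1 & H2).
split; [|split; [reflexivity|exact H2]].
rewrite den_at1 in H.
change (den M (bind (dpair (dfst d) (dsnd d), Pair b c) g)
  (ev m (bind (dsnd d, c) (bind (dfst d, b) g)))
  (fst (val m (scons xc (scons xb g'))))) in H.
assert (E1' := cenv_l (B :: G) _ _ (conj HG HB1) E1).
assert (HS : den (Sig B C) g (d, v) (dpair (dfst d) (dsnd d), Pair b c)).
{ exists b, c, b, c; split; [exact Hv|split; [apply red_refl|split]].
  - exact (proj1 (proj2 E1')).
  - eapply (per_l _ _ _ (use_per _ _ _ HC1 E1')), Hc. }
assert (HS1 : vty G (Sig B C)) by now apply veq_Sig.
assert (HP : per (den (Sig B C) g)) by (apply (use_per G); auto).
assert (EM : cenv (Sig B C :: G) (bind (d, v) g)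
   (bind (dpair (dfst d) (dsnd d), Pair b c) g)) by now apply cenv_bind.
destruct HM as (_ & HM1 & _).
assert (PM := use_per _ _ _ HM1 (cenv_l (Sig B C :: G) _ _ (conj HG HS1) EM)).
rewrite <- (use_vty _ _ _ _ HM1 EM) in H.
cbn [fst]; rewrite (dSig_Pair _ (d, v) b c Hv); eapply per_exp_l; [exact PM| |exact H].
eapply red_trans; [apply red_ElSig, Hv|].
unfold rz; rewrite !rzs_bind; cbn [snd]; rewrite <- at2_up.
apply red_step; constructor.
Qed.

Lemma valid_ElSig d : valid (Tm G d (Sig B C)) -> valid (Tm G (ElSig d m) (at1 0 M d)).
Proof.
intros Hd; assert (HG : vctx G) by apply Hd; split; [auto|split].
- eapply sub1_veq; [apply HM | exact Hd].
- intros g g' Hg; assert (H := use_tm _ _ _ _ _ _ Hd Hg).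
  assert (Hgg' := cenv_r _ _ _ HG Hg); assert (Hgg := cenv_l _ _ _ HG Hg).
  assert (E : (ev d g, none) = val d g)
    by (destruct H as (_ & H & _); cbn in H; now rewrite <- H).
  (* Both eliminations are compared with the step at the components of d in
     the second environment. *)
  assert (EM : den M (bind (ev d g) g) = den M (bind (ev d g') g')).
  { apply (use_vty (Sig B C :: G)); [apply HM|]; apply cenv_bind; auto; apply H. }
  assert (PM : per (den M (bind (ev d g) g))).
  { apply (use_per (Sig B C :: G)); [apply HM|]; apply cenv_bind; auto.
    apply (use_tm _ _ _ _ _ _ Hd Hgg). }
  rewrite den_at1_0, <- E.
  change (irel (den M (bind (ev d g) g)) (val (ElSig d m) g) (val (ElSig d m) g')).
  destruct H as [(b & c & b' & c' & Hv & Hv' & Hb & Hc) _].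
  assert (X := sig_core g g' _ _ b c _ _ Hg Hv (irel_pure _ _ _ Hb) (irel_pure _ _ _ Hc)).
  assert (K := use_tm _ _ _ _ _ _ Hd Hgg').
  destruct K as [(b2 & c2 & b3 & c3 & Hv2 & Hv3 & Hb2 & Hc2) _].
  assert (E3 := red_canon_eq _ _ _ (canon_Pair _ _) (canon_Pair _ _) Hv' Hv3).
  injection E3 as <- <-.
  assert (Y := sig_core g' g' _ _ _ _ _ _ Hgg' Hv2 (irel_pure _ _ _ Hb2) (irel_pure _ _ _ Hc2)).
  change (irel (den M (bind (ev d g') g')) (val (ElSig d m) g')
    (val m (bind (dsnd (content d g'), c') (bind (dfst (content d g'), b') g')))) in Y.
  rewrite <- EM in Y.
  exact (irel_trans _ _ _ _ PM X (irel_sym _ _ _ PM Y)).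
Qed.

Lemma valid_ElSig_Pair b c : valid (Tm G b B) -> valid (Tm G c (at1 0 C b)) ->
  valid (TmEq G (ElSig (Pair b c) m) (at2 0 m b c) (at1 0 M (Pair b c))).
Proof.
intros Hb Hc; assert (HG : vctx G) by apply Hb; split; [auto|split].
- eapply sub1_veq; [apply HM | now apply valid_Pair].
- intros g g' Hg; rewrite den_at1_0, val_at2_0.
  assert (Hb1 := use_tm _ _ _ _ _ _ Hb Hg).
  assert (Hc1 := use_tm _ _ _ _ _ _ Hc Hg).
  assert (E : val b g = (ev b g, none))
    by (destruct Hb1 as (_ & H & _); cbn in H; now rewrite <- H).
  assert (E' : val c g = (ev c g, none))
    by (destruct Hc1 as (_ & H & _); cbn in H; now rewrite <- H).
  rewrite den_at1_0, E in Hc1; rewrite E' in Hc1; rewrite E in Hb1.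
  exact (sig_core g g' (dpair (content b g) (content c g)) (Pair (rz b g) (rz c g)) _ _ _ _ Hg
           (red_refl _) Hb1 Hc1).
Qed.
End Sigs.

Lemma vtm_Lam G B B' C c c' :
  valid (Ty KCol G (Pi B C)) -> vtm (B :: G) c c' C ->
  vtm G (Lam B c) (Lam B' c') (Pi B C).
Proof.
intros (HG & HP & _ & HB & _ & HC) Hc; split; [auto|split; [auto|]].
intros g g' Hg; split; [|split; reflexivity].
intros w w' Hw; assert (E := cenv_bind _ _ _ _ _ _ Hg Hw).
destruct (use_tm _ _ _ _ _ _ Hc E) as [H _].
assert (PC := use_per _ _ _ HC (cenv_l (B :: G) _ _ (conj HG HB) E)).
change (den C (bind (pt w) g)
  (content c (bind (pt w) g), Ap (Lam (rz B g) (subst (up (rzs g)) c)) w)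
  (content c' (bind (pt w') g'), Ap (Lam (rz B' g') (subst (up (rzs g')) c')) w')).
eapply (per_exp _ _ _ (rz c (bind (pt w) g)) _ _ (rz c' (bind (pt w') g')) PC);
  [| |exact H]; rewrite rz_bind; apply red_step; constructor.
Qed.

Lemma valid_Lam G B C c :
  valid (Ty KCol G (Pi B C)) -> valid (Tm (B :: G) c C) ->
  valid (Tm G (Lam B c) (Pi B C)).
Proof. apply vtm_Lam. Qed.

Lemma valid_xi G B B' C c c' :
  valid (Ty KCol G (Pi B C)) -> valid (TyEq KSet G B B') ->
  valid (TmEq (B :: G) c c' C) -> valid (TmEq G (Lam B c) (Lam B' c') (Pi B C)).
Proof. intros H _; now apply vtm_Lam. Qed.

Lemma valid_Ap G B C f b :
  valid (Ty KCol G (Pi B C)) -> valid (Tm G f (Pi B C)) -> valid (Tm G b B) ->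
  valid (Tm G (Ap f b) (at1 0 C b)).
Proof.
intros (HG & HP & _ & HB & HI & HC) Hf Hb; split; [auto|split].
- eapply sub1_veq; [exact HC | exact Hb].
- intros g g' Hg; assert (Hgg := cenv_l _ _ _ HG Hg).
  destruct (use_tm _ _ _ _ _ _ Hf Hg) as [H _].
  assert (K := use_tm _ _ _ _ _ _ Hb Hg).
  rewrite den_at1_0.
  rewrite <- (use_vty _ _ _ _ HC (env_pt_l _ _ _ _ _ HG HB HI Hgg (use_tm _ _ _ _ _ _ Hb Hgg))).
  split; [|split; reflexivity]; apply H.
  apply (irr_pt G _ _ (content b g) _ (content b g') _ HI); auto; apply K.
Qed.

Lemma valid_beta G B C c b :
  valid (Ty KCol G (Pi B C)) -> valid (Tm (B :: G) c C) -> valid (Tm G b B) ->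
  valid (TmEq G (Ap (Lam B c) b) (at1 0 c b) (at1 0 C b)).
Proof.
intros (HG & HP & _ & HB & HI & HC) Hc Hb; split; [auto|split].
- eapply sub1_veq; [exact HC | exact Hb].
- intros g g' Hg; assert (Hgg := cenv_l _ _ _ HG Hg).
  assert (E := env_pt _ _ _ _ _ _ HG HB HI Hg (use_tm _ _ _ _ _ _ Hb Hg)).
  destruct (use_tm _ _ _ _ _ _ Hc E) as (H & H1 & H2).
  rewrite den_at1_0, val_at1_0.
  rewrite <- (use_vty _ _ _ _ HC (env_pt_l _ _ _ _ _ HG HB HI Hgg (use_tm _ _ _ _ _ _ Hb Hgg))).
  split; [|split; [reflexivity|exact H2]].
  assert (PC := use_per _ _ _ HC (cenv_l (B :: G) _ _ (conj HG HB) E)).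
  apply (per_exp_l _ _ _ (rz c (bind (pt (rz b g)) g)) _ PC); [|exact H].
  rewrite rz_bind; apply red_step; constructor.
Qed.

Lemma valid_eta G B C f :
  valid (Ty KCol G (Pi B C)) -> valid (Tm G f (Pi B C)) ->
  valid (TmEq G (Lam B (Ap (wk 1 f) (Var 0))) f (Pi B C)).
Proof.
intros (HG & HP & _ & HB & HI & HC) Hf; split; [auto|split; [auto|]].
intros g g' Hg; destruct (use_tm _ _ _ _ _ _ Hf Hg) as (H & H1 & H2).
split; [|split; [reflexivity|exact H2]].
intros w w' Hw; assert (E := cenv_bind _ _ _ _ _ _ Hg Hw).
assert (PC := use_per _ _ _ HC (cenv_l (B :: G) _ _ (conj HG HB) E)).
specialize (H w w' Hw).
assert (Ef : val (wk 1 f) (bind (pt w) g) = val f g) by apply val_wk.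
assert (Ed : content (wk 1 f) (bind (pt w) g) = content f g) by (now injection Ef).
assert (Er : rz (wk 1 f) (bind (pt w) g) = rz f g) by (now injection Ef).
apply (per_exp_l _ _ _ (rz (Ap (wk 1 f) (Var 0)) (bind (pt w) g)) _ PC).
- rewrite rz_bind; apply red_step; constructor.
- change (den C (bind (pt w) g)
    (dapp (content (wk 1 f) (bind (pt w) g)) w, Ap (rz (wk 1 f) (bind (pt w) g)) w)
    (papp (ev f g') w')).
  rewrite Ed, Er; exact H.
Qed.

(** * Logic *)

(** As proof terms have no content, inhabitation of a proposition is truth in
    all environments, and the rules of logic reduce to classical truths. *)
Definition true_in (G : ctx) (A : expr) : Prop := forall g, cenv G g g -> tr (den A g).

Lemma true_intro G A a b : vctx G -> vty G A -> pirr G A -> true_in G A ->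
  (forall g, cenv G g g -> snd (val a g) = none) ->
  (forall g, cenv G g g -> snd (val b g) = none) -> vtm G a b A.
Proof.
intros HG HA HI H Ha Hb; split; [auto|split; [auto|]].
intros g g' Hg; apply (prop_irel G); auto.
- eapply cenv_l; eauto.
- apply H; eapply cenv_l; eauto.
- apply Ha; eapply cenv_l; eauto.
- apply Hb; eapply cenv_r; eauto.
Qed.

Lemma true_elim G A a b : pirr G A -> vtm G a b A -> true_in G A.
Proof. intros HI H g Hg; eapply irel_tr; eauto; eapply use_tm; eauto. Qed.

Lemma tm_none G a b A g : vtm G a b A -> cenv G g g -> snd (val b g) = none.
Proof. intros H Hg; apply (use_tm _ _ _ _ _ _ H Hg). Qed.

Lemma wk_pirr G A B : pirr G A -> pirr (B :: G) (wk 1 A).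
Proof. intros H g x y x' y' [Hg _]; rewrite den_wk; apply H, Hg. Qed.

Lemma wk2_pirr G A B C : pirr G A -> pirr (C :: B :: G) (wk 2 A).
Proof. intros H g x y x' y' [[Hg _] _]; rewrite den_wk; apply H, Hg. Qed.

Lemma at1_pirr G A C a : pirr (A :: G) C -> vtm G a a A -> pirr G (at1 0 C a).
Proof.
intros H Ha g x y x' y' Hg; rewrite den_at1_0; apply H, cenv_cons; auto.
eapply use_tm; eauto.
Qed.

Lemma cenv_tr G B g : cenv G g g -> tr (den B g) ->
  cenv (B :: G) (bind (pt Star) g) (bind (pt Star) g).
Proof. intros Hg H; now apply cenv_bind. Qed.

Lemma true_wk G A B : true_in (B :: G) (wk 1 A) -> forall g, cenv G g g ->
  tr (den B g) -> tr (den A g).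
Proof.
intros H g Hg HB; assert (K := H _ (cenv_tr _ _ _ Hg HB)).
rewrite den_wk in K; exact K.
Qed.

Definition pty (G : ctx) (A : expr) : Prop := vctx G /\ vty G A /\ pirr G A.

Lemma pty_of G A : valid (Ty KProp G A) -> pty G A.
Proof. intros (H1 & H2 & H3 & _); split; auto. Qed.

Lemma true_of G a A : pty G A -> valid (Tm G a A) -> true_in G A.
Proof. intros (_ & _ & H); now apply true_elim. Qed.

Lemma of_true G a A : pty G A -> true_in G A -> (forall g, den a g = none) ->
  valid (Tm G a A).
Proof. intros (H1 & H2 & H3) H H'; apply true_intro; auto; intros g _; apply H'. Qed.

Lemma of_true_eq G a b b' A B : pty G A -> (forall g, den a g = none) ->
  vtm G b b' B -> true_in G A -> vtm G a b' A.
Proof.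
intros (H1 & H2 & H3) Ha Hb H; apply true_intro; auto; intros g Hg; [apply Ha|].
eapply tm_none; eauto.
Qed.

Lemma pty_wk G A B : pty G A -> vty G B -> pty (B :: G) (wk 1 A).
Proof.
intros (H1 & H2 & H3) HB; split; [split; auto|split]; [now apply wk1_vty|now apply wk_pirr].
Qed.

Lemma pty_wk2 G A B C : pty G A -> vty G B -> vty (B :: G) C -> pty (C :: B :: G) (wk 2 A).
Proof.
intros (H1 & H2 & H3) HB HC; split; [split; [split|]; assumption|split]; [|now apply wk2_pirr].
assert (E : wk 2 A = wk 1 (wk 1 A)) by (unfold wk; now rewrite ren_ren).
rewrite E; apply wk1_vty; [split; auto|auto|now apply wk1_vty].
Qed.

Lemma pty_at1 G A C a : pty (A :: G) C -> vtm G a a A -> pty G (at1 0 C a).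
Proof.
intros (H1 & H2 & H3) Ha; split; [apply Ha|split]; [eapply sub1_veq; eauto|].
eapply at1_pirr; eauto.
Qed.

Lemma pty_crel G A : vctx G -> vty G A -> (forall g, exists P, den A g = crel P) -> pty G A.
Proof. intros H1 H2 H; split; [|split]; auto; now apply (kc_crel KProp); [left|]. Qed.

Lemma pty_Or G A B : pty G A -> pty G B -> pty G (Or A B).
Proof.
intros (H1 & H2 & _) (_ & H3 & _); apply pty_crel; auto using veq_Or; [now apply veq_Or|].
intros g; eexists; cbn [den]; reflexivity.
Qed.
Lemma pty_And G A B : pty G A -> pty G B -> pty G (And A B).
Proof.
intros (H1 & H2 & _) (_ & H3 & _); apply pty_crel; auto; [now apply veq_And|].
intros g; eexists; cbn [den]; reflexivity.
Qed.
Lemma pty_Imp G A B : pty G A -> pty G B -> pty G (Imp A B).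
Proof.
intros (H1 & H2 & _) (_ & H3 & _); apply pty_crel; auto; [now apply veq_Imp|].
intros g; eexists; cbn [den]; reflexivity.
Qed.
Lemma pty_Fls G : vctx G -> pty G Fls.
Proof.
intros H; apply pty_crel; auto; [intros g g' Hg; split; [apply per_crel|reflexivity]|].
intros g; now exists False.
Qed.
Lemma pty_Ex G A B : vty G A -> pty (A :: G) B -> pty G (Ex A B).
Proof.
intros H2 ([H1 _] & H3 & _); apply pty_crel; auto; [now apply veq_Ex|].
intros g; eexists; cbn [den]; reflexivity.
Qed.
Lemma pty_All G A B : vty G A -> pty (A :: G) B -> pty G (All A B).
Proof.
intros H2 ([H1 _] & H3 & _); apply pty_crel; auto; [now apply veq_All|].
intros g; eexists; cbn [den]; reflexivity.
Qed.
Lemma pty_Eqp G A a b : vtm G a a A -> vtm G b b A -> pty G (Eqp A a b).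
Proof.
intros Ha Hb; apply pty_crel; [apply Ha|apply veq_Eqp; auto; apply Ha|].
intros g; eexists; cbn [den]; reflexivity.
Qed.

Lemma truth_Fls G A : true_in G Fls -> true_in G A.
Proof. intros H g Hg; destruct (H g Hg). Qed.
Lemma truth_Or1 G A B : true_in G A -> true_in G (Or A B).
Proof. intros H g Hg; left; auto. Qed.
Lemma truth_Or2 G A B : true_in G B -> true_in G (Or A B).
Proof. intros H g Hg; right; auto. Qed.
Lemma truth_OrE G B C A : true_in G (Or B C) -> true_in (B :: G) (wk 1 A) ->
  true_in (C :: G) (wk 1 A) -> true_in G A.
Proof.
intros H H1 H2 g Hg; destruct (H g Hg) as [HB | HC];
  [eapply true_wk; [exact H1|..] | eapply true_wk; [exact H2|..]]; eauto.
Qed.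
Lemma truth_And G A B : true_in G A -> true_in G B -> true_in G (And A B).
Proof. intros H H' g Hg; split; auto. Qed.
Lemma truth_And1 G A B : true_in G (And A B) -> true_in G A.
Proof. intros H g Hg; apply (H g Hg). Qed.
Lemma truth_And2 G A B : true_in G (And A B) -> true_in G B.
Proof. intros H g Hg; apply (H g Hg). Qed.
Lemma truth_ImpI G A B : true_in (A :: G) (wk 1 B) -> true_in G (Imp A B).
Proof. intros H g Hg HA; eapply true_wk; eauto. Qed.
Lemma truth_ImpE G A B : true_in G (Imp A B) -> true_in G A -> true_in G B.
Proof. intros H H' g Hg; apply (H g Hg), H', Hg. Qed.

Lemma val_pure G a b A g g' : vtm G a b A -> cenv G g g' -> val a g = (ev a g, none).
Proof.
intros Ha Hg; destruct (use_tm _ _ _ _ _ _ Ha Hg) as (_ & H & _); cbn in H; now rewrite <- H.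
Qed.

Lemma truth_ExI G A B a : vtm G a a A -> true_in G (at1 0 B a) -> true_in G (Ex A B).
Proof.
intros Ha H g Hg; exists (ev a g); split; [apply (use_tm _ _ _ _ _ _ Ha Hg)|].
specialize (H g Hg); rewrite den_at1_0, (val_pure _ _ _ _ _ _ Ha Hg) in H; exact H.
Qed.
Lemma truth_ExE G A B C : true_in G (Ex A B) -> true_in (B :: A :: G) (wk 2 C) ->
  true_in G C.
Proof.
intros H H' g Hg; destruct (H g Hg) as (x & Hx & HB).
assert (K := H' _ (cenv_tr (A :: G) B _ (cenv_bind _ _ _ _ _ _ Hg Hx) HB)).
rewrite den_wk in K; exact K.
Qed.
Lemma truth_AllI G A B : true_in (A :: G) B -> true_in G (All A B).
Proof. intros H g Hg x Hx; apply H, cenv_bind; auto. Qed.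
Lemma truth_AllE G A B a : true_in G (All A B) -> vtm G a a A -> true_in G (at1 0 B a).
Proof.
intros H Ha g Hg; rewrite den_at1_0, (val_pure _ _ _ _ _ _ Ha Hg).
apply (H g Hg), (use_tm _ _ _ _ _ _ Ha Hg).
Qed.
Lemma truth_Eqp G A a : vtm G a a A -> true_in G (Eqp A a a).
Proof. intros Ha g Hg; apply (use_tm _ _ _ _ _ _ Ha Hg). Qed.
Lemma truth_Lem G A : true_in G (Or A (Not A)).
Proof. intros g Hg; destruct (classic (tr (den A g))); [left|right]; auto. Qed.

(** All that the model requires of a proof is to denote nothing as a type. The
    lemmas below leave the proof [p] of the conclusion arbitrary: it is [Tru] at
    the extensional level and a specific constructor at the intensional one, so
    one lemma covers the rules of both. *)
Definition proof_term (p : expr) : Prop := forall g, den p g = none.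

Lemma at1_wk A a : at1 0 (wk 1 A) a = A.
Proof. unfold at1; rewrite subst_wk1; apply subst_Var. Qed.

Lemma at2_wk A a b : at2 0 (wk 2 A) a b = A.
Proof. unfold at2, wk; rewrite subst_ren; apply subst_Var. Qed.

Lemma sub2_vtm G A B M a b c : vtm (B :: A :: G) c c M ->
  vtm G a a A -> vtm G b b (at1 0 B a) ->
  vtm G (at2 0 c a b) (at2 0 c a b) (at2 0 M a b).
Proof.
intros (_ & HM & Hc) Ha Hb.
assert (E : forall g g', cenv G g g' ->
  cenv (B :: A :: G) (scons (val b g) (scons (val a g) g))
     (scons (val b g') (scons (val a g') g'))).
{ intros g g' Hg; apply cenv_cons; [apply cenv_cons; auto; eapply use_tm; eauto|].
  assert (H := use_tm _ _ _ _ _ _ Hb Hg); rewrite den_at1_0 in H; exact H. }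
split; [apply Ha|split].
- intros g g' Hg; rewrite !den_at2_0; auto.
- intros g g' Hg; rewrite den_at2_0, !val_at2_0; auto.
Qed.

Section Prop_rules.
Variables (G : ctx) (p : expr).
Hypothesis Hp : proof_term p.

Lemma valid_ElFls a A : valid (Ty KProp G A) -> valid (Tm G a Fls) -> valid (Tm G p A).
Proof.
intros HA Ha; apply of_true; auto using pty_of.
eapply truth_Fls, true_of; [apply pty_Fls, HA|exact Ha].
Qed.

Lemma valid_OrL B C b : valid (Ty KProp G B) -> valid (Ty KProp G C) ->
  valid (Tm G b B) -> valid (Tm G p (Or B C)).
Proof.
intros HB HC Hb; apply of_true; auto using pty_of, pty_Or.
eapply truth_Or1, true_of; eauto using pty_of.
Qed.

Lemma valid_OrR B C b : valid (Ty KProp G B) -> valid (Ty KProp G C) ->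
  valid (Tm G b C) -> valid (Tm G p (Or B C)).
Proof.
intros HB HC Hb; apply of_true; auto using pty_of, pty_Or.
eapply truth_Or2, true_of; eauto using pty_of.
Qed.

Lemma valid_ElOr B C A d a b :
  valid (Ty KProp G B) -> valid (Ty KProp G C) -> valid (Ty KProp G A) ->
  valid (Tm G d (Or B C)) ->
  valid (Tm (B :: G) a (wk 1 A)) -> valid (Tm (C :: G) b (wk 1 A)) ->
  valid (Tm G p A).
Proof.
intros HB HC HA Hd Ha Hb; apply of_true; auto using pty_of.
apply (truth_OrE G B C).
- eapply true_of; eauto using pty_of, pty_Or.
- eapply true_of; eauto; apply pty_wk; [auto using pty_of|apply HB].
- eapply true_of; eauto; apply pty_wk; [auto using pty_of|apply HC].
Qed.

Lemma valid_AndI B C b c : valid (Ty KProp G B) -> valid (Ty KProp G C) ->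
  valid (Tm G b B) -> valid (Tm G c C) -> valid (Tm G p (And B C)).
Proof.
intros HB HC Hb Hc; apply of_true; auto using pty_of, pty_And.
apply truth_And; eapply true_of; eauto using pty_of.
Qed.

Lemma valid_And1 B C d : valid (Ty KProp G B) -> valid (Ty KProp G C) ->
  valid (Tm G d (And B C)) -> valid (Tm G p B).
Proof.
intros HB HC Hd; apply of_true; auto using pty_of.
eapply truth_And1, true_of; [|exact Hd]; auto using pty_of, pty_And.
Qed.

Lemma valid_And2 B C d : valid (Ty KProp G B) -> valid (Ty KProp G C) ->
  valid (Tm G d (And B C)) -> valid (Tm G p C).
Proof.
intros HB HC Hd; apply of_true; auto using pty_of.
eapply truth_And2, true_of; [|exact Hd]; auto using pty_of, pty_And.
Qed.

Lemma valid_ImpI B C c : valid (Ty KProp G B) -> valid (Ty KProp G C) ->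
  valid (Tm (B :: G) c (wk 1 C)) -> valid (Tm G p (Imp B C)).
Proof.
intros HB HC Hc; apply of_true; auto using pty_of, pty_Imp.
eapply truth_ImpI, true_of; eauto; apply pty_wk; [auto using pty_of|apply HB].
Qed.

Lemma valid_ImpE B C f b : valid (Ty KProp G B) -> valid (Ty KProp G C) ->
  valid (Tm G f (Imp B C)) -> valid (Tm G b B) -> valid (Tm G p C).
Proof.
intros HB HC Hf Hb; apply of_true; auto using pty_of.
apply (truth_ImpE G B C); [apply (true_of _ f)|apply (true_of _ b)]; auto using pty_of, pty_Imp.
Qed.

Lemma valid_ExI B C b c : valid (Ty KCol G B) -> valid (Ty KProp (B :: G) C) ->
  valid (Tm G b B) -> valid (Tm G c (at1 0 C b)) -> valid (Tm G p (Ex B C)).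
Proof.
intros HB HC Hb Hc; apply pty_of in HC; apply of_true; auto.
- apply pty_Ex; [apply HB|auto].
- eapply truth_ExI; [exact Hb|]; eapply true_of; eauto; eapply pty_at1; eauto.
Qed.

Lemma valid_ElEx B C M d m :
  valid (Ty KCol G B) -> valid (Ty KProp (B :: G) C) -> valid (Ty KProp G M) ->
  valid (Tm G d (Ex B C)) -> valid (Tm (C :: B :: G) m (wk 2 M)) ->
  valid (Tm G p M).
Proof.
intros HB HC HM Hd Hm; apply pty_of in HC, HM; apply of_true; auto.
eapply truth_ExE.
- eapply true_of; eauto; apply pty_Ex; [apply HB|auto].
- eapply true_of; eauto; apply pty_wk2; [auto|apply HB|apply HC].
Qed.

Lemma valid_AllI B C c : valid (Ty KCol G B) -> valid (Ty KProp (B :: G) C) ->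
  valid (Tm (B :: G) c C) -> valid (Tm G p (All B C)).
Proof.
intros HB HC Hc; apply pty_of in HC; apply of_true; auto.
- apply pty_All; [apply HB|auto].
- eapply truth_AllI, true_of; eauto.
Qed.

Lemma valid_AllE B C f b : valid (Ty KCol G B) -> valid (Ty KProp (B :: G) C) ->
  valid (Tm G f (All B C)) -> valid (Tm G b B) -> valid (Tm G p (at1 0 C b)).
Proof.
intros HB HC Hf Hb; apply pty_of in HC; apply of_true; auto.
- eapply pty_at1; eauto.
- eapply truth_AllE; eauto; eapply true_of; eauto; apply pty_All; [apply HB|auto].
Qed.

Lemma valid_IdI A a : valid (Ty KCol G A) -> valid (Tm G a A) -> valid (Tm G p (Eqp A a a)).
Proof. intros HA Ha; apply of_true; auto using pty_Eqp, truth_Eqp. Qed.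

Lemma valid_Lem A : valid (Ty KProp G A) -> valid (Tm G p (Or A (Not A))).
Proof.
intros HA; apply of_true; auto using truth_Lem.
assert (H := pty_of _ _ HA); apply pty_Or; auto; apply pty_Imp; auto; apply pty_Fls, HA.
Qed.

Lemma valid_proof A q : valid (Ty KProp G A) -> valid (Tm G q A) -> valid (Tm G p A).
Proof.
intros HA Hq; apply of_true; auto using pty_of; eapply true_of; eauto using pty_of.
Qed.

Lemma valid_proof_eq A q : valid (Ty KProp G A) -> valid (Tm G q A) ->
  valid (TmEq G p q A).
Proof.
intros HA Hq; eapply of_true_eq; eauto using pty_of; eapply true_of; eauto using pty_of.
Qed.

Lemma valid_ElOr_eq B A d a :
  valid (Ty KProp G A) -> valid (Tm G d B) -> valid (Tm (B :: G) a (wk 1 A)) ->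
  valid (TmEq G p (at1 0 a d) A).
Proof.
intros HA Hd Ha; apply valid_proof_eq; auto.
assert (H := sub1_vtm _ _ _ _ _ _ _ Ha Hd); rewrite at1_wk in H; exact H.
Qed.

Lemma valid_ElEx_eq B C M b c m :
  valid (Ty KProp G M) -> valid (Tm G b B) -> valid (Tm G c (at1 0 C b)) ->
  valid (Tm (C :: B :: G) m (wk 2 M)) -> valid (TmEq G p (at2 0 m b c) M).
Proof.
intros HM Hb Hc Hm; apply valid_proof_eq; auto.
assert (H := sub2_vtm _ _ _ _ _ _ _ Hm Hb Hc); rewrite at2_wk in H; exact H.
Qed.

Lemma valid_AllAp_eq B C c b : valid (Ty KProp (B :: G) C) ->
  valid (Tm (B :: G) c C) -> valid (Tm G b B) ->
  valid (TmEq G p (at1 0 c b) (at1 0 C b)).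
Proof.
intros HC Hc Hb; assert (H := sub1_vtm _ _ _ _ _ _ _ Hc Hb).
eapply of_true_eq; eauto; [eapply pty_at1; eauto using pty_of|].
eapply true_of; eauto; eapply pty_at1; eauto using pty_of.
Qed.

Lemma env_diag A g g' x y : cenv G g g' -> irel (den A g) x y ->
  cenv (wk 1 A :: A :: G) (scons x (scons x g)) (scons y (scons y g')).
Proof. intros Hg Hx; apply cenv_cons; [now apply cenv_cons|]; rewrite den_wk; exact Hx. Qed.

Section Id.
Variables (A C c : expr).
Hypothesis (HA : valid (Ty KCol G A)) (HC : valid (Ty KProp (wk 1 A :: A :: G) C))
  (Hc : valid (Tm (A :: G) c (at2 1 C (Var 0) (Var 0)))).

Lemma id_refl g x : cenv G g g -> irel (den A g) x x ->
  tr (den C (scons x (scons x g))).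
Proof.
intros Hg Hx; assert (E := env_diag _ _ _ _ _ Hg Hx).
assert (H := use_tm _ _ _ _ _ _ Hc (cenv_cons _ _ _ _ _ _ Hg Hx)).
rewrite den_at2, !val_Var in H.
eapply irel_tr; [apply HC|exact E|exact H].
Qed.

Lemma id_pty a b : valid (Tm G a A) -> valid (Tm G b A) -> pty G (at2 0 C a b).
Proof.
intros Ha Hb; assert (E : forall g g', cenv G g g' ->
  cenv (wk 1 A :: A :: G) (scons (val b g) (scons (val a g) g))
     (scons (val b g') (scons (val a g') g'))).
{ intros g g' Hg; apply cenv_cons; [apply cenv_cons; auto; eapply use_tm; eauto|].
  rewrite den_wk; apply (use_tm _ _ _ _ _ _ Hb Hg). }
split; [apply HA|split].
- intros g g' Hg; rewrite !den_at2_0; apply HC, E, Hg.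
- intros g x y x' y' Hg; rewrite den_at2_0; apply HC, E, Hg.
Qed.

Lemma valid_ElId a b d : valid (Tm G a A) -> valid (Tm G b A) ->
  valid (Tm G d (Eqp A a b)) -> valid (Tm G p (at2 0 C a b)).
Proof.
intros Ha Hb Hd; apply of_true; auto using id_pty.
apply true_of in Hd; [|now apply pty_Eqp].
intros g Hg; assert (K := Hd g Hg).
assert (Ka := use_tm _ _ _ _ _ _ Ha Hg).
assert (Kb := use_tm _ _ _ _ _ _ Hb Hg).
rewrite den_at2_0, <- (use_vty (wk 1 A :: A :: G) C (scons (val a g) (scons (val a g) g))).
- apply id_refl; auto.
- apply HC.
- apply cenv_cons; [apply cenv_cons; auto|]; rewrite den_wk.
  split; [exact K|split; [apply Ka|apply Kb]].
Qed.

Lemma valid_ElId_eq a : valid (Tm G a A) -> valid (TmEq G p (at1 0 c a) (at2 0 C a a)).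
Proof.
intros Ha; destruct (id_pty a a Ha Ha) as (H1 & H2 & H3).
apply true_intro; auto.
- intros g Hg; rewrite den_at2_0; apply id_refl; auto; apply (use_tm _ _ _ _ _ _ Ha Hg).
- intros g _; apply Hp.
- intros g Hg; rewrite val_at1_0.
  eapply tm_none; [exact Hc|]; apply cenv_cons; auto; apply (use_tm _ _ _ _ _ _ Ha Hg).
Qed.
End Id.
End Prop_rules.

Lemma valid_prop_irr G A p q :
  valid (Ty KProp G A) -> valid (Tm G p A) -> valid (Tm G q A) ->
  valid (TmEq G p q A).
Proof.
intros HA Hp Hq; apply true_intro; try apply HA.
- eapply true_of; eauto using pty_of.
- intros g; eapply tm_none; eauto.
- intros g; eapply tm_none; eauto.
Qed.

Lemma valid_reflection G A a b p : valid (Ty KCol G A) ->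
  valid (Tm G a A) -> valid (Tm G b A) -> valid (Tm G p (Eqp A a b)) ->
  valid (TmEq G a b A).
Proof.
intros (HG & HA & _) Ha Hb Hp; split; [auto|split; [auto|]].
apply true_of in Hp; [|now apply pty_Eqp].
intros g g' Hg; assert (Hgg := cenv_l _ _ _ HG Hg).
apply (irel_trans _ _ (val b g)); [now apply (use_per G)| |eapply use_tm; eauto].
split; [apply (Hp g Hgg)|].
split; [apply (use_tm _ _ _ _ _ _ Ha Hg)|apply (use_tm _ _ _ _ _ _ Hb Hg)].
Qed.

(** * Codes of small propositions and truth values *)

Lemma code_intro G a b : vctx G -> proof_term a -> proof_term b ->
  (forall g g', cenv G g g' -> (holds (content a g) <-> holds (content b g'))) ->
  vtm G a b PropS.
Proof.
intros HG Ha Hb H; split; [auto|split; [apply (veq_Omega mTT)|]].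
intros g g' Hg; split; [apply H, Hg|split; [apply Ha | apply Hb]].
Qed.

Lemma code_use G a b g g' : vtm G a b PropS -> cenv G g g' ->
  (holds (content a g) <-> holds (content b g')).
Proof. intros H Hg; apply (use_tm _ _ _ _ _ _ H Hg). Qed.

Lemma valid_Tau G p : valid (Tm G p PropS) -> valid (Ty KProps G (Tau p)).
Proof.
intros Hp; split; [apply Hp|split; [|split; [|exact I]]].
- eapply veq_crel; [intros h; cbn [den]; reflexivity..|].
  intros g g' Hg; eapply code_use; eauto.
- apply kc_crel; [now right|]; intros g; eexists; cbn [den]; reflexivity.
Qed.

Lemma valid_CFls G : valid (Cont G) -> valid (Tm G CFls PropS).
Proof. intros HG; apply code_intro; try easy; intros g g' _; tauto. Qed.

Lemma valid_COr G p q : valid (Tm G p PropS) -> valid (Tm G q PropS) ->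
  valid (Tm G (COr p q) PropS).
Proof.
intros Hp Hq; apply code_intro; try easy; [apply Hp|]; intros g g' Hg.
assert (H1 := code_use _ _ _ _ _ Hp Hg); assert (H2 := code_use _ _ _ _ _ Hq Hg).
cbn [content]; unfold holds, dprop in *; tauto.
Qed.

Lemma valid_CAnd G p q : valid (Tm G p PropS) -> valid (Tm G q PropS) ->
  valid (Tm G (CAnd p q) PropS).
Proof.
intros Hp Hq; apply code_intro; try easy; [apply Hp|]; intros g g' Hg.
assert (H1 := code_use _ _ _ _ _ Hp Hg); assert (H2 := code_use _ _ _ _ _ Hq Hg).
cbn [content]; unfold holds, dprop in *; tauto.
Qed.

Lemma valid_CImp G p q : valid (Tm G p PropS) -> valid (Tm G q PropS) ->
  valid (Tm G (CImp p q) PropS).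
Proof.
intros Hp Hq; apply code_intro; try easy; [apply Hp|]; intros g g' Hg.
assert (H1 := code_use _ _ _ _ _ Hp Hg); assert (H2 := code_use _ _ _ _ _ Hq Hg).
cbn [content]; unfold holds, dprop in *; tauto.
Qed.

Lemma valid_CEx G B p : valid (Ty KSet G B) -> valid (Tm (B :: G) p PropS) ->
  valid (Tm G (CEx B p) PropS).
Proof.
intros (HG & HB & _) Hp; apply code_intro; try easy; intros g g' Hg.
cbn [content]; unfold holds at 1 3, dprop; rewrite <- (use_vty _ _ _ _ HB Hg).
apply ex_in_iff; intros x Hx; eapply code_use; eauto; now apply cenv_bind.
Qed.

Lemma valid_CAll G B p : valid (Ty KSet G B) -> valid (Tm (B :: G) p PropS) ->
  valid (Tm G (CAll B p) PropS).
Proof.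
intros (HG & HB & _) Hp; apply code_intro; try easy; intros g g' Hg.
cbn [content]; unfold holds at 1 3, dprop; rewrite <- (use_vty _ _ _ _ HB Hg).
apply all_in_iff; intros x Hx; eapply code_use; eauto; now apply cenv_bind.
Qed.

Lemma valid_CEqp G A a b : valid (Ty KSet G A) -> valid (Tm G a A) -> valid (Tm G b A) ->
  valid (Tm G (CEqp A a b) PropS).
Proof.
intros (HG & HA & _) Ha Hb; apply code_intro; try easy; intros g g' Hg.
exact (eqp_iff G A A a a b b g g' HG HA Ha Hb Hg).
Qed.

(** The clauses of [content] for codes repeat those of [den], so each decoding
    rule equates types whose denotations are convertible. *)
Lemma valid_decode k G A B : valid (Ty k G A) -> (forall g, den A g = den B g) ->
  valid (TyEq k G A B).
Proof.
intros (HG & HA & _) E; split; auto.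
intros g g' Hg; rewrite <- E; auto.
Qed.

Lemma valid_PCls G A : valid (Ty KProps G A) -> valid (Tm G (PCls A) Pow1).
Proof.
intros (HG & HA & _); split; [auto|split; [apply (veq_Omega emTT)|]].
intros g g' Hg; split; [|split; reflexivity].
change (tr (den A g) <-> tr (den A g')); rewrite (use_vty _ _ _ _ HA Hg); tauto.
Qed.

Lemma valid_PCls_eq G A B p : valid (Ty KProps G A) -> valid (Ty KProps G B) ->
  valid (Tm G p (Iff A B)) -> valid (TmEq G (PCls A) (PCls B) Pow1).
Proof.
intros HA HB Hp; assert (HG : vctx G) by apply HA.
split; [auto|split; [apply (veq_Omega emTT)|]].
apply (valid_ty_sub KProps KProp) in HA, HB; [|constructor..].
apply true_of in Hp; [|apply pty_And; apply pty_Imp; auto using pty_of].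
intros g g' Hg; split; [|split; reflexivity].
change (tr (den A g) <-> tr (den B g')).
rewrite (use_vty G A g g'); [|apply HA|auto].
exact (Hp g' (cenv_r _ _ _ HG Hg)).
Qed.

Lemma valid_Pow1_eff G A B p : proof_term p ->
  valid (Ty KProps G A) -> valid (Ty KProps G B) ->
  valid (TmEq G (PCls A) (PCls B) Pow1) -> valid (Tm G p (Iff A B)).
Proof.
intros Hp HA HB H; apply (valid_ty_sub KProps KProp) in HA, HB; [|constructor..].
apply of_true; auto.
- apply pty_And; apply pty_Imp; auto using pty_of.
- intros g Hg; exact (proj1 (use_tm _ _ _ _ _ _ H Hg)).
Qed.

Lemma valid_Pow1_eta G U : valid (Tm G U Pow1) ->
  valid (TmEq G U (PCls (Eqp Pow1 U (PCls Top))) Pow1).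
Proof.
intros HU; split; [apply HU|split; [apply HU|]].
intros g g' Hg; destruct (use_tm _ _ _ _ _ _ HU Hg) as (H & H1 & H2).
split; [|split; [exact H1|reflexivity]].
change (holds (content U g) <-> (holds (content U g') <-> (False -> False))).
change (holds (content U g) <-> holds (content U g')) in H; tauto.
Qed.

(** * Quotients *)

Lemma veq_Quo G A A' R R' : vctx G -> veq G A A' -> veq (wk 1 A :: A :: G) R R' ->
  (forall g, cenv G g g -> equiv_on (den A g) (fun x y => den R (bind y (bind x g)))) ->
  veq G (Quo A R) (Quo A' R').
Proof.
intros HG HA HR HE g g' Hg; cbn [den]; assert (Hgg := cenv_l _ _ _ HG Hg).
destruct (HA _ _ Hg) as [HP <-]; split; [apply per_rQuo; auto|].
apply rQuo_ext; intros x y Hx Hy.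
assert (E : cenv (wk 1 A :: A :: G) (bind y (bind x g)) (bind y (bind x g'))).
{ apply cenv_bind; [now apply cenv_bind|]; rewrite den_wk; exact Hy. }
destruct (HR _ _ E) as [_ ->]; tauto.
Qed.

Lemma valid_tyeq_Quo G A A' R R' :
  valid (Ty KSet G (Quo A R)) -> valid (Ty KSet G (Quo A' R')) ->
  valid (TyEq KSet G A A') -> valid (TyEq KProps (wk 1 A :: A :: G) R R') ->
  valid (TyEq KSet G (Quo A R) (Quo A' R')).
Proof.
intros (HG & _ & _ & H) _ (_ & HA) (_ & HR); split; auto.
apply veq_Quo; auto; apply H.
Qed.

Section Quo_formation.
Variables (G : ctx) (A R p q r : expr).
Hypothesis (HA : valid (Ty KSet G A)) (HR : valid (Ty KProps (wk 1 A :: A :: G) R))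
  (Hrefl : valid (Tm (A :: G) p (at2 1 R (Var 0) (Var 0))))
  (Hsym : valid (Tm (R :: wk 1 A :: A :: G) q (at2 3 R (Var 1) (Var 2))))
  (Htrans : valid (Tm (at2 4 R (Var 2) (Var 1) :: wk 1 R :: wk 2 A :: wk 1 A :: A :: G)
         r (at2 5 R (Var 4) (Var 2)))).

Lemma quo_env g x y x' y' : cenv G g g -> den A g x x' -> den A g y y' ->
  cenv (wk 1 A :: A :: G) (bind y (bind x g)) (bind y' (bind x' g)).
Proof. intros Hg Hx Hy; apply cenv_bind; [now apply cenv_bind|]; rewrite den_wk; exact Hy. Qed.

Lemma quo_equiv g : cenv G g g ->
  equiv_on (den A g) (fun x y => den R (bind y (bind x g))).
Proof.
intros Hg; destruct HA as (HG & HA1 & _), HR as (_ & HR1 & HR2 & _).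
split.
- intros x x' y y' Hx Hy H; rewrite <- (use_vty _ _ _ _ HR1 (quo_env _ _ _ _ _ Hg Hx Hy)); auto.
- intros x Hx; assert (E := quo_env g x x x x Hg Hx Hx).
  assert (H := use_tm _ _ _ _ _ _ Hrefl (cenv_bind _ _ _ _ _ _ Hg Hx)).
  rewrite den_at2, !val_Var in H; exact (irel_tr _ _ _ _ _ HR2 E H).
- intros x y Hx Hy H; assert (E := quo_env g x y x y Hg Hx Hy).
  assert (K := use_tm _ _ _ _ _ _ Hsym (cenv_tr _ _ _ E H)).
  rewrite den_at2, !val_Var in K.
  exact (irel_tr _ _ _ _ _ HR2 (quo_env g y x y x Hg Hy Hx) K).
- intros x y z Hx Hy Hz Hxy Hyz.
  assert (E := quo_env g x y x y Hg Hx Hy).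
  assert (E1 : cenv (wk 2 A :: wk 1 A :: A :: G)
      (bind z (bind y (bind x g))) (bind z (bind y (bind x g)))).
  { apply cenv_bind; auto; rewrite den_wk; exact Hz. }
  assert (E2 : cenv (wk 1 R :: wk 2 A :: wk 1 A :: A :: G)
      (bind (pt Star) (bind z (bind y (bind x g)))) (bind (pt Star) (bind z (bind y (bind x g))))).
  { apply cenv_tr; auto; rewrite den_wk; exact Hxy. }
  assert (E3 := cenv_tr _ (at2 4 R (Var 2) (Var 1)) _ E2).
  rewrite den_at2, !val_Var in E3; specialize (E3 Hyz).
  assert (K := use_tm _ _ _ _ _ _ Htrans E3).
  rewrite den_at2, !val_Var in K.
  exact (irel_tr _ _ _ _ _ HR2 (quo_env g x z x z Hg Hx Hz) K).
Qed.

Lemma valid_Quo : valid (Ty KSet G (Quo A R)).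
Proof.
assert (HE := quo_equiv); destruct HA as (HG & HA1 & HA2 & _), HR as (_ & HR1 & HR2 & _).
split; [auto|split; [now apply veq_Quo|split]].
- intros g d d' e e' v v' _ H; exact H.
- repeat (split; [assumption|]); assumption.
Qed.
End Quo_formation.

Lemma rQuo_intro R S x y : per R -> equiv_on R S ->
  R (pt (snd x)) (pt (snd y)) -> rQuo R S x y.
Proof.
intros HR HS H; assert (Hl := per_l _ _ _ HR H); assert (Hr := per_r _ _ _ HR H).
split; [auto|split; [auto|]].
apply (equiv_cong _ _ HS (pt (snd x)) (pt (snd x)) (pt (snd x)) (pt (snd y))); auto.
now apply (equiv_refl _ _ HS).
Qed.

Section Quo_rules.
Variables (G : ctx) (A R : expr).
Hypothesis HQ : valid (Ty KSet G (Quo A R)).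

Lemma quo_per g : cenv G g g -> per (den A g).
Proof. apply use_per, HQ. Qed.

Lemma quo_eq g : cenv G g g -> equiv_on (den A g) (fun x y => den R (bind y (bind x g))).
Proof. destruct HQ as (_ & _ & _ & _ & _ & _ & _ & H); apply H. Qed.

Lemma quo_pt a b g g' : valid (TmEq G a b A) -> cenv G g g' ->
  den A g (pt (rz a g)) (pt (rz b g')).
Proof.
intros Ha Hg; apply (irr_pt G _ _ (content a g) _ (content b g'));
  [apply HQ|eapply cenv_l; [apply HQ|eauto]|].
apply (use_tm _ _ _ _ _ _ Ha Hg).
Qed.

Lemma quo_Cls g x v : cenv G g g -> den A g x (pt v) -> den A g x (pt (Cls v)).
Proof.
intros Hg H; assert (HP := quo_per _ Hg).
apply (per_sym _ HP), (per_exp_l _ _ _ v _ HP); [apply red_step; constructor|].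
now apply (per_sym _ HP).
Qed.

Lemma valid_Cls a : valid (Tm G a A) -> valid (Tm G (Cls a) (Quo A R)).
Proof.
intros Ha; assert (HG : vctx G) by apply HQ; split; [auto|split; [apply HQ|]].
intros g g' Hg; split; [|split; reflexivity].
assert (Hgg := cenv_l _ _ _ HG Hg); assert (HP := quo_per _ Hgg).
apply rQuo_intro; auto using quo_eq.
apply quo_Cls; auto; apply (per_sym _ HP), quo_Cls; auto; apply (per_sym _ HP).
now apply quo_pt.
Qed.

Lemma quo_rel a b g : valid (Tm G a A) -> valid (Tm G b A) -> cenv G g g ->
  (tr (den (at2 0 R a b) g) <->
   tr (den R (bind (pt (Cls (rz b g))) (bind (pt (Cls (rz a g))) g)))).
Proof.
intros Ha Hb Hg; assert (HP := quo_per _ Hg).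
rewrite den_at2_0, (val_pure _ _ _ _ _ _ Ha Hg), (val_pure _ _ _ _ _ _ Hb Hg).
assert (H : forall c, valid (Tm G c A) -> den A g (ev c g) (pt (Cls (rz c g)))).
{ intros c Hc; apply quo_Cls; auto.
  destruct HQ as (_ & _ & _ & _ & HI & _).
  apply (HI g (content c g) (content c g)); auto; apply (use_tm _ _ _ _ _ _ Hc Hg). }
split; apply (equiv_cong _ _ (quo_eq g Hg)); auto; apply (per_sym _ HP); auto.
Qed.

Lemma quo_pty a b : valid (Tm G a A) -> valid (Tm G b A) -> pty G (at2 0 R a b).
Proof.
intros Ha Hb; destruct HQ as (HG & _ & _ & HA & _ & HR & HI & _).
assert (E : forall g g', cenv G g g' ->
  cenv (wk 1 A :: A :: G) (scons (val b g) (scons (val a g) g))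
     (scons (val b g') (scons (val a g') g'))).
{ intros g g' Hg; apply cenv_cons; [apply cenv_cons; auto; eapply use_tm; eauto|].
  rewrite den_wk; apply (use_tm _ _ _ _ _ _ Hb Hg). }
split; [auto|split].
- intros g g' Hg; rewrite !den_at2_0; apply HR, E, Hg.
- intros g x y x' y' Hg; rewrite den_at2_0; apply HI, E, Hg.
Qed.

Lemma valid_Cls_eq a b p : valid (Tm G a A) -> valid (Tm G b A) ->
  valid (Tm G p (at2 0 R a b)) -> valid (TmEq G (Cls a) (Cls b) (Quo A R)).
Proof.
intros Ha Hb Hp; assert (HG : vctx G) by apply HQ; split; [auto|split; [apply HQ|]].
apply true_of in Hp; [|now apply quo_pty].
intros g g' Hg; assert (Hgg := cenv_l _ _ _ HG Hg).
assert (HP : per (den (Quo A R) g)) by (apply (use_per G); [apply HQ|auto]).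
apply (irel_trans _ _ (val (Cls b) g)); auto.
- split; [|split; reflexivity].
  split; [|split].
  + apply (use_tm _ _ _ _ _ _ (valid_Cls a Ha) Hgg).
  + apply (use_tm _ _ _ _ _ _ (valid_Cls b Hb) Hgg).
  + apply quo_rel; auto.
- apply (use_tm _ _ _ _ _ _ (valid_Cls b Hb) Hg).
Qed.

Lemma valid_Quo_eff a b p : proof_term p -> valid (Tm G a A) -> valid (Tm G b A) ->
  valid (TmEq G (Cls a) (Cls b) (Quo A R)) -> valid (Tm G p (at2 0 R a b)).
Proof.
intros Hp Ha Hb H; apply of_true; auto using quo_pty.
intros g Hg; apply quo_rel; auto; apply (use_tm _ _ _ _ _ _ H Hg).
Qed.

Variables (M l : expr).
Hypothesis (HM : valid (Ty KCol (Quo A R :: G) M))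
  (Hl : valid (Tm (A :: G) l (at1 1 M (Cls (Var 0)))))
  (Hl2 : valid (TmEq (R :: wk 1 A :: A :: G) (at1 3 l (Var 2)) (at1 3 l (Var 1))
            (at1 3 M (Cls (Var 2))))).

(** The compatibility premise of the eliminator, at two representatives of the
    same class. *)
Lemma quo_core g g' v w : cenv G g g' -> den (Quo A R) g (pt v) (pt w) ->
  irel (den M (bind (pt (Cls v)) g)) (val l (bind (pt v) g)) (val l (bind (pt w) g')).
Proof.
intros Hg (Hv & Hw & H); assert (HG : vctx G) by apply HQ.
assert (Hgg := cenv_l _ _ _ HG Hg).
assert (E : cenv (R :: wk 1 A :: A :: G)
  (bind (pt Star) (bind (pt w) (bind (pt v) g)))
  (bind (pt Star) (bind (pt w) (bind (pt v) g')))).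
{ apply cenv_bind; [apply cenv_bind; [now apply cenv_bind|rewrite den_wk; exact Hw]|].
  exact H. }
assert (K := use_tm _ _ _ _ _ _ Hl2 E).
rewrite den_at1, !val_at1, !val_Var in K; exact K.
Qed.

(** [Cls] is erased by reduction, so M(x) may be read at any realizer equal to
    that of a representative. *)
Lemma quo_M g x y : cenv G g g -> irel (den (Quo A R) g) y y ->
  den A g (pt (snd x)) (pt (snd (fst y))) ->
  den M (bind x g) = den M (scons y g).
Proof.
intros Hg Hy H; apply (use_vty (Quo A R :: G)); [apply HM|].
apply cenv_cons; auto; split; [|split; [reflexivity|apply Hy]].
apply rQuo_intro; auto using quo_eq, quo_per.
Qed.

Lemma valid_ElQuo p : valid (Tm G p (Quo A R)) -> valid (Tm G (ElQuo p l) (at1 0 M p)).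
Proof.
intros Hp; assert (HG : vctx G) by apply HQ; split; [auto|split].
- eapply sub1_veq; [apply HM | exact Hp].
- intros g g' Hg; assert (Hgg := cenv_l _ _ _ HG Hg).
  assert (H := use_tm _ _ _ _ _ _ Hp Hg).
  assert (K : irel (den (Quo A R) g) (val p g) (val p g)) by (apply (use_tm _ _ _ _ _ _ Hp Hgg)).
  destruct (quo_core g g' _ _ Hg (proj1 H)) as (X & _).
  assert (HP := quo_per _ Hgg).
  assert (E : den M (bind (pt (Cls (rz p g))) g) = den M (scons (val p g) g)).
  { apply quo_M; auto; apply (per_sym _ HP), quo_Cls; auto; apply (proj1 K). }
  rewrite den_at1_0; change (snd (fst (val p g))) with (rz p g) in X; rewrite E in X.
  split; [|split; reflexivity].
  apply (per_exp _ _ _ (rz l (bind (pt (rz p g)) g)) _ _ (rz l (bind (pt (rz p g')) g'))).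
  + apply (use_per (Quo A R :: G)); [apply HM|]; apply cenv_cons; auto.
  + rewrite rz_bind; apply red_step; constructor.
  + rewrite rz_bind; apply red_step; constructor.
  + exact X.
Qed.

Lemma valid_ElQuo_Cls a : valid (Tm G a A) ->
  valid (TmEq G (ElQuo (Cls a) l) (at1 0 l a) (at1 0 M (Cls a))).
Proof.
intros Ha; assert (HG : vctx G) by apply HQ; split; [auto|split].
- eapply sub1_veq; [apply HM | now apply valid_Cls].
- intros g g' Hg; assert (Hgg := cenv_l _ _ _ HG Hg).
  assert (HP := quo_per _ Hgg).
  assert (K := use_tm _ _ _ _ _ _ Ha Hg).
  assert (E : cenv (A :: G) (bind (pt (Cls (rz a g))) g) (scons (val a g') g')).
  { apply cenv_cons; auto; split; [|split; [reflexivity|apply K]].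
    apply (per_exp_l _ _ _ (rz a g) _ HP); [apply red_step; constructor|].
    destruct HQ as (_ & _ & _ & _ & HI & _); eapply HI; [auto|apply K]. }
  destruct (use_tm _ _ _ _ _ _ Hl E) as (X & X1 & X2).
  rewrite den_at1_1 in X.
  change (den M (bind (pt (Cls (Cls (rz a g)))) g) (ev l (bind (pt (Cls (rz a g))) g))
    (ev l (scons (val a g') g'))) in X.
  assert (KC : irel (den (Quo A R) g) (val (Cls a) g) (val (Cls a) g))
    by (apply (use_tm _ _ _ _ _ _ (valid_Cls a Ha) Hgg)).
  rewrite (quo_M g _ (val (Cls a) g)) in X; auto.
  + rewrite den_at1_0, val_at1_0; split; [|split; [reflexivity|exact X2]].
    apply (per_exp_l _ _ _ (rz l (bind (pt (Cls (rz a g))) g))).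
    * apply (use_per (Quo A R :: G)); [apply HM|]; apply cenv_cons; auto.
    * rewrite rz_bind; apply red_step; constructor.
    * exact X.
  + cbn [snd]; apply (per_sym _ HP), quo_Cls; auto; apply (proj1 KC).
Qed.
End Quo_rules.

(** * Soundness *)

Lemma valid_nil : valid (Cont []).
Proof. exact I. Qed.

Lemma valid_tmeq_sym G a b A : valid (TmEq G a b A) -> valid (TmEq G b a A).
Proof. apply vtm_sym. Qed.

Lemma valid_tmeq_trans G a b c A :
  valid (TmEq G a b A) -> valid (TmEq G b c A) -> valid (TmEq G a c A).
Proof. apply vtm_trans. Qed.

Lemma valid_tmeq_refl G a A : valid (Tm G a A) -> valid (TmEq G a a A).
Proof. auto. Qed.

Lemma valid_tmeq_conv G a b A B :
  valid (TmEq G a b A) -> valid (TyEq KCol G A B) -> valid (TmEq G a b B).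
Proof. intros H [_ E]; exact (vtm_conv _ _ _ _ _ H E). Qed.

Lemma valid_conv G a A B :
  valid (Tm G a A) -> valid (TyEq KCol G A B) -> valid (Tm G a B).
Proof. apply valid_tmeq_conv. Qed.

(* Unification should see judgements only, not their interpretation. *)
Opaque valid.

Ltac premise := multimatch goal with H : _ |- _ => exact H end.
Ltac by_rule r := solve [eapply r; premise].
Ltac by_prop r := solve [eapply r; first [solve [intros ?; reflexivity] | premise]].

(* The left side of a decoding rule is a type because the code is a term. *)
Ltac by_decoding r :=
  solve [eapply valid_decode; [apply valid_Tau; by_rule r | reflexivity]].

Theorem soundness T cl J : derivable T cl J -> valid J.
Proof.
induction 1.
- by_rule valid_nil.
- by_rule valid_cons.
- by_rule valid_var.
- by_rule valid_ty_sub.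
- by_rule valid_tyeq_sub.
- by_rule valid_tyeq_refl.
- by_rule valid_tyeq_sym.
- by_rule valid_tyeq_trans.
- by_rule valid_tmeq_refl.
- by_rule valid_tmeq_sym.
- by_rule valid_tmeq_trans.
- by_rule valid_conv.
- by_rule valid_tmeq_conv.
- by_rule valid_sub_nil.
- by_rule valid_sub_cons.
- by_rule valid_ty_subst.
- by_rule valid_tyeq_subst.
- by_rule valid_tm_subst.
- by_rule valid_tmeq_subst.
- by_rule valid_N0.
- by_rule valid_N1.
- by_rule valid_Lst.
- by_rule valid_tyeq_Lst.
- by_rule valid_Sum.
- by_rule valid_tyeq_Sum.
- by_rule valid_Sig.
- by_rule valid_tyeq_Sig.
- by_rule valid_Pi.
- by_rule valid_tyeq_Pi.
- by_rule valid_Omega.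
- by_rule valid_Pow.
- by_rule valid_tyeq_Pow.
- by_rule valid_Fls.
- by_rule valid_Or.
- by_rule valid_tyeq_Or.
- by_rule valid_And.
- by_rule valid_tyeq_And.
- by_rule valid_Imp.
- by_rule valid_tyeq_Imp.
- by_rule valid_Ex.
- by_rule valid_tyeq_Ex.
- by_rule valid_All.
- by_rule valid_tyeq_All.
- by_rule valid_Eqp.
- by_rule valid_tyeq_Eqp.
- by_rule valid_ElN0.
- by_rule valid_Star.
- by_rule valid_ElN1.
- by_rule valid_ElN1_Star.
- by_rule valid_Eps.
- by_rule valid_Cns.
- by_rule valid_ElLst.
- by_rule valid_ElLst_Eps.
- by_rule valid_ElLst_Cns.
- by_rule valid_Inl.
- by_rule valid_Inr.
- by_rule valid_ElSum.
- by_rule valid_ElSum_Inl.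
- by_rule valid_ElSum_Inr.
- by_rule valid_Pair.
- by_rule valid_ElSig.
- by_rule valid_ElSig_Pair.
- by_rule valid_Lam.
- by_rule valid_Ap.
- by_rule valid_beta.
- by_rule valid_Tau.
- by_rule valid_CFls.
- by_decoding valid_CFls.
- by_rule valid_COr.
- by_decoding valid_COr.
- by_rule valid_CAnd.
- by_decoding valid_CAnd.
- by_rule valid_CImp.
- by_decoding valid_CImp.
- by_rule valid_CEx.
- by_decoding valid_CEx.
- by_rule valid_CAll.
- by_decoding valid_CAll.
- by_rule valid_CEqp.
- by_decoding valid_CEqp.
- by_prop valid_ElFls.
- by_prop valid_OrL.
- by_prop valid_OrR.
- by_prop valid_ElOr.
- by_prop valid_ElOr_eq.
- by_prop valid_ElOr_eq.
- by_prop valid_AndI.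
- by_prop valid_And1.
- by_prop valid_And2.
- by_prop valid_proof_eq.
- by_prop valid_proof_eq.
- by_prop valid_ImpI.
- by_prop valid_ImpE.
- by_prop valid_ElOr_eq.
- by_prop valid_ExI.
- by_prop valid_ElEx.
- by_prop valid_ElEx_eq.
- by_prop valid_AllI.
- by_prop valid_AllE.
- by_prop valid_AllAp_eq.
- by_prop valid_IdI.
- by_prop valid_ElId.
- by_prop valid_ElId_eq.
- by_rule valid_xi.
- by_rule valid_eta.
- by_rule valid_Quo.
- by_rule valid_tyeq_Quo.
- by_rule valid_Cls.
- by_rule valid_Cls_eq.
- by_prop valid_Quo_eff.
- by_rule valid_ElQuo.
- by_rule valid_ElQuo_Cls.
- by_rule valid_PCls.
- by_rule valid_PCls_eq.
- by_prop valid_Pow1_eff.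
- by_rule valid_Eqp_Pow1.
- by_rule valid_Pow1_eta.
- by_prop valid_proof.
- by_rule valid_prop_irr.
- by_prop valid_ElFls.
- by_prop valid_OrL.
- by_prop valid_OrR.
- by_prop valid_ElOr.
- by_prop valid_AndI.
- by_prop valid_And1.
- by_prop valid_And2.
- by_prop valid_ImpI.
- by_prop valid_ImpE.
- by_prop valid_ExI.
- by_prop valid_ElEx.
- by_prop valid_AllI.
- by_prop valid_AllE.
- by_prop valid_IdI.
- by_rule valid_reflection.
- by_prop valid_Lem.
- by_prop valid_Lem.
Qed.

(** * A relation that no realizer computes *)

Definition leaves (n : nat) : list expr :=
  [Var n; N0; N1; PropS; Pow1; Fls; Star; Eps; CFls; Tru].
Definition unary (a : expr) : list expr :=
  [Lst a; Tau a; ElN0 a; Inl a; Inr a; Cls a; PCls a; ElFls a; OrL a; OrR a;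
   And1 a; And2 a; IdI a; Lem a].
Definition binary (a b : expr) : list expr :=
  [Sum a b; Sig a b; Pi a b; Quo a b; Or a b; And a b; Imp a b; Ex a b; All
   a b; ElN1 a b; Cns a b; Pair a b; ElSig a b; Lam a b; Ap a b; ElQuo a b;
   COr a b; CAnd a b; CImp a b; CEx a b; CAll a b; AndI a b; ImpLam a b;
   ImpAp a b; ExI a b; ElEx a b; AllLam a b; AllAp a b; ElId a b].
Definition ternary (a b c : expr) : list expr :=
  [Eqp a b c; ElLst a b c; ElSum a b c; CEqp a b c; ElOr a b c].

(** Generations are finite and increasing, and together exhaust the
    expressions, so a generation and a position in it index any expression;
    repetitions are harmless. *)
Fixpoint exprs (n : nat) : list expr :=
  match n with
  | 0 => []
  | S n =>
      let L := exprs n in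
      L ++ leaves n ++
      flat_map (fun a => unary a ++
        flat_map (fun b => binary a b ++
          flat_map (ternary a b) L) L) L
  end.

Lemma exprs_mono n m e : n <= m -> In e (exprs n) -> In e (exprs m).
Proof.
intros H He; induction H; auto; cbn [exprs]; apply in_or_app; auto.
Qed.

Lemma exprs_all e : exists n, In e (exprs n).
Proof.
assert (leaf : forall n e, In e (leaves n) -> exists m, In e (exprs m)).
{ intros n e' H; exists (S n); cbn [exprs]; rewrite !in_app_iff; auto. }
assert (un : forall e a, (exists n, In a (exprs n)) -> In e (unary a) ->
  exists m, In e (exprs m)).
{ intros e' a [n Ha] H; exists (S n); cbn [exprs]; rewrite !in_app_iff, in_flat_map.
  right; right; exists a; rewrite in_app_iff; auto. }
assert (bin : forall e a b, (exists n, In a (exprs n)) -> (exists n, In b (exprs n)) ->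
  In e (binary a b) -> exists m, In e (exprs m)).
{ intros e' a b [n Ha] [m Hb] H; exists (S (n + m)); cbn [exprs].
  apply (exprs_mono _ (n + m)) in Ha, Hb; try lia.
  rewrite !in_app_iff, in_flat_map; right; right; exists a; split; auto.
  rewrite in_app_iff, in_flat_map; right; exists b; rewrite in_app_iff; auto. }
assert (ter : forall e a b c, (exists n, In a (exprs n)) ->
  (exists n, In b (exprs n)) -> (exists n, In c (exprs n)) ->
  In e (ternary a b c) -> exists m, In e (exprs m)).
{ intros e' a b c [n Ha] [m Hb] [k Hc] H; exists (S (n + m + k)); cbn [exprs].
  apply (exprs_mono _ (n + m + k)) in Ha, Hb, Hc; try lia.
  rewrite !in_app_iff, in_flat_map; right; right; exists a; split; auto.
  rewrite in_app_iff, in_flat_map; right; exists b; split; auto.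
  rewrite in_app_iff, in_flat_map; right; exists c; auto. }
induction e; [exact (leaf n _ (or_introl eq_refl))|..];
  first
  [ apply (ter _ e1 e2 e3); [assumption..|cbn; tauto]
  | apply (bin _ e1 e2); [assumption..|cbn; tauto]
  | apply (un _ e); [assumption|cbn; tauto]
  | apply (leaf 0); cbn; tauto ].
Qed.

Definition enum (m : nat) : expr :=
  let (n, i) := of_nat m in nth i (exprs n) Star.

Lemma enum_surj e : exists m, enum m = e.
Proof.
destruct (exprs_all e) as [n H]; destruct (In_nth _ _ Star H) as (i & _ & Hi).
exists (to_nat (n, i)); unfold enum; now rewrite cancel_of_to.
Qed.

Inductive reads : expr -> nat -> Prop :=
| reads_0 v : red v Eps -> reads v 0
| reads_S v s c n : red v (Cns s c) -> reads s n -> reads v (S n).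

Lemma reads_fun v n m : reads v n -> reads v m -> n = m.
Proof.
intros H; revert m; induction H; intros m Hm; inversion Hm; subst; canon_inj; auto.
Qed.

Lemma lrel_reads R v v' : lrel R v v' -> exists n, reads v n /\ reads v' n.
Proof.
intros H; induction H as [v v' H H'|v v' s s' c c' H H' _ (n & Hn & Hn')].
- exists 0; split; now apply reads_0.
- exists (S n); split; eapply reads_S; eauto.
Qed.

Lemma reads_lrel v v' n : reads v n -> reads v' n -> lrel (crel True) v v'.
Proof.
intros H; revert v'; induction H; intros v' H'; inversion H'; subst.
- now apply lrel_Eps.
- eapply lrel_Cns; eauto; exact I.
Qed.

Fixpoint num (n : nat) : expr :=
  match n with 0 => Eps | S n => Cns (num n) Star end.

Lemma reads_num n : reads (num n) n.
Proof. induction n; [now apply reads_0 | exact (reads_S _ _ _ _ (red_refl _) IHn)]. Qed.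

Definition vanishes (m : nat) : Prop := reads (Ap (enum m) (num m)) 0.

(** Cantor's diagonal: at m, a value that the m-th program does not return. *)
Definition diag (m n : nat) : Prop :=
  (vanishes m /\ n = 1) \/ (~ vanishes m /\ n = 0).

Lemma diag_total m : exists n, diag m n.
Proof. destruct (classic (vanishes m)); [exists 1; left | exists 0; right]; auto. Qed.

Lemma diag_fun m n n' : diag m n -> diag m n' -> n = n'.
Proof. intros [[H ->]|[H ->]] [[H' ->]|[H' ->]]; tauto. Qed.

Lemma diag_untracked t : exists m, forall n, diag m n -> ~ reads (Ap t (num m)) n.
Proof.
destruct (enum_surj t) as [m <-]; exists m; intros n [[H ->]|[H ->]] Hn.
- discriminate (reads_fun _ _ _ H Hn).
- now apply H.
Qed.

(** The diagonal relation as a predicate on realizers of N x N, that is, as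
    the information of an element of N x N -> P(1). *)
Definition graph (w : expr) : Prop :=
  exists a b m n, red w (Pair a b) /\ reads a m /\ reads b n /\ diag m n.

Lemma graph_Pair a b m n : reads a m -> reads b n ->
  (graph (Pair a b) <-> diag m n).
Proof.
intros Ha Hb; split.
- intros (a' & b' & m' & n' & H & Ha' & Hb' & HD).
  assert (E : Pair a b = Pair a' b') by (apply (red_canon_eq (Pair a b)); auto).
  injection E as <- <-.
  now rewrite (reads_fun _ _ _ Ha Ha'), (reads_fun _ _ _ Hb Hb').
- intros HD; exists a, b, m, n; auto.
Qed.

(** * The instance of unique choice *)

(** The proposition given by an element of prop_s, resp. of P(1). *)
Definition tau (T : level) (u : expr) : expr :=
  match T with mTT => Tau u | emTT => Eqp Pow1 u (PCls Top) end.

Definition power (T : level) : expr := Arrow (Sig NN NN) (Omega T).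

(** P(x,y), for P the variable k. *)
Definition member (T : level) (k : nat) (x y : expr) : expr :=
  tau T (Ap (Var k) (Pair x y)).

Definition relation (T : level) (k : nat) : expr := member T k (Var 1) (Var 0).

(** The index is shifted by the two variables x and y of the relation. *)
Definition total (T : level) (k : nat) : expr := All NN (ExUniq (relation T (2 + k))).

(** That P is functional is a declared hypothesis, so that uniqueness and
    existence are derivable for a relation on which nothing else is known. *)
Definition context (T : level) : ctx := [total T 0; power T].

Section Derivations.
Variables (T : level) (cl : bool).
Local Notation "⊢ J" := (derivable T cl J) (at level 70, J at next level).

Lemma derivable_NN G : ⊢ Cont G -> ⊢ Ty KSet G NN.
Proof. intros H; now apply ty_Lst, ty_N1. Qed.

Lemma derivable_col k G A : is_col k -> ⊢ Ty k G A -> ⊢ Ty KCol G A.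
Proof. intros [-> | ->] H; auto; eapply ty_sub; eauto; constructor. Qed.

Lemma derivable_NN_col G : ⊢ Cont G -> ⊢ Ty KCol G NN.
Proof. intros H; apply (derivable_col KSet); [now right|now apply derivable_NN]. Qed.

Lemma derivable_cons_NN G : ⊢ Cont G -> ⊢ Cont (NN :: G).
Proof. intros H; now apply cont_cons, derivable_NN_col. Qed.

Lemma derivable_NxN G : ⊢ Cont G -> ⊢ Ty KSet G (Sig NN NN).
Proof.
intros H; apply ty_Sig; [now right|..]; apply derivable_NN; auto using derivable_cons_NN.
Qed.

Lemma derivable_power G : ⊢ Cont G -> ⊢ Ty KCol G (power T).
Proof. intros H; now apply ty_Pow, derivable_NxN. Qed.

Lemma derivable_member G k x y : ⊢ Cont G -> nth_error G k = Some (power T) ->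
  ⊢ Tm G x NN -> ⊢ Tm G y NN -> ⊢ Ty KProps G (member T k x y).
Proof.
intros HG Hk Hx Hy.
assert (H : ⊢ Tm G (Ap (Var k) (Pair x y)) (Omega T)).
{ rewrite <- (at1_wk (Omega T) (Pair x y)); apply (tm_Ap _ _ G (Sig NN NN)).
  - now apply derivable_power.
  - assert (E : wk (S k) (power T) = power T) by now destruct T.
    assert (Hv := tm_var T cl G k _ HG Hk); rewrite E in Hv; exact Hv.
  - apply tm_Pair; auto; apply derivable_NN_col; auto using derivable_cons_NN. }
unfold member, tau; destruct T eqn:ET; [now apply ty_Tau|].
apply ty_Eqp_Pow1; auto; apply tm_PCls; auto.
apply ty_Imp; [now right|..]; now apply ty_Fls.
Qed.

Lemma derivable_var_NN G n : ⊢ Cont G -> nth_error G n = Some NN -> ⊢ Tm G (Var n) NN.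
Proof. intros HG Hn; exact (tm_var T cl G n NN HG Hn). Qed.

Lemma derivable_relation G k : ⊢ Cont G -> nth_error G k = Some (power T) ->
  ⊢ Ty KProps (NN :: NN :: G) (relation T (2 + k)).
Proof.
intros HG Hk; assert (H : ⊢ Cont (NN :: NN :: G)) by now do 2 apply derivable_cons_NN.
apply derivable_member; auto; now apply derivable_var_NN.
Qed.

Lemma derivable_ExUniq G k : ⊢ Cont G -> nth_error G k = Some (power T) ->
  ⊢ Ty KProps (NN :: G) (ExUniq (relation T (2 + k))).
Proof.
intros HG Hk.
assert (Hs : is_prop KProps) by now right.
assert (HG1 := derivable_cons_NN _ HG); assert (HG2 := derivable_cons_NN _ HG1).
assert (HG3 := derivable_cons_NN _ HG2).
assert (HN : forall D, ⊢ Cont D -> ⊢ Ty (dom KProps) D NN) by apply derivable_NN.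
apply ty_And; auto; [apply ty_Ex; auto using derivable_relation|].
apply ty_All; auto; apply ty_All; auto; apply ty_Imp; auto.
- assert (E : forall j, at2 3 (relation T (2 + k)) (Var 2) (Var j) =
                member T (3 + k) (Var 2) (Var j)) by now destruct T.
  rewrite !E; apply ty_And; auto; apply derivable_member; auto; now apply derivable_var_NN.
- apply ty_Eqp; auto; now apply derivable_var_NN.
Qed.

Lemma derivable_total G k : ⊢ Cont G -> nth_error G k = Some (power T) ->
  ⊢ Ty KProp G (total T k).
Proof.
intros HG Hk; apply ty_All; [now left|now apply derivable_NN_col|].
apply (ty_sub _ _ KProps); [constructor|now apply derivable_ExUniq].
Qed.

Lemma derivable_context : ⊢ Cont (context T).
Proof.
assert (H : ⊢ Cont [power T]) by apply cont_cons, derivable_power, cont_nil.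
apply cont_cons, (ty_sub _ _ KProp); [constructor|now apply derivable_total].
Qed.

Lemma derivable_unique :
  exists p, ⊢ Tm (NN :: context T) p (ExUniq (relation T 3)).
Proof.
assert (HG := derivable_cons_NN _ derivable_context).
assert (Hh := tm_var T cl _ 1 (total T 0) HG eq_refl).
assert (E : wk 2 (total T 0) = All NN (ExUniq (relation T 4))) by now destruct T.
rewrite E in Hh.
assert (E' : at1 0 (ExUniq (relation T 4)) (Var 0) = ExUniq (relation T 3)) by now destruct T.
rewrite <- E'.
assert (HC : ⊢ Ty KProp (NN :: NN :: context T) (ExUniq (relation T 4))).
{ apply (ty_sub _ _ KProps); [constructor|now apply derivable_ExUniq]. }
assert (Hx := derivable_var_NN (NN :: context T) 0 HG eq_refl).
assert (HN := derivable_NN_col _ HG).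
destruct T eqn:ET.
- eexists; eapply tm_AllAp; eauto.
- exists Tru; apply (true_All_E _ _ _ NN); auto.
  apply (tm_Tru _ _ _ _ (Var 1)); auto; apply ty_All; auto; now left.
Qed.
End Derivations.

(** * The countermodel *)

Section Countermodel.
Variable T : level.

Definition diag_env : env :=
  bind (pt Star)
    (bind (dlam (fun w => dprop (graph w)), Star) (fun _ => (pt Star, none))).

Lemma tr_member k x y g : fst (fst (g k)) = dlam (fun w => dprop (graph w)) ->
  (tr (den (member T k x y) g) <-> graph (Pair (rz x g) (rz y g))).
Proof.
intros E.
assert (H : graph (Pair (rz x g) (rz y g)) <->
  holds (dapp (fst (fst (g k))) (Pair (rz x g) (rz y g)))) by now rewrite E.
rewrite H; destruct T; [reflexivity|].
change ((holds (dapp (fst (fst (g k))) (Pair (rz x g) (rz y g))) <->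
         (False -> False)) <-> holds (dapp (fst (fst (g k))) (Pair (rz x g) (rz y g)))).
tauto.
Qed.

Lemma total_diag k g : fst (fst (g k)) = dlam (fun w => dprop (graph w)) ->
  tr (den (total T k) g).
Proof.
intros Hk x Hx.
destruct (lrel_reads _ _ _ Hx) as (m & Hm & _); destruct (diag_total m) as [n Hn].
split.
- exists (pt (num n)); split; [exact (reads_lrel _ _ _ (reads_num n) (reads_num n))|].
  apply (tr_member (2 + k)); [exact Hk|].
  apply (graph_Pair _ _ m n); auto; apply reads_num.
- intros y Hy z Hz [H1 H2].
  assert (E : forall j, at2 3 (relation T (2 + k)) (Var 2) (Var j) =
                member T (3 + k) (Var 2) (Var j)) by now destruct T.
  rewrite E in H1, H2.
  apply (tr_member (3 + k)) in H1, H2; try exact Hk.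
  destruct (lrel_reads _ _ _ Hy) as (a & Ha & _), (lrel_reads _ _ _ Hz) as (b & Hb & _).
  apply (graph_Pair _ _ m a) in H1; auto.
  apply (graph_Pair _ _ m b) in H2; auto.
  rewrite (diag_fun _ _ _ H1 H2) in Ha.
  exact (reads_lrel _ _ _ Ha Hb).
Qed.

(** A function given by choice would be realized by some program, which errs
    at its own index. *)
Lemma no_choice : ~ tr (den (Choice (relation T 3)) diag_env).
Proof.
intros (f & Hf & H).
destruct (diag_untracked (snd f)) as (m & Hm).
assert (Hx := reads_lrel _ _ _ (reads_num m) (reads_num m)).
specialize (H (pt (num m)) Hx).
assert (E : at2 2 (relation T 3) (Var 0) (Ap (Var 1) (Var 0)) =
            member T 3 (Var 0) (Ap (Var 1) (Var 0))) by now destruct T.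
rewrite E in H; apply tr_member in H; [|reflexivity].
destruct (lrel_reads _ _ _ (Hf _ _ Hx)) as (n & Hn & _).
apply (graph_Pair _ _ m n) in H; [|apply reads_num|exact Hn].
exact (Hm n H Hn).
Qed.

(** The diagonal respects equality of realizers of N x N, as required of an
    element of a function collection; realizing it costs nothing, whence the
    arbitrary realizer in [diag_env]. *)
Lemma cenv_diag : cenv (context T) diag_env diag_env.
Proof.
apply cenv_bind; [apply cenv_bind; [exact I|]|now apply total_diag].
intros w w' (b & c & b' & c' & Hw & Hw' & Hb & Hc).
destruct (lrel_reads _ _ _ Hb) as (m & Hm & Hm'), (lrel_reads _ _ _ Hc) as (n & Hn & Hn').
assert (E : forall v a e, red v (Pair a e) -> reads a m -> reads e n -> (graph v <-> diag m n)).
{ intros v a e Hv Ha He; rewrite <- (graph_Pair a e m n Ha He).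
  split; intros (a' & e' & i & j & H & K).
  - exists a', e', i, j; split; [|exact K]; apply (red_canon v); auto.
  - exists a', e', i, j; split; [|exact K]; apply (red_canon v (Pair a e)); auto. }
assert (K : graph w <-> graph w') by (rewrite (E w b c), (E w' b' c'); tauto).
destruct T; exact K.
Qed.

Lemma refuted cl A : pirr (context T) A ->
  ~ tr (den A diag_env) -> ~ inhabited_in T cl (context T) A.
Proof.
intros HA HN [p Hp]; apply soundness in Hp.
exact (HN (true_elim _ _ _ _ HA Hp _ cenv_diag)).
Qed.

Lemma rule_fails cl : not_validates_rule T cl.
Proof.
exists (context T), (relation T 3); split; [|split].
- exact (derivable_relation T cl _ 1 (derivable_context T cl) eq_refl).
- apply derivable_unique.
- apply refuted; [|apply no_choice].
  intros g x y x' y' _ H; exact H.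
Qed.

Lemma axiom_fails cl : not_validates_axiom T cl.
Proof.
exists (context T), (relation T 3); split.
- exact (derivable_relation T cl _ 1 (derivable_context T cl) eq_refl).
- apply refuted.
  + intros g x y x' y' _ H; exact H.
  + intros H; apply no_choice, H; exact (total_diag 1 diag_env eq_refl).
Qed.
End Countermodel.

Theorem corollary6p8 :
  (not_validates_rule emTT true /\ not_validates_rule mTT true) /\
  (not_validates_axiom emTT true /\ not_validates_axiom mTT true).
Proof. auto using rule_fails, axiom_fails. Qed.
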